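(* Let $K$ be either a totally real or a CM number field with ring of integers $\mathcal{O}_K$, and let $L$ and $M$ be $\mathcal{O}_K$-lattices, spanning the $K$-vector spaces $E=KL$ and $F=KM$ respectively. Let $G\leq \operatorname{Aut}(L)$ and $H\leq \operatorname{Aut}(M)$ be subgroups such that $E$ is a multiplicity-free $K[G]$-module and $F$ is a multiplicity-free $K[H]$-module, and let $r$ and $s$ be the number of irreducible components of $E$ and $F$ respectively. If $\min(r,s)\leq 2$, then $$\mu_{min}(L\otimes_{\mathcal{O}_K} M)=\mu_{min}(L)\,\mu_{min}(M).$$
   Context: An $\mathcal{O}_K$-lattice is a pair $(L,(h_\sigma)_\sigma)$ where $L$ is a finitely generated projective $\mathcal{O}_K$-submodule of a finite-dimensional $K$-vector space $E$ containing a $K$-basis of $E$, and for each infinite place (embedding) $\sigma:K\hookrightarrow\mathbb{C}$, $h_\sigma$ is a positive definite Hermitian form on $E\otimes_{K,\sigma}\mathbb{C}$. Writing $L=\sum_{i=1}^\ell \mathfrak a_i b_i$ (pseudo-basis: fractional ideals $\mathfrak a_i$, $K$-basis $b_i$ of $E$), its volume is $\operatorname{vol}(L)=\mathrm{N}(\prod_i\mathfrak a_i)\prod_\sigma \det(h_\sigma(b_i,b_j))^{e_\sigma/2}$, with $e_\sigma=1$ or $2$ according as $\sigma$ is real or complex. The rank is $\dim_K E$, the slope is $\mu(L)=\operatorname{vol}(L)^{1/\operatorname{rk}L}$. A sublattice of $L$ means a primitive (pure) submodule $N$ (i.e. $L/N$ torsion free), with the restricted forms; $\mu_{min}(L)$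 is the minimum of $\mu(N)$ over nonzero sublattices $N$ of $L$. The tensor product $L\otimes_{\mathcal{O}_K}M$ is the $\mathcal{O}_K$-lattice in $E\otimes_K F$ with forms $h_\sigma\otimes h'_\sigma$, i.e. $(x\otimes y)\cdot(x'\otimes y')=h_\sigma(x,x')h'_\sigma(y,y')$. $\operatorname{Aut}(L)$ is the (finite) group of $\mathcal{O}_K$-module automorphisms of $L$ preserving all $h_\sigma$. A $K[G]$-module is multiplicity-free if it is a direct sum of pairwise non-isomorphic absolutely irreducible $K[G]$-submodules (absolutely irreducible: irreducible after extending scalars to an algebraic closure of $K$). *)

(* Defs.v *)
From HB Require Import structures.
From mathcomp Require Import all_boot all_order all_algebra all_field.
From mathcomp Require Import finmap boolp classical_sets functions cardinality.
From mathcomp Require Import reals exp complex mxtens.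

Set Implicit Arguments.
Unset Strict Implicit.
Unset Printing Implicit Defensive.

Import Order.TTheory GRing.Theory Num.Theory.

Local Open Scope classical_set_scope.
Local Open Scope ring_scope.

(* A number field is a [K : fieldExtType rat]; the complex numbers are [R[i]]
   for [R : realType]. *)

Section NumberField.
Context {R : realType}.

Definition real_embedding (K : fieldExtType rat) (sigma : {rmorphism K -> R[i]}) :=
  forall x : K, sigma x \is Num.real.

Definition totally_real (K : fieldExtType rat) :=
  forall sigma : {rmorphism K -> R[i]}, real_embedding sigma.

Definition totally_imaginary (K : fieldExtType rat) :=
  forall sigma : {rmorphism K -> R[i]}, ~ real_embedding sigma.

Definition CM_field (K : fieldExtType rat) :=
  totally_imaginary K /\
  exists F : {subfield K}, totally_real (subvs_of F) /\ (\dim_F {:K} = 2)%N.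

(* The infinite places of K, each given by one chosen embedding: every
   embedding is, up to complex conjugation, exactly one of the sigma p. *)
Definition infinite_places (K : fieldExtType rat) (P : finType)
    (sigma : P -> {rmorphism K -> R[i]}) :=
  forall tau : {rmorphism K -> R[i]},
    exists! p, (tau =1 sigma p) \/ (forall x, tau x = (sigma p x)^*).

Definition local_degree (K : fieldExtType rat) (sigma : {rmorphism K -> R[i]}) : nat :=
  if `[< real_embedding sigma >] then 1 else 2.

End NumberField.

Section Ideals.
Variable K : fieldExtType rat.

Definition OK : set K := [set x | integralOver (intr : int -> K) x].

Definition OK_submodule (V : lmodType K) (N : set V) :=
  [/\ N 0, forall x y, N x -> N y -> N (x + y)
    & forall a x, OK a -> N x -> N (a *: x)].

Definition fractional_ideal (a : set K) :=
  [/\ OK_submodule (V := K^o) a, exists2 x, a x & x != 0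
    & exists d, [/\ OK d, d != 0 & forall x, a x -> OK (d * x)]].

Definition ideal_mul (a b : set K) : set K :=
  [set x | exists2 t : seq (K * K),
     (forall u, u \in t -> a u.1 /\ b u.2) & x = \sum_(u <- t) u.1 * u.2].

(* [A : B] for additive subgroups B of A, as the number of cosets. *)
Definition coset_index (A B : set K) : nat :=
  #|` fset_set [set [set x + y | y in B] | x in A] |.

(* The absolute norm as a generalized index; for an integral ideal a it is
   the cardinality of O_K / a. *)
Definition ideal_norm (R : realType) (a : set K) : R :=
  (coset_index OK (OK `&` a))%:R / (coset_index a (OK `&` a))%:R.

End Ideals.
Arguments OK {K}.

Section Lattices.
Context {R : realType} {K : fieldExtType rat} {P : finType}.
Variable sigma : P -> {rmorphism K -> R[i]}.

(* A Hermitian form on E (x)_{K,tau} C is recorded through its restriction to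
   E x E, which is an arbitrary map that is tau-semilinear on the left and
   conjugate symmetric. Positivity has to be required on the whole of
   E (x)_{K,tau} C, i.e. on the complex combinations of a K-basis of E: on E
   alone it would be strictly weaker. *)
Definition gram (E : Type) (h : E -> E -> R[i]) n (b : 'I_n -> E) : 'M[R[i]]_n :=
  \matrix_(i, j) h (b i) (b j).

Definition std_basis (E : vectType K) : 'I_(\dim {:E}) -> E :=
  fun i => (vbasis {:E})`_i.

Definition pos_def_hermitian (E : vectType K) (tau : {rmorphism K -> R[i]})
    (h : E -> E -> R[i]) :=
  [/\ forall a x y z, h (a *: x + y) z = tau a * h x z + h y z,
      forall x y, h y x = (h x y)^*
    & forall c : 'rV[R[i]]_(\dim {:E}), c != 0 ->
        0 < (c *m gram h (@std_basis E) *m (map_mx Num.conj c)^T) 0 0].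

(* L is isomorphic to a direct summand of a free module O_K^n, with inclusion
   f and retraction g. *)
Definition fg_projective (E : vectType K) (L : set E) :=
  exists n (f : E -> 'rV[K]_n) (g : 'rV[K]_n -> E),
    let OKn := [set v : 'rV[K]_n | forall i, OK (v 0 i)] in
    [/\ forall x, L x -> OKn (f x),
        forall v, OKn v -> L (g v),
        forall a x y, OK a -> L x -> L y -> f (a *: x + y) = a *: f x + f y,
        forall a v w, OK a -> OKn v -> OKn w -> g (a *: v + w) = a *: g v + g w
      & forall x, L x -> g (f x) = x].

Definition OK_lattice (E : vectType K) (L : set E) (h : P -> E -> E -> R[i]) :=
  [/\ OK_submodule L, fg_projective L,
      exists2 b : seq E, basis_of {:E} b & forall x, x \in b -> L x
    & forall p, pos_def_hermitian (sigma p) (h p)].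

(* The smallest K-subspace containing N. *)
Definition Kspan (E : vectType K) (N : set E) : {vspace E} :=
  xget 0%VS [set U : {vspace E} | (forall x, N x -> x \in U) /\
    forall W : {vspace E}, (forall x, N x -> x \in W) -> (U <= W)%VS].

Definition rank (E : vectType K) (N : set E) : nat := \dim (Kspan N).

Definition pseudo_basis (E : vectType K) (N : set E) l
    (a : 'I_l -> set K) (b : 'I_l -> E) :=
  [/\ forall i, fractional_ideal (a i),
      basis_of (Kspan N) [seq b i | i <- enum 'I_l]
    & N = [set x | exists2 c : 'I_l -> K,
             (forall i, a i (c i)) & x = \sum_i c i *: b i]].

Definition pseudo_vol (E : vectType K) (h : P -> E -> E -> R[i]) l
    (a : 'I_l -> set K) (b : 'I_l -> E) : R :=
  ideal_norm R (\big[@ideal_mul K/OK]_(i < l) a i) *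
  \prod_p (complex.Re (\det (gram (h p) b))) `^ ((local_degree (sigma p))%:R / 2).

(* The value does not depend on the pseudo-basis; [xget] picks it out. *)
Definition vol (E : vectType K) (h : P -> E -> E -> R[i]) (N : set E) : R :=
  xget 0 [set v | exists l (a : 'I_l -> set K) (b : 'I_l -> E),
                    pseudo_basis N a b /\ v = pseudo_vol h a b].

Definition slope (E : vectType K) (h : P -> E -> E -> R[i]) (N : set E) : R :=
  vol h N `^ (rank N)%:R^-1.

(* Submodules N of L with L / N torsion free. *)
Definition sublattice (E : vectType K) (L N : set E) :=
  [/\ OK_submodule N, N `<=` L
    & forall a x, OK a -> a != 0 -> L x -> N (a *: x) -> N x].

Definition slopes (E : vectType K) (h : P -> E -> E -> R[i]) (L : set E) : set R :=
  [set m | exists N, [/\ sublattice L N, exists2 x, N x & x != 0 & m = slope h N]].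

(* The minimum of [slopes h L]. The default value 0 is only used when the set
   of slopes has no least element, as for L = 0. *)
Definition mu_min (E : vectType K) (h : P -> E -> E -> R[i]) (L : set E) : R :=
  xget 0 [set m | slopes h L m /\ lbound (slopes h L) m].

(* E (x)_K F in coordinates with respect to the fixed K-bases of E and F. *)
Definition tensor (E F : vectType K) : vectType K :=
  'rV[K]_(\dim {:E} * \dim {:F}).

Definition tens (E F : vectType K) (x : E) (y : F) : tensor E F :=
  passmx.rVof (vbasis {:E}) x *t passmx.rVof (vbasis {:F}) y.

Definition tensor_form (E F : vectType K) (h : P -> E -> E -> R[i])
    (h' : P -> F -> F -> R[i]) : P -> tensor E F -> tensor E F -> R[i] :=
  fun p u v =>
    (map_mx (sigma p) u *m (gram (h p) (@std_basis E) *t gram (h' p) (@std_basis F))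
       *m (map_mx Num.conj (map_mx (sigma p) v))^T) 0 0.

Definition tensor_lattice (E F : vectType K) (L : set E) (M : set F) :
    set (tensor E F) :=
  [set u | exists2 t : seq (E * F), (forall z, z \in t -> L z.1 /\ M z.2) &
     u = \sum_(z <- t) tens z.1 z.2].

Section TensorForm.
Variables (E F : vectType K) (h : P -> E -> E -> R[i]) (h' : P -> F -> F -> R[i]).

Lemma gram_formE (V : vectType K) (tau : {rmorphism K -> R[i]})
    (k : V -> V -> R[i]) : pos_def_hermitian tau k -> forall x y,
  (map_mx tau (passmx.rVof (vbasis {:V}) x) *m gram k (@std_basis V) *m
     (map_mx Num.conj (map_mx tau (passmx.rVof (vbasis {:V}) y)))^T) 0 0 = k x y.
Proof.
move=> [klin kherm _] x y.
have k0 z : k 0 z = 0.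
  have := klin 1 0 0 z; rewrite scaler0 addr0 rmorph1 mul1r => /eqP.
  by rewrite -subr_eq0 opprD addNKr oppr_eq0 => /eqP.
have kl n (c : 'I_n -> K) (b : 'I_n -> V) z :
    k (\sum_i c i *: b i) z = \sum_i tau (c i) * k (b i) z.
  elim/big_rec2: _ => [|i u v _ <-]; first exact: k0.
  by rewrite klin.
have xE z : z = \sum_i coord (vbasis {:V}) i z *: std_basis i.
  exact: (coord_basis (vbasisP _) (memvf z)).
rewrite [in RHS](xE x) [in RHS](xE y) kl -mulmxA mxE; apply: eq_bigr => i _.
rewrite !mxE; congr (_ * _); rewrite kherm kl rmorph_sum; apply: eq_bigr => j _.
by rewrite !mxE (kherm (std_basis j)) mulrC -rmorphM.
Qed.

Lemma tensor_formE : (forall p, pos_def_hermitian (sigma p) (h p)) ->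
  (forall p, pos_def_hermitian (sigma p) (h' p)) ->
  forall p x x' y y',
  tensor_form h h' p (tens x y) (tens x' y') = h p x x' * h' p y y'.
Proof.
move=> hH hH' p x x' y y'.
rewrite -(gram_formE (hH p)) -(gram_formE (hH' p)) /tensor_form /tens.
set X := passmx.rVof _ x; set X' := passmx.rVof _ x'.
set Y := passmx.rVof _ y; set Y' := passmx.rVof _ y'.
set A := gram _ _; set B := gram _ _.
have tensE : map_mx (sigma p) (X *t Y) *m (A *t B) *m
    (map_mx Num.conj (map_mx (sigma p) (X' *t Y')))^T =
  (map_mx (sigma p) X *m A *m (map_mx Num.conj (map_mx (sigma p) X'))^T) *t
  (map_mx (sigma p) Y *m B *m (map_mx Num.conj (map_mx (sigma p) Y'))^T).
  by rewrite !map_mxT trmx_tens !tensmx_mul.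
transitivity ((map_mx (sigma p) (X *t Y) *m (A *t B) *m
    (map_mx Num.conj (map_mx (sigma p) (X' *t Y')))^T) ord0 ord0).
  by [].
by rewrite tensE mxE !ord1.
Qed.

End TensorForm.

End Lattices.

Section Groups.
Context {R : realType} {K : fieldExtType rat} {P : finType}.

(* An O_K-automorphism of L extends uniquely to a K-linear map on E = KL. *)
Definition Aut_lattice (E : vectType K) (L : set E) (h : P -> E -> E -> R[i]) :
    set 'End(E) :=
  [set g | [set g x | x in L] = L /\ forall p x y, h p (g x) (g y) = h p x y].

Definition subgroup (E : vectType K) (G A : set 'End(E)) :=
  [/\ G `<=` A, G \1%VF, forall f g, G f -> G g -> G (f \o g)%VF
    & forall g, G g -> G (g^-1)%VF].

Definition stable (E : vectType K) (G : set 'End(E)) (U : {vspace E}) :=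
  forall g, G g -> (g @: U <= U)%VS.

(* Matrix of g on the g-stable subspace U, acting on row vectors. *)
Definition restr_mx (E : vectType K) (U : {vspace E}) (g : 'End(E)) :
    'M[K]_(\dim U) :=
  \matrix_(i, j) coord (vbasis U) j (g (vbasis U)`_i).

(* [algC], being an algebraic closure of Q, is an algebraic closure of K
   through any embedding of K; U (x)_K algC is 'rV[algC]_(\dim U). *)
Definition absolutely_irreducible (E : vectType K) (G : set 'End(E))
    (U : {vspace E}) :=
  [/\ stable G U, (0 < \dim U)%N &
    exists iota : {rmorphism K -> algC},
    forall W : 'M[algC]_(\dim U),
      (forall g, G g -> stablemx W (map_mx iota (restr_mx U g))) ->
      W != 0 -> row_full W].

Definition KG_isomorphic (E : vectType K) (G : set 'End(E)) (U V : {vspace E}) :=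
  exists f : 'End(E), [/\ (f @: U = V)%VS, {in U &, injective f}
    & forall g x, G g -> x \in U -> f (g x) = g (f x)].

(* E is the direct sum of r pairwise non-isomorphic absolutely irreducible
   K[G]-submodules. *)
Definition multiplicity_free (E : vectType K) (G : set 'End(E)) (r : nat) :=
  exists U : 'I_r -> {vspace E},
    [/\ forall i, absolutely_irreducible G (U i),
        forall i j, i != j -> ~ KG_isomorphic G (U i) (U j),
        (\sum_i U i)%VS = {:E}%VS & directv (\sum_i U i)].

End Groups.

(* Main.v *)
(** For a K-subspace U of E put f(U) = log vol(L ∩ U).  By the
    Koteljanskii determinant inequality f is submodular:
    f(U ∩ W) + f(U + W) <= f(U) + f(W); it is also invariant under Aut(L).
    If f - c dim is nonnegative on stable subspaces, it is nonnegative
    everywhere, because an almost minimiser U that is not stable can be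
    replaced by the larger U + gU.  So log mu_min is the minimum of f / dim over
    the nonzero stable subspaces, of which there are finitely many in the
    multiplicity-free case, and it remains to bound f_T(W) from below for the
    G x H-stable subspaces W of E ⊗ F.  By Schur's lemma W = ∑ U_i ⊗ X_i with
    U_i the components of E and X_i H-stable; when F = V1 ⊕ V2 has at most two
    components, W = A ⊗ V1 + B ⊗ V2.  If dim B <= dim A, submodularity for
    W and E ⊗ V1, the equality case of Koteljanskii for E ⊗ V1 and B ⊗ F,
    and vol(A ⊗ B) = vol(A)^dim(B) vol(B)^dim(A) give
    f_T(W) >= (log mu_min(L) + log mu_min(M)) dim W.  The other cases are
    symmetric. *)

(* Nothing guarantees in advance that the slopes have a least element, so the descent to stable
   subspaces works with an infimum I of f - c dim. It is finite because every U has a complement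
   among finitely many coordinate subspaces. If U is within e of I, then the value at U ∩ gU is at
   least I, so U + gU is within 2e of I. The dimension grows each time, so the error doubles at most
   dim E times and can be fixed beforehand.

   For W = A ⊗ V1 + B ⊗ V2 the inequalities combine to f_T(W) >= f(A) dim V1 + f(B) dim V2 + (dim A
   - dim B) f(V1) + dim B f(F). The lower bound for f(V1) can be inserted only because dim A - dim B
   >= 0.

   Most of the text makes [vol] usable. Modules over O_K need not be free, so pseudo-bases are built
   by splitting off one fractional ideal at a time, which rests on the invertibility of fractional
   ideals; the comparison of two pseudo-bases rests on the multiplicativity of the ideal norm. *)
From HB Require Import structures.
Require Import Defs.
From mathcomp Require Import all_boot all_order all_algebra all_field.
From mathcomp Require Import finmap boolp classical_sets functions cardinality.
From mathcomp Require Import reals sequences exp complex mxtens.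
From mathcomp Require Import perm lra.

Set Implicit Arguments.
Unset Strict Implicit.
Unset Printing Implicit Defensive.

Import Order.TTheory GRing.Theory Num.Theory.

Local Open Scope classical_set_scope.
Local Open Scope ring_scope.

(** * Indices of subgroups *)

Section Index.
Variable V : zmodType.
Implicit Types A B C : set V.

Definition subgrp A := A 0 /\ forall x y, A x -> A y -> A (x - y).

(* [A : B] = k, witnessed by a transversal. *)
Definition has_index A B (k : nat) := exists (I : finType) (r : I -> V),
  [/\ #|I| = k, forall i, A (r i), forall x, A x -> exists i, B (x - r i)
    & forall i j, B (r i - r j) -> i = j].

Lemma subgrpN A x : subgrp A -> A x -> A (- x).
Proof. by case=> A0 AB Ax; rewrite -sub0r; apply: AB. Qed.

Lemma subgrpD A x y : subgrp A -> A x -> A y -> A (x + y).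
Proof. by move=> sA Ax Ay; rewrite -[y]opprK; apply: (proj2 sA) => //; apply: subgrpN. Qed.

Lemma subgrpC A x y : subgrp A -> A (x - y) -> A (y - x).
Proof. by move=> sA /(subgrpN sA); rewrite opprB. Qed.

Lemma subgrp_trans A x y z : subgrp A -> A (x - y) -> A (y - z) -> A (x - z).
Proof. by move=> sA Axy Ayz; rewrite -(subrK y x) -addrA; apply: subgrpD. Qed.

Lemma subgrpI A B : subgrp A -> subgrp B -> subgrp (A `&` B).
Proof.
by move=> [A0 AB] [B0 BB]; split=> [//|x y [? ?] [? ?]]; split; [apply: AB|apply: BB].
Qed.

(** Sending each member of one transversal to the member of the other in the same coset is
    injective. *)
Lemma has_index_leq A B k l : subgrp B -> has_index A B k -> has_index A B l ->
  (k <= l)%N.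
Proof.
move=> sB [I [r [<- rA _ rI]]] [J [s [<- _ sA _]]].
have /(_ _)/cid f i := sA _ (rA i).
apply: (leq_card (fun i => projT1 (f i))) => i j eij; apply: rI.
have := projT2 (f j); rewrite -eij; move/(subgrpC sB).
exact: subgrp_trans (projT2 (f i)).
Qed.

Lemma has_index_uniq A B k l : subgrp B -> has_index A B k -> has_index A B l ->
  k = l.
Proof.
by move=> sB ik il; apply/eqP; rewrite eqn_leq !(@has_index_leq A B).
Qed.

Lemma has_index_trans A B C k l : subgrp A -> B `<=` A -> subgrp B -> subgrp C -> C `<=` B ->
  has_index A B k -> has_index B C l -> has_index A C (k * l).
Proof.
move=> sA BA sB sC CB [I [r [<- rA Ar rI]]] [J [s [<- sJ Js sI]]].
exists (I * J)%type, (fun u => r u.1 + s u.2); split.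
    by rewrite card_prod.
  by move=> u; apply: subgrpD => //; apply: BA.
  move=> x /Ar[i xi]; have [j xj] := Js _ xi; exists (i, j).
  by rewrite opprD addrA.
move=> [i j] [i' j'] /= c.
have ii : i = i'.
  apply: rI.
  have -> : r i - r i' = (r i + s j - (r i' + s j')) + (s j' - s j).
    by rewrite opprD [r i + s j + _]addrACA -(opprB (s j) (s j')) addrK.
  by apply: subgrpD (CB _ c) _ => //; apply: (proj2 sB).
move: c; rewrite ii opprD addrACA subrr add0r => /sI ->//.
Qed.

Lemma has_index_mid A B C m : subgrp B -> subgrp C -> C `<=` B -> B `<=` A ->
  has_index A C m -> exists k l, [/\ has_index A B k, has_index B C l & (0 < m -> 0 < k /\ 0 < l)%N].
Proof.
move=> sB sC CB BA [I [r [cI rA Ar rI]]].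
pose e i := `[< B (r i) >].
(* [cn i] is a canonical index in the B-coset of [r i]. The fixed points of [cn] represent A/B, and
   the indices satisfying [e] represent B/C. *)
pose cn i := odflt i [pick j | `[< B (r i - r j) >]].
have cnP i : B (r i - r (cn i)).
  rewrite /cn; case: pickP => [j /asboolP //|/(_ i)].
  by rewrite subrr; move/asboolPn; have [] := sB.
have cnE i j : B (r i - r j) -> cn i = cn j.
  move=> Bij; rewrite /cn.
  have eq1 : (fun k => `[< B (r i - r k) >]) =1 (fun k => `[< B (r j - r k) >]).
    move=> k; apply/asbool_equiv_eq; split=> h.
      by apply: subgrp_trans h => //; apply: subgrpC.
    exact: subgrp_trans h.
  rewrite (eq_pick eq1); case: pickP => [//|/(_ j)].
  by rewrite subrr; move/asboolPn; have [] := sB.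
have kA : has_index A B #|{: {i | cn i == i}}|.
  exists {: {i | cn i == i}}, (fun u => r (val u)); split=> // [x /Ar[i xi]|u v /cnE].
    have ci : cn (cn i) == cn i by apply/eqP/esym/cnE/cnP.
    exists (exist _ (cn i) ci) => /=.
    apply: subgrp_trans (cnP i) => //; exact: CB.
  by rewrite (eqP (valP u)) (eqP (valP v)) => /val_inj.
have lB : has_index B C #|{: {i | e i}}|.
  exists {: {i | e i}}, (fun u => r (val u)); split=> //.
      by move=> u; apply/asboolP/(valP u).
    move=> x Bx; have [i xi] := Ar _ (BA _ Bx).
    have ei : e i.
      apply/asboolP; rewrite -[r i](subKr x); apply: (proj2 sB) => //.
      exact: CB.
    by exists (exist _ i ei).
  by move=> u v /rI/val_inj.
exists #|{: {i | cn i == i}}|, #|{: {i | e i}}|; split => //.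
rewrite -cI => /card_gt0P[i _]; split; apply/card_gt0P.
  by have ci : cn (cn i) == cn i; [apply/eqP/esym/cnE/cnP | exists (exist _ (cn i) ci)].
have [j] := Ar _ (BA _ (proj1 sB)); rewrite sub0r => /(subgrpN sC); rewrite opprK => /CB Bj.
by have ej : e j; [apply/asboolP | exists (exist _ j ej)].
Qed.

Lemma has_index1 A : subgrp A -> has_index A A 1.
Proof.
move=> sA; exists unit, (fun=> 0); split=> //; first by rewrite card_unit.
- by case: sA.
- by move=> x Ax; exists tt; rewrite subr0.
- by case=> [[]].
Qed.

Lemma has_index1_eq A B : subgrp A -> subgrp B -> B `<=` A -> has_index A B 1 -> A = B.
Proof.
move=> sA sB BA [I [r [cI rA Ar rI]]]; apply/seteqP; split=> // x Ax.
have [i xi] := Ar _ Ax; have [j rj] := Ar _ (proj1 sA).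
have ij : i = j.
  have /card_le1_eqP c : (#|I| <= 1)%N by rewrite cI.
  by apply: c.
rewrite -[x](subrK (r i)); apply: subgrpD => //.
by move: (subgrpN sB rj); rewrite sub0r opprK ij.
Qed.

Lemma has_index_gt0 A B k : subgrp A -> has_index A B k -> (0 < k)%N.
Proof.
by move=> [A0 _] [I [r [<- _ Ar _]]]; have [i _] := Ar _ A0; apply/card_gt0P; exists i.
Qed.

End Index.

Lemma has_index_image (V W : zmodType) (f : {additive V -> W}) (A B : set V) k :
  injective f -> has_index A B k -> has_index (f @` A) (f @` B) k.
Proof.
move=> fI [I [r [cI rA Ar rI]]]; exists I, (f \o r); split=> //.
- by move=> i; exists (r i).
- move=> _ [x Ax <-]; have [i xi] := Ar _ Ax; exists i.
  by exists (x - r i) => //; rewrite raddfB.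
- by move=> i j [x Bx] /=; rewrite -raddfB => /fI e; apply: rI; rewrite -e.
Qed.

Lemma subgrp_image (V W : zmodType) (f : {additive V -> W}) (A : set V) :
  subgrp A -> subgrp (f @` A).
Proof.
move=> [A0 AB]; split; first by exists 0; rewrite ?raddf0.
by move=> _ _ [x Ax <-] [y Ay <-]; exists (x - y); rewrite ?raddfB //; apply: AB.
Qed.

(** * The index of the row lattice of an integer matrix *)

Section IntegerMatrices.
Variable n : nat.

Definition mx_lattice (M : 'M[int]_n) : set 'rV[int]_n := [set v *m M | v in setT].

Lemma subgrp_mx_lattice M : subgrp (mx_lattice M).
Proof.
split; first by exists 0; rewrite ?mul0mx.
by move=> _ _ [x _ <-] [y _ <-]; exists (x - y); rewrite ?mulmxBl.
Qed.

Let good (M : 'M[int]_n) := has_index [set: 'rV[int]_n] (mx_lattice M) `|\det M|.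

Lemma mulmx_int_inj (M : 'M[int]_n) : \det M != 0 ->
  injective (mulmxr M : 'rV_n -> 'rV_n).
Proof.
move=> nzM u v /= /(congr1 (mulmxr (\adj M))) /=.
rewrite -!mulmxA mul_mx_adj !mul_mx_scalar => e; apply/rowP => i.
have /rowP/(_ i) := e; rewrite !mxE => /eqP.
by rewrite (inj_eq (mulfI nzM)) => /eqP.
Qed.

Let goodM M N : \det N != 0 -> good M -> good N -> good (M *m N).
Proof.
move=> nzN gM gN; rewrite /good det_mulmx abszM mulnC.
apply: has_index_trans gN _ => //; try exact: subgrp_mx_lattice.
  by move=> _ [v _ <-]; exists (v *m M); rewrite ?mulmxA.
have := has_index_image (f := mulmxr N : {additive 'rV_n -> 'rV_n}) (mulmx_int_inj nzN) gM.
congr has_index; apply/seteqP; split.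
  by move=> _ [_ [v _ <-] <-]; exists v; rewrite ?mulmxA.
by move=> _ [v _ <-]; exists (v *m M); [exists v | rewrite /= mulmxA].
Qed.

Let good_unit M : M \in unitmx -> good M.
Proof.
move=> uM; rewrite /good.
have -> : `|\det M|%N = 1%N.
  by move: uM; rewrite unitmxE qualifE /= => /orP[] /eqP ->.
have -> : mx_lattice M = setT.
  by apply/seteqP; split=> // v _; exists (v *m invmx M); rewrite ?mulmxKV.
exact: has_index1.
Qed.

Let good_diag (d : 'rV[int]_n) : \prod_i d 0 i != 0 -> good (diag_mx d).
Proof.
move=> /prodf_neq0 nzd; rewrite /good det_diag.
exists {dffun forall i : 'I_n, 'I_`|d 0 i|}.
exists (fun f : {dffun forall i : 'I_n, 'I_`|d 0 i|} => \row_i (nat_of_ord (f i))%:Z); split=> //.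
- rewrite card_dep_ffun (big_morph absz abszM (erefl _)).
  rewrite -big_enum /= /image_mem; elim: (enum _) => [|i s IH] /=.
    by rewrite big_nil.
  by rewrite big_cons -IH card_ord.
- move=> x _.
  have lt i : (`|modz (x ord0 i) (d ord0 i)| < `|d ord0 i|)%N.
    by rewrite -ltz_nat !abszE ger0_norm ?modz_ge0 ?ltz_mod ?nzd.
  exists [ffun i => Ordinal (lt i)].
  exists (\row_i divz (x ord0 i) (d ord0 i)) => //.
  apply/rowP => i; rewrite mul_mx_diag !mxE ffunE /=.
  by rewrite abszE ger0_norm ?modz_ge0 ?nzd // {2}(divz_eq (x ord0 i) (d ord0 i)) addrK.
- move=> f g [v _ /rowP e]; apply/ffunP => i; apply/val_inj => /=.
  have := e i; rewrite mul_mx_diag !mxE.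
  have := ltn_ord (f i); have := ltn_ord (g i).
  move: (nat_of_ord (f i)) (nat_of_ord (g i)) (v 0 i) (nzd i isT) => a b q nz lb la eq.
  have ma (c : nat) : (c < `|d ord0 i|)%N -> modz c%:Z (d 0 i) = c.
    by move=> lc; rewrite -modz_abs modz_nat modn_small.
  apply/eqP; rewrite -eqz_nat -(ma a la) -(ma b lb) -(subrK b%:Z a%:Z) -eq.
  by rewrite modzMDl.
Qed.

(** The Smith normal form reduces this to unimodular matrices, whose lattice is everything, and to
    diagonal ones, where the vectors of residues form a transversal. Indices multiply along products
    because a nonsingular matrix acts injectively. *)
Lemma mx_lattice_index (M : 'M[int]_n) : \det M != 0 ->
  has_index [set: 'rV[int]_n] (mx_lattice M) `|\det M|.
Proof.
have [L uL [R uR [d _ ->]]] := int_Smith_normal_form M.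
have -> : \matrix_(i, j) (d`_i *+ (i == j :> nat)) = diag_mx (\row_i d`_i) :> 'M_n.
  by apply/matrixP => i j; rewrite !mxE.
rewrite !det_mulmx !mulf_eq0 !negb_or => /andP[/andP[nL nD] nR].
rewrite -!det_mulmx; apply: (goodM nR _ (good_unit uR)).
apply: (goodM nD (good_unit uL)).
by apply: good_diag; rewrite det_diag in nD.
Qed.

End IntegerMatrices.

(** * Integers of a number field *)

Section RingOfIntegers.
Variable K : fieldExtType rat.
Local Notation O := (@OK K).
Implicit Types x y : K.

Lemma OK0 : O 0. Proof. exact: integral0. Qed.
Lemma OK1 : O 1. Proof. exact: integral1. Qed.
Lemma OKB x y : O x -> O y -> O (x - y). Proof. exact: integral_sub. Qed.
Lemma OKD x y : O x -> O y -> O (x + y). Proof. exact: integral_add. Qed.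
Lemma OKN x : O x -> O (- x). Proof. exact: integral_opp. Qed.
Lemma OKM x y : O x -> O y -> O (x * y). Proof. exact: integral_mul. Qed.
Lemma OK_int (m : int) : O m%:~R. Proof. exact: integral_id. Qed.
Lemma OK_nat n : O n%:R. Proof. exact: integral_nat. Qed.

Lemma subgrp_OK : subgrp O. Proof. by split; [exact: OK0 | exact: OKB]. Qed.

Lemma OK_sum (I : Type) (s : seq I) (Q : pred I) (f : I -> K) :
  (forall i, Q i -> O (f i)) -> O (\sum_(i <- s | Q i) f i).
Proof. by move=> h; apply: big_ind => //; [exact: OK0 | exact: OKD]. Qed.

Lemma intr_eq0K (m : int) : (m%:~R == 0 :> K) = (m == 0).
Proof.
have -> : m%:~R = (in_alg K) m%:~R by rewrite rmorph_int.
by rewrite fmorph_eq0 intr_eq0.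
Qed.

Lemma natr_eq0K n : (n%:R == 0 :> K) = (n == 0)%N.
Proof. by rewrite -[n%:R]/(n%:Z%:~R) intr_eq0K. Qed.

Lemma intr_scale (c : int) y : (c%:~R : rat) *: y = c%:~R * y.
Proof. rewrite -mulr_algl; congr (_ * _); exact: (rmorph_int (in_alg K)). Qed.

(* Clearing denominators in the coefficients of the minimal polynomial. *)
Lemma integral_multiple x : exists2 m : int, m != 0 & O (m%:~R * x).
Proof.
have /polyOver1P[p Dp] := minPolyOver 1%AS x.
have [q [c nzc Dq]] := rat_poly_scale p.
have monm := monic_minPoly 1%AS x; have rx := minPolyxx 1%AS x.
have sm := size_minPoly 1%AS x; set n := adjoin_degree _ x in sm.
set m := minPoly _ x in Dp monm rx sm.
have Oq k : O (c%:~R * m`_k).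
  rewrite Dp coef_map Dq coefZ coef_map /= -[c%:~R](rmorph_int (in_alg K)) -rmorphM mulrA.
  by rewrite divff ?intr_eq0 // mul1r rmorph_int; apply: OK_int.
(* [P] is c^n m(X/c): monic, with root c x. Each coefficient below the top contains a factor c,
   which makes it integral by [Oq]. *)
exists c => //; pose P := \poly_(k < n.+1) (c%:~R ^+ (n - k) * m`_k).
have mn : m`_n = 1 by have := monicP monm; rewrite lead_coefE sm.
have lP : P`_n = 1 by rewrite coef_poly ltnSn subnn mul1r mn.
have sP : size P = n.+1 by rewrite size_poly_eq // subnn mul1r mn oner_eq0.
apply: (@integral_root_monic _ _ _ _ P).
- by rewrite monicE lead_coefE sP lP.
- apply/rootP; rewrite horner_poly.
  under eq_bigr => k _.
    rewrite exprMn mulrACA -exprD subnK ?[m`_k * _]mulrC; last by rewrite -ltnS ltn_ord.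
  over.
  rewrite -mulr_sumr; have := rx; rewrite horner_coef sm => e.
  by under eq_bigr do rewrite mulrC; rewrite e mulr0.
- apply/integral_poly => k; rewrite coef_poly ltnS; case: ltngtP => // kn; last first.
  + by rewrite kn subnn mul1r mn; apply: OK1.
  + by apply: OK0.
  rewrite -[(n - k)%N]prednK ?subn_gt0 // exprSr -mulrA; apply: OKM => //.
  by rewrite -rmorphXn; apply: OK_int.
Qed.

(** * Multiplication matrices and the trace form *)

Section Trace.
Variable w : (\dim {:K}).-tuple K.
Hypothesis bw : basis_of {:K} w.
Local Notation n := (\dim {:K}).

Definition mult_mx x : 'M[rat]_n := \matrix_(i, j) coord w j (x * w`_i).

Definition coords y : 'rV[rat]_n := \row_j coord w j y.

Lemma coordsE y : y = \sum_i coords y 0 i *: w`_i.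
Proof.
rewrite {1}(coord_basis bw (memvf y)); apply: eq_bigr => i _; by rewrite mxE.
Qed.

Lemma coords_inj : injective coords.
Proof. by move=> y z e; rewrite (coordsE y) e -coordsE. Qed.

Lemma coords_is_linear : linear coords.
Proof. by move=> a y z; apply/rowP => j; rewrite !mxE linearP. Qed.

HB.instance Definition _ := GRing.isLinear.Build rat K 'rV[rat]_n _ coords coords_is_linear.

Lemma coords_sum (c : 'rV[rat]_n) : coords (\sum_i c 0 i *: w`_i) = c.
Proof.
apply/rowP => j; rewrite mxE linear_sum /= (bigD1 j) //= linearZ /= coord_free ?(basis_free bw) //.
rewrite eqxx mulr1 big1 ?addr0 // => i ij.
by rewrite linearZ /= coord_free ?(basis_free bw) // (negPf ij) mulr0.
Qed.

Lemma coordsM x y : coords (x * y) = coords y *m mult_mx x.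
Proof.
apply/rowP => j; rewrite mxE {1}(coordsE y) mulr_sumr linear_sum /= mxE.
by apply: eq_bigr => i _; rewrite -scalerAr linearZ /= !mxE.
Qed.

Lemma mult_mx_eqP (A : 'M[rat]_n) x : (forall y, coords (x * y) = coords y *m A) ->
  mult_mx x = A.
Proof.
move=> h; apply/row_matrixP => i; rewrite !rowE.
have -> : delta_mx 0 i = coords w`_i.
  apply/rowP => j; rewrite !mxE coord_free ?(basis_free bw) //=.
  by rewrite eq_sym.
by rewrite -h coordsM.
Qed.

Lemma mult_mxD x y : mult_mx (x + y) = mult_mx x + mult_mx y.
Proof. by apply: mult_mx_eqP => z; rewrite mulrDl linearD /= !coordsM mulmxDr. Qed.

Lemma mult_mxZ a x : mult_mx (a *: x) = a *: mult_mx x.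
Proof. by apply: mult_mx_eqP => z; rewrite -scalerAl linearZ /= coordsM scalemxAr. Qed.

Lemma mult_mx0 : mult_mx 0 = 0.
Proof. by apply: mult_mx_eqP => z; rewrite mul0r linear0 mulmx0. Qed.

Lemma mult_mx1 : mult_mx 1 = 1%:M.
Proof. by apply: mult_mx_eqP => z; rewrite mul1r mulmx1. Qed.

Lemma mult_mxM x y : mult_mx (x * y) = mult_mx y *m mult_mx x.
Proof. by apply: mult_mx_eqP => z; rewrite -mulrA !coordsM mulmxA. Qed.

Lemma mult_mx_int (z : int) : mult_mx z%:~R = (z%:~R)%:M.
Proof.
have -> : z%:~R = (z%:~R : rat) *: (1 : K) by rewrite -[RHS]/(in_alg K _) rmorph_int.
by rewrite mult_mxZ mult_mx1 scalemx1.
Qed.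

Lemma mult_mx_eigen (C : fieldType) (f : {rmorphism rat -> C}) x (v : 'rV[C]_n) (l : C) :
  v *m map_mx f (mult_mx x) = l *: v ->
  forall p : {poly int},
  v *m map_mx f (mult_mx (map_poly intr p).[x]) = (map_poly intr p).[l] *: v.
Proof.
move=> e; elim/poly_ind => [|p c IH].
  by rewrite !rmorph0 !horner0 mult_mx0 map_mx0 mulmx0 scale0r.
rewrite !rmorphD !rmorphM /= !map_polyX !map_polyC /= !hornerMXaddC.
rewrite mult_mxD mult_mxM map_mxD map_mxM mulmxDr mulmxA e -scalemxAl IH.
by rewrite mult_mx_int map_scalar_mx rmorph_int mul_mx_scalar scalerA scalerDl mulrC.
Qed.

Definition trace_K x : rat := \tr (mult_mx x).

Lemma dim_gt0 : (0 < n)%N.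
Proof. by rewrite lt0n dimv_eq0; apply/eqP=> /vspaceP/(_ 1); rewrite memvf memv0 oner_eq0. Qed.

(** The eigenvalues of multiplication by x are roots of the monic integer polynomial that kills x.
    Their sum is thus an algebraic integer, and being rational it is an integer. *)
Lemma trace_integral x : O x -> trace_K x \is a Num.int.
Proof.
case=> p monp /rootP px.
pose A : 'M[algC]_n := map_mx ratr (mult_mx x).
have [s Ds] := closed_field_poly_normal (char_poly A).
rewrite (monicP (char_poly_monic A)) scale1r in Ds.
have ss : size s = n.
  by have := size_char_poly A; rewrite Ds size_prod_XsubC => -[].
have sA l : l \in s -> l \in Aint.
  move=> ls; have : root (char_poly A) l by rewrite Ds root_prod_XsubC.
  rewrite -eigenvalue_root_char => /eigenvalueP[v vA nzv].
  have := mult_mx_eigen vA p; rewrite px mult_mx0 map_mx0 mulmx0 => /esym/eqP.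
  rewrite scaler_eq0 (negPf nzv) orbF => /eqP pl.
  apply: (@root_monic_Aint (map_poly intr p)); first by apply/rootP.
    by rewrite monicE lead_coef_map_inj ?rmorph_int ?(monicP monp) //; apply: intr_inj.
  by apply/polyOverP => i; rewrite coef_map /= intr_int.
have trE : ratr (trace_K x) = \sum_(l <- s) l :> algC.
  rewrite /trace_K -trace_map_mx -/A.
  have := char_poly_trace A dim_gt0; rewrite Ds -[in X in X = _ -> _]ss coefPn_prod_XsubC; last first.
    by rewrite ss -lt0n dim_gt0.
  by move/oppr_inj.
have : (ratr (trace_K x) : algC) \is a Num.int.
  apply: Cint_rat_Aint; first exact: Crat_rat.
  by rewrite trE big_seq; apply: rpred_sum => l /sA.
case/intrP => z; rewrite -[RHS]ratr_int => /fmorph_inj ->; exact: intr_int.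
Qed.

Lemma mult_mx_det_neq0 x : x != 0 -> \det (mult_mx x) != 0.
Proof.
move=> nzx; have := congr1 determinant (mult_mxM x x^-1).
rewrite divff // mult_mx1 det1 det_mulmx => e; apply/eqP => z.
by move/eqP: e; rewrite z mulr0 oner_eq0.
Qed.

Definition trace_mx : 'M[rat]_n := \matrix_(i, j) trace_K (w`_i * w`_j).

Lemma trace_K_sum I (r : seq I) (f : I -> K) :
  trace_K (\sum_(i <- r) f i) = \sum_(i <- r) trace_K (f i).
Proof.
apply: (big_morph trace_K) => [x y|].
  by rewrite /trace_K mult_mxD mxtraceD.
by rewrite /trace_K mult_mx0 mxtrace0.
Qed.

Lemma trace_KZ a x : trace_K (a *: x) = a * trace_K x.
Proof. by rewrite /trace_K mult_mxZ linearZ. Qed.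

Lemma trace_mxE y j : (coords y *m trace_mx) 0 j = trace_K (y * w`_j).
Proof.
rewrite mxE [in RHS](coordsE y) mulr_suml trace_K_sum.
by apply: eq_bigr => i _; rewrite -scalerAl trace_KZ [trace_mx _ _]mxE.
Qed.

(** A kernel vector is a nonzero y with Tr(y z) = 0 for all z; at z = 1/y this would make Tr(1) =
    dim K vanish. *)
Lemma trace_mx_det_neq0 : \det trace_mx != 0.
Proof.
apply/det0P => -[v nzv vT]; pose y := \sum_i v 0 i *: w`_i.
have cy : coords y = v by apply: coords_sum.
have nzy : y != 0 by apply: contraNneq nzv => y0; rewrite -cy y0 linear0.
have h z : trace_K (y * z) = 0.
  rewrite (coordsE z) mulr_sumr trace_K_sum big1 // => j _.
  by rewrite -scalerAr trace_KZ -trace_mxE cy vT [X in _ * X]mxE mulr0.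
have := h y^-1; rewrite divff // /trace_K mult_mx1 mxtrace1 => /eqP.
by rewrite pnatr_eq0 eqn0Ngt dim_gt0.
Qed.

End Trace.

Definition scale_set x (A : set K) : set K := [set x * y | y in A].

Lemma integral_basis : exists2 w : (\dim {:K}).-tuple K, basis_of {:K} w &
  forall i, O w`_i.
Proof.
have h (s : seq K) : exists2 c : int, c != 0 & forall y, y \in s -> O (c%:~R * y).
  elim: s => [|y s [c nzc IH]]; first by exists 1.
  have [d nzd Oy] := integral_multiple y.
  exists (c * d); first by rewrite mulf_neq0.
  move=> z; rewrite inE rmorphM /= => /orP[/eqP -> | /IH Oz].
    by rewrite -mulrA; apply: OKM => //; apply: OK_int.
  by rewrite mulrAC; apply: OKM => //; apply: OK_int.
have [c nzc Oc] := h (vbasis {:K}).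
pose f y : K := c%:~R * y.
have fE y : f y = (c%:~R : rat) *: y by rewrite intr_scale.
exists (map_tuple f (vbasis {:K})).
  rewrite basisEdim size_map size_tuple leqnn andbT; apply/subvP => y _.
  rewrite (coord_vbasis (memvf y)); apply: rpred_sum => i _.
  rewrite rpredZ // -[_`_i]scale1r -(mulVf (x := c%:~R)) ?intr_eq0 // -scalerA rpredZ //.
  by rewrite -fE; apply/memv_span/map_f/mem_nth; rewrite size_tuple.
move=> i; have [ltin | geni] := ltnP i (\dim {:K}).
  by rewrite (nth_map 0) ?size_tuple //; apply/Oc/mem_nth; rewrite size_tuple.
by rewrite nth_default ?size_map ?size_tuple //; apply: OK0.
Qed.

(** * The index of x O_K in O_K is the absolute norm of x *)

Section Index.
Variable w : (\dim {:K}).-tuple K.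
Hypotheses (bw : basis_of {:K} w) (Ow : forall i, O w`_i).
Local Notation n := (\dim {:K}).

Definition Zcomb (z : 'rV[int]_n) : K := \sum_i (z 0 i)%:~R * w`_i.

Lemma Zcomb_is_additive : additive Zcomb.
Proof.
move=> y z; rewrite -sumrB; apply: eq_bigr => i _.
by rewrite !mxE rmorphB /= mulrBl.
Qed.

HB.instance Definition _ := GRing.isZmodMorphism.Build 'rV[int]_n K Zcomb Zcomb_is_additive.

Lemma ZcombE z : Zcomb z = \sum_i (map_mx intr z : 'rV[rat]_n) 0 i *: w`_i.
Proof. by apply: eq_bigr => i _; rewrite mxE intr_scale. Qed.

Lemma coords_Zcomb z : coords w (Zcomb z) = map_mx intr z.
Proof. by rewrite ZcombE coords_sum. Qed.

Lemma Zcomb_inj : injective Zcomb.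
Proof.
move=> y z /(congr1 (coords w)); rewrite !coords_Zcomb => /matrixP e.
by apply/matrixP => i j; have := e i j; rewrite !mxE => /intr_inj.
Qed.

Definition Zlattice : set K := Zcomb @` setT.

Lemma subgrp_Zlattice : subgrp Zlattice.
Proof. exact: subgrp_image. Qed.

Lemma subgrp_scale x (A : set K) : subgrp A -> subgrp (scale_set x A).
Proof.
move=> [A0 AB]; split; first by exists 0; rewrite ?mulr0.
by move=> _ _ [y Ay <-] [z Az <-]; exists (y - z); [apply: AB | rewrite mulrBr].
Qed.

Lemma has_index_scale x (A B : set K) k : x != 0 -> has_index A B k ->
  has_index (scale_set x A) (scale_set x B) k.
Proof.
move=> nzx; exact: (@has_index_image K K (x \*o idfun) A B k (mulfI nzx)).
Qed.

Lemma ZlatticeP y : Zlattice y <-> exists z : 'rV[int]_n, coords w y = map_mx intr z.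
Proof.
split; first by case=> z _ <-; exists z; rewrite coords_Zcomb.
by case=> z e; exists z => //; apply: (coords_inj bw); rewrite coords_Zcomb.
Qed.

Lemma Zlattice_OK : Zlattice `<=` O.
Proof. by move=> _ [z _ <-]; apply: OK_sum => i _; apply: OKM => //; apply: OK_int. Qed.

Lemma index_Zlattice y : y != 0 -> scale_set y Zlattice `<=` Zlattice ->
  exists2 k, has_index Zlattice (scale_set y Zlattice) k & `|\det (mult_mx w y)| = k%:R.
Proof.
move=> nzy sy.
have [N DN] : exists N : 'M[int]_n, mult_mx w y = map_mx intr N.
  have h i : exists z : 'rV[int]_n, row i (mult_mx w y) = map_mx intr z.
    have : Zlattice (y * w`_i).
      apply: sy; exists (w`_i) => //; apply/ZlatticeP; exists (delta_mx 0 i).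
      apply/rowP => j; rewrite !mxE coord_free ?(basis_free bw) //=.
      by rewrite eq_sym mulrb; case: (j == i).
    move/ZlatticeP => [z e]; exists z; rewrite -e.
    by apply/rowP => j; rewrite !mxE.
  have [f Df] := choice h; exists (\matrix_i f i).
  apply/row_matrixP => i; rewrite Df; apply/rowP => j; by rewrite !mxE.
have dN : \det N != 0.
  by have := mult_mx_det_neq0 bw nzy; rewrite DN det_map_mx intr_eq0.
exists `|\det N|%N; last by rewrite DN det_map_mx -intr_norm -abszE.
have := has_index_image Zcomb_inj (mx_lattice_index dN); congr has_index.
apply/seteqP; split=> [_ [_ [v _ <-] <-]|_ [_ [v _ <-] <-]].
  exists (Zcomb v); first by exists v.
  by apply: (coords_inj bw); rewrite coordsM // !coords_Zcomb DN map_mxM.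
exists (v *m N); first by exists v.
by apply: (coords_inj bw); rewrite coordsM // !coords_Zcomb DN map_mxM.
Qed.

(** D is the discriminant of the basis. For integral x the traces Tr(x w_j) are integers, and the
    adjugate of the trace matrix turns them into D times the coordinates of x. *)
Lemma OK_denominator : exists2 D : int, D != 0 & scale_set D%:~R O `<=` Zlattice.
Proof.
have [T DT] : exists T : 'M[int]_n, trace_mx w = map_mx intr T.
  have h i : exists z : 'rV[int]_n, row i (trace_mx w) = map_mx intr z.
    have h j : exists z : int, trace_K w (w`_i * w`_j) = z%:~R.
      by apply/intrP/trace_integral => //; apply: OKM.
    have [f Df] := choice h; exists (\row_j f j).
    by apply/rowP => j; rewrite !mxE Df.
  have [f Df] := choice h; exists (\matrix_i f i).
  apply/row_matrixP => i; rewrite Df; apply/rowP => j; by rewrite !mxE.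
exists (\det T); first by have := trace_mx_det_neq0 bw; rewrite DT det_map_mx intr_eq0.
move=> _ [x Ox <-]; apply/ZlatticeP.
have [t Dt] : exists t : 'rV[int]_n, coords w x *m trace_mx w = map_mx intr t.
  have h j : exists z : int, trace_K w (x * w`_j) = z%:~R.
    by apply/intrP/trace_integral => //; apply: OKM.
  have [f Df] := choice h; exists (\row_j f j).
  by apply/rowP => j; rewrite trace_mxE // !mxE Df.
exists (t *m \adj T); rewrite map_mxM -Dt DT map_mx_adj -mulmxA mul_mx_adj.
by rewrite det_map_mx mul_mx_scalar -intr_scale linearZ.
Qed.

(** The determinant gives indices in the free lattice Z spanned by w, not in O_K. They are
    transferred for multipliers u = D y, which satisfy u O <= Z; then x is reached by dividing the
    case u = D x by the case u = D. *)
Lemma index_OK x : O x -> x != 0 ->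
  exists2 k, has_index O (scale_set x O) k & `|\det (mult_mx w x)| = k%:R.
Proof.
have [D nzD sD] := OK_denominator.
have nzDK : D%:~R != 0 :> K by rewrite intr_eq0K.
have sO := subgrp_OK; have sZ := subgrp_Zlattice.
(* [O : Z] is finite because Z <= O <= D^-1 Z. *)
have [m im m0] : exists2 m, has_index O Zlattice m & (0 < m)%N.
  have [|d id _] := index_Zlattice nzDK.
    by apply: subset_trans sD => _ [y Zy <-]; exists y => //; apply: Zlattice_OK.
  have d0 := has_index_gt0 sZ id.
  have := has_index_scale (x := D%:~R^-1) _ id; rewrite invr_eq0 => /(_ nzDK).
  have -> : scale_set (D%:~R^-1) (scale_set D%:~R Zlattice) = Zlattice.
    apply/seteqP; split=> [_ [_ [y Zy <-] <-]|y Zy]; first by rewrite mulKf.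
    by exists (D%:~R * y); [exists y | rewrite mulKf].
  case/(has_index_mid sO sZ Zlattice_OK) => [y Oy|k [l [_ il /(_ d0)[_ l0]]]].
    by exists (D%:~R * y); [apply: sD; exists y | rewrite mulKf].
  by exists l.
(* Compare [O : Z][Z : uZ] with [O : uO][uO : uZ] and cancel [uO : uZ] = [O : Z]. *)
have key y : O y -> y != 0 -> exists2 k, has_index O (scale_set (D%:~R * y) O) k &
    `|\det (mult_mx w (D%:~R * y))| = k%:R.
  move=> Oy nzy; set u := D%:~R * y; have nzu : u != 0 by rewrite mulf_neq0.
  have Ou : O u by apply: OKM => //; apply: OK_int.
  have [|d id Dd] := index_Zlattice nzu.
    move=> _ [z Zz <-]; apply: sD; exists (y * z); last by rewrite mulrA.
    by apply: OKM => //; apply: Zlattice_OK.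
  exists d => //.
  have uOO : scale_set u O `<=` O by move=> _ [z Oz <-]; apply: OKM.
  have uZuO : scale_set u Zlattice `<=` scale_set u O.
    by move=> _ [z Zz <-]; exists z => //; apply: Zlattice_OK.
  have uZZ : scale_set u Zlattice `<=` Zlattice.
    move=> _ [z Zz <-]; apply: sD; exists (y * z); last by rewrite mulrA.
    by apply: OKM => //; apply: Zlattice_OK.
  have sUZ := subgrp_scale u sZ; have sUO := subgrp_scale u sO.
  have imd := has_index_trans sO Zlattice_OK sZ sUZ uZZ im id.
  have [k [l [ik il _]]] := has_index_mid sUO sUZ uZuO uOO imd.
  have lm := has_index_uniq sUZ il (has_index_scale nzu im).
  have := has_index_uniq sUZ imd (has_index_trans sO uOO sUO sUZ uZuO ik il).
  rewrite lm mulnC => /eqP; rewrite eqn_pmul2r // => /eqP -> //.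
move=> Ox nzx; have [a ia Da] := key x Ox nzx.
have [b ib Db] := key 1 OK1 (oner_neq0 _); rewrite mulr1 in ib Db.
have sx := subgrp_scale x sO; have sDO := subgrp_scale D%:~R sO.
have sDx := subgrp_scale (D%:~R * x) sO.
have xOO : scale_set x O `<=` O by move=> _ [z Oz <-]; apply: OKM.
have DOO : scale_set D%:~R O `<=` O by move=> _ [z Oz <-]; apply: OKM => //; apply: OK_int.
have DxO : scale_set (D%:~R * x) O `<=` scale_set x O.
  by move=> _ [z Oz <-]; exists (D%:~R * z); [apply: OKM => //; apply: OK_int | rewrite mulrA (mulrC x)].
have [k [l [ik il _]]] := has_index_mid sx sDx DxO xOO ia.
exists k => //.
have iD : has_index (scale_set x O) (scale_set (D%:~R * x) O) b.
  have := has_index_scale nzx ib; congr has_index; apply/seteqP; split.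
    by move=> _ [_ [z Oz <-] <-]; exists z => //; rewrite -mulrA mulrCA.
  by move=> _ [z Oz <-]; exists (D%:~R * z); [exists z | rewrite -mulrA mulrCA].
have := has_index_uniq sDx ia (has_index_trans sO xOO sx sDx DxO ik iD).
have b0 : b%:R != 0 :> rat.
  by rewrite -Db normr_eq0 mult_mx_det_neq0.
move=> Eab; apply: (mulIf b0); rewrite -natrM -Eab -Da -Db -normrM -det_mulmx.
by rewrite -mult_mxM // mulrC.
Qed.

End Index.
End RingOfIntegers.

(** * Embeddings and norms *)

Lemma pchar_number_field (K : fieldExtType rat) : [pchar K] =i pred0.
Proof. by move=> p; rewrite !inE natr_eq0K andbC; case: p. Qed.

Section Embeddings.
Variables (R : realType) (K : fieldExtType rat).
Local Notation C := R[i].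
Local Notation toK := (map_poly (in_alg K)).
Local Notation toC := (map_poly (ratr : rat -> C)).

(** * Embeddings given by a conjugate of a generator *)

Section Extend.
Variables (z : K) (m : {poly rat}) (r : C).
Hypotheses (gen : <<1; z>>%VS = fullv) (Dm : toK m = minPoly 1 z) (mr : root (toC m) r).

Lemma gen_poly x : exists q : {poly rat}, x = (toK q).[z].
Proof. by apply/Fadjoin1_polyP; rewrite gen memvf. Qed.

Lemma eval_transfer (q : {poly rat}) : (toK q).[z] = 0 -> (toC q).[r] = 0.
Proof.
move=> qz; have : minPoly 1 z %| toK q.
  by apply: minPoly_dvdp; [apply: alg_polyOver | apply/rootP].
rewrite -Dm dvdp_map => /dvdpP[u ->].
by rewrite rmorphM hornerM (rootP mr) mulr0.
Qed.

(** The polynomial representing x is an arbitrary choice; [extendE] shows that the value does not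
    depend on it. *)
Definition extend x : C := (toC (projT1 (cid (gen_poly x)))).[r].

Lemma extendE (q : {poly rat}) : extend (toK q).[z] = (toC q).[r].
Proof.
rewrite /extend; case: cid => q' /= e; apply/eqP.
rewrite -subr_eq0 -hornerN -hornerD -rmorphB; apply/eqP/eval_transfer.
by rewrite rmorphB hornerD hornerN -e subrr.
Qed.

Lemma extend_zmod : zmod_morphism extend.
Proof.
move=> x y; have [[p ->] [q ->]] := (gen_poly x, gen_poly y).
by rewrite -hornerN -hornerD -rmorphB !extendE rmorphB hornerD hornerN.
Qed.

Lemma extend_monoid : monoid_morphism extend.
Proof.
split=> [|x y]; first by have := extendE 1; rewrite !rmorph1 !hornerC.
have [[p ->] [q ->]] := (gen_poly x, gen_poly y).
by rewrite -hornerM -rmorphM !extendE rmorphM hornerM.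
Qed.

HB.instance Definition _ := GRing.isZmodMorphism.Build K C extend extend_zmod.
HB.instance Definition _ := GRing.isMonoidMorphism.Build K C extend extend_monoid.

Lemma embedding_exists : exists f : {rmorphism K -> C}, f z = r.
Proof.
by have := extendE 'X; rewrite !map_polyX !hornerX => e; exists extend.
Qed.

End Extend.

Lemma embedding_poly (f : {rmorphism K -> C}) (q : {poly rat}) z :
  f (toK q).[z] = (toC q).[f z].
Proof.
rewrite -horner_map -map_poly_comp; congr horner; apply: eq_map_poly => c /=.
by rewrite alg_num_field fmorph_rat.
Qed.

Lemma primitive_generator : exists z : K, <<1; z>>%VS = fullv.
Proof.
exists (separable_generator 1 {:K}); apply/esym/eq_adjoin_separable_generator.
  by apply/separableP => y _; apply: pcharf0_separable; apply: pchar_number_field.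
exact: sub1v.
Qed.

(** In characteristic 0 the minimal polynomial of a generator z has dim K distinct roots, and an
    embedding amounts to the choice of one of them as the image of z. *)
Lemma embeddings_enum : exists (z : K) (tau : 'I_(\dim {:K}) -> {rmorphism K -> C}),
  [/\ <<1; z>>%VS = fullv, injective (fun j => tau j z)
    & forall f : {rmorphism K -> C}, exists j, f z = tau j z].
Proof.
have [z gen] := primitive_generator; exists z.
have [m Dm] : exists m : {poly rat}, toK m = minPoly 1 z.
  by have /polyOver1P[m Dm] := minPolyOver 1%AS z; exists m.
have [s Ds] := closed_field_poly_normal (toC m).
have monm : m \is monic.
  by rewrite -(map_monic (in_alg K)) Dm monic_minPoly.
rewrite lead_coef_map (monicP monm) rmorph1 scale1r in Ds.
have us : uniq s.
  rewrite -separable_prod_XsubC -Ds separable_map -(separable_map (in_alg K)) Dm.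
  exact: pcharf0_separable (@pchar_number_field K) _.
have ss : size s = \dim {:K}.
  have := size_minPoly 1%AS z; rewrite -Dm size_map_poly -(size_map_poly (ratr : {rmorphism rat -> C})) Ds.
  by rewrite size_prod_XsubC => -[->]; rewrite -gen /= dim_Fadjoin dimv1 muln1.
have h (j : 'I_(\dim {:K})) : exists f : {rmorphism K -> C}, f z = s`_j.
  apply: (embedding_exists gen Dm); rewrite Ds root_prod_XsubC.
  by rewrite mem_nth // ss.
have [tau Dtau] := choice h; exists tau; split=> // [i j|f].
  by rewrite !Dtau => /eqP; rewrite nth_uniq ?ss // => /eqP/val_inj.
have : f z \in s.
  rewrite -root_prod_XsubC -Ds; apply/rootP.
  by rewrite -embedding_poly Dm minPolyxx rmorph0.
case/(nthP 0) => j; rewrite ss => jn <-; exists (Ordinal jn).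
by rewrite Dtau.
Qed.

Lemma embedding_eq z (f g : {rmorphism K -> C}) : <<1; z>>%VS = fullv -> f z = g z -> f =1 g.
Proof. by move=> gen fg x; have [q ->] := gen_poly gen x; rewrite !embedding_poly fg. Qed.

(** * The norm as a product over embeddings and over places *)

Section NormFormula.
Variable w : (\dim {:K}).-tuple K.
Hypothesis bw : basis_of {:K} w.
Local Notation n := (\dim {:K}).

Lemma embedding_lin (f : {rmorphism K -> C}) y :
  f y = \sum_i ratr (coords w y 0 i) * f w`_i.
Proof.
rewrite {1}(coordsE bw y) rmorph_sum /=; apply: eq_bigr => i _.
by rewrite -mulr_algl rmorphM alg_num_field fmorph_rat.
Qed.

(** The matrix [Om] of the values of the embeddings on the basis diagonalises multiplication by x.
    It is invertible because a linear relation among the embeddings, evaluated on the polynomial in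
    z vanishing at all conjugates but one, loses all its terms but one. *)
Lemma det_mult_mx_embeddings (z : K) (tau : 'I_n -> {rmorphism K -> C}) :
  injective (fun j => tau j z) ->
  forall x, ratr (\det (mult_mx w x)) = \prod_j tau j x.
Proof.
move=> tauI x; pose Om : 'M[C]_n := \matrix_(i, j) tau j w`_i.
have uOm : Om \in unitmx.
  rewrite unitmxE unitfE -det_tr; apply/det0P => -[u nzu uO].
  have lin y : \sum_j u 0 j * tau j y = 0.
    under eq_bigr => j _ do rewrite embedding_lin mulr_sumr.
    rewrite exchange_big big1 //= => i _.
    under eq_bigr => j _ do rewrite mulrCA.
    have := congr1 (fun M : 'rV_n => M 0 i) uO; rewrite !mxE => e.
    by rewrite -mulr_sumr -[X in _ * X = _]/(\sum_j _) (eq_bigr (fun j => u 0 j * Om^T j i)) ?e ?mulr0 // => j _; rewrite !mxE.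
  have linp (p : {poly C}) : \sum_j u 0 j * p.[tau j z] = 0.
    under eq_bigr => j _ do rewrite horner_coef mulr_sumr.
    rewrite exchange_big big1 //= => k _.
    under eq_bigr => j _ do rewrite mulrCA -rmorphXn.
    by rewrite -mulr_sumr lin mulr0.
  case/rV0Pn: nzu => j0 nzj.
  pose p := \prod_(j | j != j0) ('X - (tau j z)%:P).
  have := linp p; rewrite (bigD1 j0) //= big1 ?addr0 => [/eqP|j jj0]; last first.
    by rewrite /p horner_prod (bigD1 j) //= hornerXsubC subrr mul0r mulr0.
  rewrite mulf_eq0 (negPf nzj) /= horner_prod prodf_seq_eq0 => /hasP[j _].
  by rewrite hornerXsubC subr_eq0 => /andP[jj0 /eqP/tauI e]; rewrite e eqxx in jj0.
have E : map_mx ratr (mult_mx w x) *m Om = Om *m diag_mx (\row_j tau j x).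
  apply/matrixP => i j; rewrite mul_mx_diag !mxE mulrC -rmorphM embedding_lin.
  by apply: eq_bigr => k _; rewrite !mxE.
have := congr1 determinant E; rewrite !det_mulmx det_diag det_map_mx mulrC.
move/(mulrI uOm) ->; by apply: eq_bigr => j _; rewrite mxE.
Qed.

Variables (P : finType) (sigma : P -> {rmorphism K -> C}).
Hypothesis places : infinite_places sigma.

(** The embeddings above the place p are [sigma p] and its complex conjugate, which coincide exactly
    when the place is real; both give x the same absolute value. *)
Lemma norm_places x :
  ratr `|\det (mult_mx w x)| = \prod_p `|sigma p x| ^+ local_degree (sigma p) :> C.
Proof.
have [z [tau [gen tauI tauS]]] := embeddings_enum.
rewrite ratr_norm (det_mult_mx_embeddings tauI) normr_prod.
have h j : exists p, ((tau j =1 sigma p) \/ (forall x, tau j x = (sigma p x)^*)) /\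
   forall q, ((tau j =1 sigma q) \/ (forall x, tau j x = (sigma q x)^*)) -> p = q.
  by have [p [p1 p2]] := places (tau j); exists p.
have [pl Dpl] := choice h.
rewrite (partition_big pl predT) //=; apply: eq_bigr => p _.
have [j1 Dj1] := tauS (sigma p).
have e1 := embedding_eq gen Dj1.
have pj1 : pl j1 = p by apply: (proj2 (Dpl j1)); left => y; rewrite e1.
have nE j : pl j = p -> `|tau j x| = `|sigma p x|.
  by move=> <-; have [[->|->] _] := Dpl j; rewrite ?norm_conjC.
rewrite (eq_bigr (fun=> `|sigma p x|)); last by move=> j /eqP/nE.
rewrite prodr_const; congr (_ ^+ _).
have [j2 Dj2] := tauS (Num.conj \o sigma p).
have e2 : tau j2 =1 (fun y => (sigma p y)^*) by move=> y; rewrite -(embedding_eq gen Dj2).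
have pj2 : pl j2 = p by apply: (proj2 (Dpl j2)); right.
have -> : #|[pred j | pl j == p]| = #|pred2 j1 j2|.
  apply: eq_card => j; rewrite !inE; apply/idP/idP => [/eqP pj|/orP[]/eqP->]; rewrite ?pj1 ?pj2 //.
  have [[eq|eq] _] := Dpl j; rewrite pj in eq.
    by apply/orP; left; apply/eqP/tauI; rewrite eq e1.
  by apply/orP; right; apply/eqP/tauI; rewrite eq e2.
rewrite /local_degree; case: asboolP => re.
  suff -> : j2 = j1 by rewrite card2 eqxx.
  by apply: tauI; rewrite e2 -e1; apply/CrealP/re.
suff : j1 != j2 by rewrite card2 => ->.
apply/eqP => e; apply: re => y; apply/CrealP.
by rewrite -e2 -e e1.
Qed.

End NormFormula.
End Embeddings.

(** * Arithmetic of fractional ideals *)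

Section IdealArithmetic.
Variable K : fieldExtType rat.
Local Notation O := (@OK K).
Implicit Types (a b c p q : set K) (x y z : K).

Lemma submod_sub a x y : OK_submodule (V := K^o) a -> a x -> a y -> a (x - y).
Proof.
move=> [_ aD aM] ax ay; apply: aD => //; rewrite -mulN1r; apply: aM => //.
by apply: OKN; apply: OK1.
Qed.

Lemma subgrp_submod a : OK_submodule (V := K^o) a -> subgrp a.
Proof. by move=> sa; split=> [|x y ax ay]; [case: sa | apply: submod_sub]. Qed.

Lemma subgrp_frac a : fractional_ideal a -> subgrp a.
Proof. by case=> /subgrp_submod. Qed.

Lemma submod_sum a (I : Type) (s : seq I) (Q : pred I) (f : I -> K) :
  OK_submodule (V := K^o) a -> (forall i, Q i -> a (f i)) ->
  a (\sum_(i <- s | Q i) f i).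
Proof. by move=> [a0 aD _] h; apply: big_ind. Qed.

Lemma frac_mulO a u x : fractional_ideal a -> O u -> a x -> a (u * x).
Proof. by move=> [[_ _ aM] _ _]; apply: aM. Qed.

Lemma frac_OK : fractional_ideal O.
Proof.
split; first by split; [apply: OK0 | apply: OKD | apply: OKM].
  by exists 1; [apply: OK1 | apply: oner_neq0].
by exists 1; split; [apply: OK1 | apply: oner_neq0 | move=> x; rewrite mul1r].
Qed.

Lemma ideal_mul_mem a b x y : a x -> b y -> ideal_mul a b (x * y).
Proof.
move=> ax by_; exists [:: (x, y)]; last by rewrite big_seq1.
by move=> u; rewrite inE => /eqP->.
Qed.

Lemma submod_mul a b : OK_submodule (V := K^o) a -> OK_submodule (V := K^o) (ideal_mul a b).
Proof.
move=> [a0 aD aM]; split.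
- by exists [::]; rewrite ?big_nil.
- move=> _ _ [s sP ->] [t tP ->]; exists (s ++ t); last by rewrite big_cat.
  by move=> u; rewrite mem_cat => /orP[/sP|/tP].
- move=> d _ Od [s sP ->]; exists [seq (d * u.1, u.2) | u <- s].
    by move=> _ /mapP[u /sP[au bu] ->]; split=> //; apply: aM.
  rewrite big_map [LHS]mulr_sumr; apply: eq_bigr => u _; by rewrite mulrA.
Qed.

Lemma ideal_mul_subP a b c : OK_submodule (V := K^o) c ->
  (forall x y, a x -> b y -> c (x * y)) -> ideal_mul a b `<=` c.
Proof.
move=> sc h _ [t tP ->]; rewrite big_seq; apply: submod_sum => // u /tP[au bu].
exact: h.
Qed.

Lemma ideal_mulC a b : ideal_mul a b = ideal_mul b a.
Proof.
wlog suff h : a b / ideal_mul a b `<=` ideal_mul b a.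
  by apply/seteqP; split; apply: h.
move=> _ [t tP ->]; exists [seq (u.2, u.1) | u <- t].
  by move=> _ /mapP[u /tP[? ?] ->].
by rewrite big_map; apply: eq_bigr => u _; rewrite mulrC.
Qed.

Lemma ideal_mulA a b c : OK_submodule (V := K^o) a -> OK_submodule (V := K^o) c ->
  ideal_mul a (ideal_mul b c) = ideal_mul (ideal_mul a b) c.
Proof.
move=> sa sc; apply/seteqP; split.
  apply: ideal_mul_subP => [|x _ ax [t tP ->]]; first by apply/submod_mul/submod_mul.
  rewrite mulr_sumr big_seq; apply: submod_sum => [|u /tP[bu cu]].
    by apply/submod_mul/submod_mul.
  by rewrite mulrA; do 2 apply: ideal_mul_mem => //.
apply: ideal_mul_subP => [|_ z [t tP ->] cz]; first exact: submod_mul.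
rewrite mulr_suml big_seq; apply: submod_sum => [|u /tP[au bu]]; first exact: submod_mul.
by rewrite -mulrA; do 2 apply: ideal_mul_mem => //.
Qed.

Lemma ideal_mulO a : OK_submodule (V := K^o) a -> ideal_mul O a = a.
Proof.
move=> sa; apply/seteqP; split; first by apply: ideal_mul_subP => //; case: sa.
by move=> x ax; rewrite -[x]mul1r; apply: ideal_mul_mem => //; apply: OK1.
Qed.

Lemma ideal_mulS a b c : b `<=` c -> ideal_mul a b `<=` ideal_mul a c.
Proof. by move=> bc _ [t tP ->]; exists t => // u /tP[au /bc]. Qed.

Lemma frac_mul a b : fractional_ideal a -> fractional_ideal b ->
  fractional_ideal (ideal_mul a b).
Proof.
move=> [sa [x ax nzx] [d [Od nzd da]]] [sb [y b_y nzy] [e [Oe nze eb]]]; split.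
- exact: submod_mul.
- by exists (x * y); [apply: ideal_mul_mem | rewrite mulf_neq0].
- exists (d * e); split; [exact: OKM | by rewrite mulf_neq0 |].
  move=> _ [t tP ->]; rewrite mulr_sumr big_seq; apply: OK_sum => u /tP[au bu].
  by rewrite mulrACA; apply: OKM; [apply: da | apply: eb].
Qed.

Lemma frac_scale x a : x != 0 -> fractional_ideal a -> fractional_ideal (scale_set x a).
Proof.
move=> nzx [[a0 aD aM] [y ay nzy] [d [Od nzd da]]]; split.
- split; first by exists 0; rewrite ?mulr0.
    by move=> _ _ [u au <-] [v av <-]; exists (u + v); [apply: aD | rewrite mulrDr].
  by move=> e _ Oe [u au <-]; exists (e * u); [apply: aM | rewrite mulrCA].
- by exists (x * y); [exists y | rewrite mulf_neq0].
- have [e nze Oe] := integral_multiple x.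
  exists (d * e%:~R); split; [by apply: OKM => //; apply: OK_int | by rewrite mulf_neq0 ?intr_eq0K|].
  by move=> _ [u au <-]; rewrite [x * u]mulrC mulrACA; apply: OKM => //; apply: da.
Qed.

Lemma scale_mulE x a b : scale_set x (ideal_mul a b) = ideal_mul (scale_set x a) b.
Proof.
apply/seteqP; split.
  move=> _ [_ [t tP ->] <-]; exists [seq (x * u.1, u.2) | u <- t].
    by move=> _ /mapP[u /tP[au bu] ->]; split=> //; exists u.1.
  by rewrite big_map mulr_sumr; apply: eq_bigr => u _; rewrite mulrA.
move=> _ [t tP ->].
have h : forall s : seq (K * K), {subset s <= t} -> scale_set x (ideal_mul a b) (\sum_(u <- s) u.1 * u.2).
  elim=> [|u s IH] st; first by rewrite big_nil; exists 0; [exists [::]; rewrite ?big_nil | rewrite mulr0].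
  have [|_ [r rP ->] e] := IH; first by move=> v vs; apply: st; rewrite inE vs orbT.
  have [[v av vE] bu] := tP u (st _ (mem_head _ _)).
  exists (\sum_(w <- (v, u.2) :: r) w.1 * w.2); first by exists ((v, u.2) :: r) => // w; rewrite inE => /orP[/eqP->|/rP].
  by rewrite !big_cons mulrDr e mulrA vE.
exact: h.
Qed.

Lemma scale_setM x y a : scale_set x (scale_set y a) = scale_set (x * y) a.
Proof.
apply/seteqP; split=> [_ [_ [u au <-] <-]|_ [u au <-]].
  by exists u; rewrite ?mulrA.
by exists (y * u); [exists u | rewrite mulrA].
Qed.

Lemma scale_set1 a : scale_set 1 a = a.
Proof.
apply/seteqP; split=> [_ [u au <-]|u au]; first by rewrite mul1r.
by exists u; rewrite ?mul1r.
Qed.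

Definition ideal_inv a : set K := [set x | forall y, a y -> O (x * y)].

Lemma frac_inv a : fractional_ideal a -> fractional_ideal (ideal_inv a).
Proof.
move=> [[a0 aD aM] [y ay nzy] [d [Od nzd da]]]; split.
- split; first by move=> u _; rewrite mul0r; apply: OK0.
    by move=> u v hu hv z az; rewrite mulrDl; apply: OKD; [apply: hu | apply: hv].
  by move=> e u Oe hu z az; rewrite -[e *: u]/(e * u) -mulrA; apply: OKM => //; apply: hu.
- by exists d.
- have [m nzm Om] := integral_multiple y.
  exists (m%:~R * y); split; first exact: Om.
    by rewrite mulf_neq0 ?intr_eq0K.
  move=> u hu; rewrite mulrC; apply: hu; apply: aM => //; exact: OK_int.
Qed.

(** For y in b and d a denominator of a, y O <= b <= a <= d^-1 O, and the outer index is that of d y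
    O in O. *)
Lemma frac_finite_index a b : fractional_ideal a -> fractional_ideal b -> b `<=` a ->
  exists2 k, has_index a b k & (0 < k)%N.
Proof.
move=> fa fb ba.
have sa := subgrp_frac fa; have sb := subgrp_frac fb.
have [_ _ [d [Od nzd da]]] := fa; have [sB [y b_y nzy] _] := fb.
have [w bw Ow] := integral_basis K.
have Ody : O (d * y) by apply: da; apply: ba.
have nzdy : d * y != 0 by rewrite mulf_neq0.
have [k ik _] := index_OK bw Ow Ody nzdy.
have sO := subgrp_OK K; have k0 := has_index_gt0 sO ik.
have sy : scale_set y O `<=` b.
  by move=> _ [u Ou <-]; rewrite mulrC; case: sB => _ _; apply.
have s1 : scale_set (d * y) O `<=` scale_set d a.
  by rewrite -scale_setM => _ [u /sy/ba au <-]; exists u.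
have s2 : scale_set d a `<=` O by move=> _ [u au <-]; apply: da.
have sda := subgrp_scale d sa; have sdy := subgrp_scale (d * y) sO.
have [_ [l [_ il /(_ k0)[_ l0]]]] := has_index_mid sda sdy s1 s2 ik.
have nzd' : d^-1 != 0 by rewrite invr_eq0.
have := has_index_scale nzd' il; rewrite !scale_setM mulrA mulVf // mul1r scale_set1 => il'.
have [m [_ [im _ /(_ l0)[m0 _]]]] := has_index_mid sb (subgrp_scale y sO) sy ba il'.
by exists m.
Qed.

(** Only b <> 0 is at stake: among the k + 1 multiples 0 x, ..., k x of some x <> 0 in a, two lie in
    the same coset of b. *)
Lemma submod_index a b k : OK_submodule (V := K^o) b -> fractional_ideal a ->
  b `<=` a -> has_index a b k -> fractional_ideal b.
Proof.
move=> sb fa ba [I [r [cI ra ar rI]]]; have [sa [x ax nzx] [d [Od nzd da]]] := fa.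
split=> //; last by exists d; split=> // u /ba/da.
pose f (i : 'I_k.+1) := projT1 (cid (ar (i%:R * x) (frac_mulO fa (OK_nat _ i) ax))).
have fP (i : 'I_k.+1) : b (i%:R * x - r (f i)) by rewrite /f; case: cid.
have : ~~ injectiveb f.
  by apply/injectiveP => /leq_card; rewrite cI card_ord ltnn.
case/injectivePn => i [j nij eij].
exists ((i%:R - j%:R) * x); last first.
  rewrite mulf_neq0 // subr_eq0; apply: contra nij => /eqP e.
  rewrite -val_eqE /=; have : (i%:R - j%:R : K) == 0 by rewrite e subrr.
  rewrite -[i%:R]/(i%:Z%:~R) -[j%:R]/(j%:Z%:~R) -rmorphB /= intr_eq0K subr_eq0 eqz_nat.
  by rewrite eq_sym.
have := submod_sub sb (fP i) (fP j); rewrite eij opprB addrA subrK -mulrBl.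
by [].
Qed.

(* Pigeonhole modulo v: two powers of x agree up to an element of O. *)
Lemma almost_integral b x : fractional_ideal b -> (forall y, b y -> b (x * y)) -> O x.
Proof.
move=> fb xb; have [_ [u bu nzu] [d [Od nzd db]]] := fb.
have bk k : b (x ^+ k * u).
  by elim: k => [|k IH]; rewrite ?mul1r // exprS -mulrA; apply: xb.
pose v := d * u; have nzv : v != 0 by rewrite mulf_neq0.
have Ov k : O (v * x ^+ k) by rewrite /v -mulrA [u * _]mulrC; apply/db/bk.
have Ov0 : O v by have := Ov 0%N; rewrite mulr1.
have [w bw Ow] := integral_basis K.
have [k [I [r [cI _ ar _]]] _] := index_OK bw Ow Ov0 nzv.
pose f (i : 'I_k.+1) := projT1 (cid (ar _ (Ov i))).
have fP (i : 'I_k.+1) : scale_set v O (v * x ^+ i - r (f i)) by rewrite /f; case: cid.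
have : ~~ injectiveb f.
  by apply/injectiveP => /leq_card; rewrite cI card_ord ltnn.
case/injectivePn => i [j]; wlog ij : i j / (i < j)%N => [th nij eij|_ eij].
  case: (ltngtP i j) => h; [exact: th h nij eij | | ].
    by apply: th h _ (esym eij); rewrite eq_sym.
  by move: nij; rewrite -val_eqE /= h eqxx.
have [o Oo oE] : scale_set v O (v * x ^+ j - v * x ^+ i).
  rewrite -(subrKA (r (f i))) {1}eij; apply: (subgrpD (subgrp_scale v (subgrp_OK K))) (fP j) _.
  by rewrite -opprB; apply: subgrpN => //; apply: subgrp_scale; apply: subgrp_OK.
have {}oE : o = x ^+ j - x ^+ i.
  by apply: (mulfI nzv); rewrite oE mulrBr.
(* x is a root of the monic polynomial X^j - X^i - o, whose coefficients are integral. *)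
pose Q : {poly K} := - ('X^i + o%:P).
have sQ : (size Q < size ('X^j : {poly K}))%N.
  rewrite size_polyN size_polyXn ltnS; apply: leq_trans (size_polyD _ _) _.
  rewrite geq_max size_polyXn ij /=; apply: leq_trans (size_polyC_leq1 _) _.
  exact: leq_trans ij.
apply: (@integral_root_monic _ _ _ _ ('X^j + Q)).
- by rewrite monicE lead_coefDl // lead_coefXn.
- by apply/rootP; rewrite /Q !hornerE oE addrCA subrr addr0 subrr.
- apply/integral_poly => l; rewrite coefD coefN coefD !coefXn coefC.
  apply: OKB; first exact: OK_nat.
  by apply: OKD; [apply: OK_nat | case: ifP => // _; apply: OK0].
Qed.

(** * Maximal ideals *)

Definition maximal_ideal p := [/\ fractional_ideal p, p `<=` O, ~ p 1 &
  forall q, OK_submodule (V := K^o) q -> q `<=` O -> p `<=` q -> q 1 \/ q = p].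

Lemma ideal_unit p : OK_submodule (V := K^o) p -> p `<=` O -> p 1 -> p = O.
Proof.
move=> [_ _ pM] pO p1; apply/seteqP; split=> // x Ox.
by rewrite -[x]mulr1; apply: pM.
Qed.

Lemma has_index_proper a b k : subgrp a -> subgrp b -> b `<=` a -> has_index a b k ->
  a <> b -> (1 < k)%N.
Proof.
move=> sa sb ba ik nab; have := has_index_gt0 sa ik.
by case: k ik => [|[]] // /(has_index1_eq sa sb ba).
Qed.

Lemma index_split a b c k : fractional_ideal a -> fractional_ideal b -> fractional_ideal c ->
  c `<=` b -> b `<=` a -> has_index a c k ->
  exists l m, [/\ has_index a b l, has_index b c m & k = (l * m)%N].
Proof.
move=> fa fb fc cb ba ik; have sa := subgrp_frac fa; have sb := subgrp_frac fb.
have sc := subgrp_frac fc.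
have [l [m [il im _]]] := has_index_mid sb sc cb ba ik.
exists l, m; split=> //; apply: has_index_uniq ik _ => //.
exact: has_index_trans il im.
Qed.

Lemma index_ltn a b c k l : fractional_ideal a -> fractional_ideal b -> fractional_ideal c ->
  c `<=` b -> b `<=` a -> b <> c -> has_index a c k -> has_index a b l -> (l < k)%N.
Proof.
move=> fa fb fc cb ba nbc ik il.
have [l' [m [il' im ->]]] := index_split fa fb fc cb ba ik.
have -> : l' = l by apply: has_index_uniq il' il; apply: subgrp_frac.
have l0 := has_index_gt0 (subgrp_frac fa) il.
have m1 := has_index_proper (subgrp_frac fb) (subgrp_frac fc) cb im nbc.
by rewrite -[X in (X < _)%N]muln1 ltn_pmul2l.
Qed.

(** Finiteness of the index in O_K stands in for Zorn's lemma: an ideal strictly above c has smaller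
    index. *)
Lemma maximal_above c : fractional_ideal c -> c `<=` O -> ~ c 1 ->
  exists2 p, maximal_ideal p & c `<=` p.
Proof.
move=> fc cO; have [k ik _] := frac_finite_index frac_OK fc cO.
have [n] := ubnP k; elim: n k c fc cO ik => // n IH k c fc cO ik kn c1.
have [cm|] := pselect (maximal_ideal c); first by exists c.
move=> nm.
have [q [sq qO cq q1 nqc]] : exists q, [/\ OK_submodule (V := K^o) q, q `<=` O, c `<=` q, ~ q 1 & q <> c].
  apply: contrapT => /forallNP nq; apply: nm; split=> // q sq qO cq.
  have [q1|q1] := pselect (q 1); first by left.
  by right; apply: contrapT => nqc; apply: (nq q).
have [l [m [il im km]]] : exists l m, [/\ has_index O q l, has_index q c m & k = (l * m)%N].
  have sc := subgrp_frac fc; have sq' := subgrp_submod sq.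
  have [l [m [il im _]]] := has_index_mid sq' sc cq qO ik.
  exists l, m; split=> //; apply: has_index_uniq ik _ => //.
  by apply: has_index_trans il im => //; apply: subgrp_OK.
have fq := submod_index sq frac_OK qO il.
have lk := index_ltn frac_OK fq fc cq qO nqc ik il.
have [p pm qp] := IH _ _ fq qO il (leq_trans lk kn) q1.
by exists p => //; apply: subset_trans qp.
Qed.

Definition ideal_adjoin a x : set K := [set y | exists2 z, a z & exists2 u, O u & y = z + u * x].

Lemma submod_adjoin a x : OK_submodule (V := K^o) a -> OK_submodule (V := K^o) (ideal_adjoin a x).
Proof.
move=> [a0 aD aM]; split.
- by exists 0 => //; exists 0; [apply: OK0 | rewrite mul0r addr0].
- move=> _ _ [z az [u Ou ->]] [z' az' [u' Ou' ->]]; exists (z + z'); first exact: aD.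
  by exists (u + u'); [apply: OKD | rewrite mulrDl addrACA].
- move=> d _ Od [z az [u Ou ->]]; exists (d * z); first exact: aM.
  by exists (d * u); [apply: OKM | rewrite -[_ *: _]/(_ * _) mulrDr mulrA].
Qed.

Lemma adjoin_sub a x : a `<=` ideal_adjoin a x.
Proof. by move=> z az; exists z => //; exists 0; [apply: OK0 | rewrite mul0r addr0]. Qed.

Lemma adjoin_mem a x : OK_submodule (V := K^o) a -> ideal_adjoin a x x.
Proof. by case=> a0 _ _; exists 0 => //; exists 1; [apply: OK1 | rewrite mul1r add0r]. Qed.

Lemma maximal_prime p x y : maximal_ideal p -> O x -> O y -> p (x * y) -> ~ p x -> p y.
Proof.
move=> [fp pO p1 pm] Ox Oy pxy npx; have [sp _ _] := fp.
have [|[z pz [u Ou e]]|e] := pm _ (submod_adjoin x sp) _ (@adjoin_sub p x).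
- move=> _ [z pz [u Ou ->]]; apply: OKD; [exact: pO | exact: OKM].
- case: sp => _ pD pM; rewrite -[y]mul1r e mulrDl; apply: pD.
    by rewrite mulrC; apply: pM.
  by rewrite -mulrA; apply: pM.
- by case: npx; rewrite -e; apply: adjoin_mem.
Qed.

(** * Products of maximal ideals and the invertibility of fractional ideals *)

Definition ideal_prod (s : seq (set K)) := foldr (@ideal_mul K) O s.

Lemma submod_prod (s : seq (set K)) : (forall q, q \in s -> fractional_ideal q) ->
  OK_submodule (V := K^o) (ideal_prod s).
Proof.
case: s => [|q s] h; first by case: frac_OK.
by apply: submod_mul; case: (h q (mem_head _ _)).
Qed.

Lemma ideal_prod_sub (s : seq (set K)) : (forall q, q \in s -> q `<=` O) -> ideal_prod s `<=` O.
Proof.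
elim: s => [|q s IH] h; first exact: subset_refl.
apply: ideal_mul_subP; first by case: frac_OK.
move=> x y qx sy; apply: OKM; first by apply: (h q) => //; rewrite mem_head.
by apply: IH sy => r rs; apply: h; rewrite inE rs orbT.
Qed.

Lemma ideal_prod_cat (s t : seq (set K)) : (forall q, q \in s ++ t -> fractional_ideal q) ->
  ideal_prod (s ++ t) = ideal_mul (ideal_prod s) (ideal_prod t).
Proof.
elim: s => [|q s IH] h /=; first by rewrite ideal_mulO //; apply: submod_prod.
rewrite IH => [|r rs]; last by apply: h; rewrite inE rs orbT.
rewrite ideal_mulA //; first by case: (h q (mem_head _ _)).
by apply: submod_prod => r rt; apply: h; rewrite inE mem_cat rt !orbT.
Qed.

(** For x in q but not in p, finiteness of O/p gives i < j with x^i (1 - x^(j-i)) in p. Primality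
    puts 1 - x^(j-i) in p <= q, hence 1 in q. *)
Lemma prime_finite_maximal p : fractional_ideal p -> p `<=` O -> ~ p 1 ->
  (forall x y, O x -> O y -> p (x * y) -> p x \/ p y) -> maximal_ideal p.
Proof.
move=> fp pO p1 pP; split=> // q sq qO pq.
have [qp|/existsNP[x /not_implyP[qx npx]]] := pselect (q `<=` p); first by right; apply/seteqP.
left; have Ox := qO _ qx.
have OX k : O (x ^+ k) by elim: k => [|k IH]; rewrite ?exprS; [apply: OK1 | apply: OKM].
have npX k : ~ p (x ^+ k).
  by elim: k => [|k IH] //; rewrite exprS => /(pP _ _ Ox (OX k))[].
have [k [I [r [cI _ ar _]]] _] := frac_finite_index frac_OK fp pO.
pose f (i : 'I_k.+1) := projT1 (cid (ar _ (OX i))).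
have fP (i : 'I_k.+1) : p (x ^+ i - r (f i)) by rewrite /f; case: cid.
have : ~~ injectiveb f.
  by apply/injectiveP => /leq_card; rewrite cI card_ord ltnn.
case/injectivePn => i [j]; wlog ij : i j / (i < j)%N => [th nij eij|_ eij].
  case: (ltngtP i j) => h; [exact: th h nij eij | | ].
    by apply: th h _ (esym eij); rewrite eq_sym.
  by move: nij; rewrite -val_eqE /= h eqxx.
have : p (x ^+ i * (1 - x ^+ (j - i))).
  rewrite mulrBr mulr1 -exprD subnKC ?(ltnW ij) //.
  have := submod_sub (let: And3 sp _ _ := fp in sp) (fP i) (fP j).
  by rewrite eij opprB addrA subrK.
case/(pP _ _ (OX i)) => [|/npX //|/pq q1].
  by apply: OKB; [apply: OK1 | apply: OX].
rewrite -[1](subrK (x ^+ (j - i))); case: sq => _ qD qM; apply: qD => //.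
by rewrite -[(j - i)%N]prednK ?subn_gt0 // exprSr; apply: qM.
Qed.

(** Induction on [O : c]. If c is not maximal it is not prime, so x y lies in c for some x, y
    outside c. The ideals c + O x and c + O y have smaller index, and their product lies in c. *)
Lemma prod_maximal_sub c : fractional_ideal c -> c `<=` O ->
  exists2 s : seq (set K), (forall q, q \in s -> maximal_ideal q) & ideal_prod s `<=` c.
Proof.
move=> fc cO; have [k ik _] := frac_finite_index frac_OK fc cO.
have [n] := ubnP k; elim: n k c fc cO ik => // n IH k c fc cO ik kn.
have [c1|c1] := pselect (c 1).
  by exists [::] => //=; rewrite (ideal_unit _ cO c1) //; case: fc.
have [cm|ncm] := pselect (maximal_ideal c).
  exists [:: c]; first by move=> q; rewrite inE => /eqP->.
  by rewrite /= ideal_mulC ideal_mulO //; case: fc.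
have [x [y [Ox Oy cxy ncx ncy]]] : exists x y, [/\ O x, O y, c (x * y), ~ c x & ~ c y].
  apply: contrapT => h; apply: ncm; apply: prime_finite_maximal => // x y Ox Oy cxy.
  have [cx|ncx] := pselect (c x); first by left.
  by right; apply: contrapT => ncy; apply: h; exists x, y.
have [sc _ _] := fc.
have step z : O z -> ~ c z -> exists2 s : seq (set K),
    (forall q, q \in s -> maximal_ideal q) & ideal_prod s `<=` ideal_adjoin c z.
  move=> Oz ncz; have sA := submod_adjoin z sc.
  have AO : ideal_adjoin c z `<=` O.
    by move=> _ [t ct [u Ou ->]]; apply: OKD; [apply: cO | apply: OKM].
  have sO := subgrp_OK K; have sc' := subgrp_frac fc.
  have [l [m [il im _]]] := has_index_mid (subgrp_submod sA) sc' (@adjoin_sub c z) AO ik.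
  have fA := submod_index sA frac_OK AO il.
  apply: (IH l) => //; rewrite ltnS in kn; apply: leq_trans kn.
  apply: (index_ltn frac_OK fA fc (@adjoin_sub c z) AO _ ik il) => e.
  by apply: ncz; rewrite -e; apply: adjoin_mem.
have [s sm sx] := step x Ox ncx; have [t tm ty] := step y Oy ncy.
exists (s ++ t); first by move=> q; rewrite mem_cat => /orP[/sm|/tm].
rewrite ideal_prod_cat; last first.
  by move=> q; rewrite mem_cat => /orP[/sm|/tm] [].
apply: ideal_mul_subP => // u v /sx[z cz [d Od ->]] /ty[z' cz' [d' Od' ->]].
case: (sc) => _ cD cM; rewrite mulrDl; apply: (cD).
  by rewrite mulrC; apply: cM => //; apply: OKD; [apply: cO | apply: OKM].
rewrite mulrDr; apply: cD; first by apply: cM => //; apply: OKM.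
by rewrite mulrACA; apply: cM => //; apply: OKM.
Qed.

(* If Ann w <= p in O / a, a product of maximal ideals killing w yields an
   element with annihilator p. *)
Lemma annihilated_by_maximal p (a0 : K) (s : seq (set K)) (w : K) : maximal_ideal p -> p a0 -> a0 != 0 ->
  (forall q, q \in s -> maximal_ideal q) -> O w ->
  (forall x, O x -> scale_set a0 O (x * w) -> p x) ->
  (forall x, ideal_prod s x -> scale_set a0 O (x * w)) ->
  exists b : K, [/\ O b, ~ scale_set a0 O b & forall x, p x -> scale_set a0 O (x * b)].
Proof.
move=> pm pa nza; have [fp pO p1 pmax] := pm.
elim: s w => [|q s IH] w sm Ow wp ws.
  by case: p1; apply: wp => //=; [apply: OK1 | apply: ws; apply: OK1].
have qm := sm q (mem_head _ _); have [fq qO q1 qmax] := qm.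
have sm' r : r \in s -> maximal_ideal r by move=> rs; apply: sm; rewrite inE rs orbT.
(* If q <= p then q = p: either the remaining product already kills w, or one of its elements b does
   not, and b w is the element sought. Otherwise w is replaced by y w with y in q outside p;
   primality keeps its annihilator inside p. *)
have [qp|/existsNP[y /not_implyP[qy npy]]] := pselect (q `<=` p).
  have {}qp : q = p.
    by have [] := qmax p (let: And3 sp _ _ := fp in sp) pO qp.
  have [h|/existsNP[b /not_implyP[sb nb]]] :=
      pselect (forall x, ideal_prod s x -> scale_set a0 O (x * w)).
    exact: IH wp h.
  exists (b * w); split=> //.
    by apply: OKM => //; apply: ideal_prod_sub sb => r /sm'[].
  move=> x px; rewrite mulrA; apply: ws => /=.
  by rewrite qp; apply: ideal_mul_mem.
apply: (IH (y * w)) => //.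
- by apply: OKM => //; apply: qO.
- move=> x Ox; rewrite mulrA => /(wp _ (OKM Ox (qO _ qy))) pxy.
  apply: contrapT => npx; apply: npy; apply: maximal_prime pxy npx => //.
  exact: qO.
- move=> x sx; rewrite mulrA mulrC mulrA [w * _]mulrC -mulrA [w * _]mulrC.
  rewrite mulrA [x * y]mulrC; apply: ws => /=; exact: ideal_mul_mem.
Qed.

(** In O / a0 O with a0 <> 0 in p, the annihilator of 1 lies in p, so some b outside a0 O satisfies
    p b <= a0 O. The element is b / a0. *)
Lemma maximal_inverse_proper p : maximal_ideal p ->
  exists x, ~ O x /\ forall y, p y -> O (x * y).
Proof.
move=> pm; have [fp pO p1 _] := pm; have [_ [a0 pa nza] _] := fp.
have fa : fractional_ideal (scale_set a0 O) by apply: frac_scale => //; apply: frac_OK.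
have aO : scale_set a0 O `<=` O by move=> _ [u Ou <-]; apply: OKM => //; apply: pO.
have [s sm sa] := prod_maximal_sub fa aO.
have [| | |b [Ob nb pb]] := annihilated_by_maximal (w := 1) pm pa nza sm.
- exact: OK1.
- by move=> x Ox; rewrite mulr1 => -[u Ou <-]; rewrite mulrC; apply: frac_mulO.
- by move=> x sx; rewrite mulr1; apply: sa.
exists (b / a0); split=> [h|y /pb[u Ou e]].
  by apply: nb; exists (b / a0) => //; rewrite mulrCA divff ?mulr1.
by rewrite mulrAC [b * y]mulrC -e mulrAC divff // mul1r.
Qed.

(** Otherwise the product lies in a maximal ideal p. A non-integral x with x p <= O then maps a^-1
    into itself, and [almost_integral] makes x integral. *)
Lemma frac_mulV a : fractional_ideal a -> ideal_mul a (ideal_inv a) = O.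
Proof.
move=> fa; have fi := frac_inv fa; have fc := frac_mul fa fi.
set c := ideal_mul _ _ in fc *.
have cO : c `<=` O.
  apply: ideal_mul_subP; first by case: frac_OK.
  by move=> x y ax iy; rewrite mulrC; apply: iy.
have [sc _ _] := fc.
apply: ideal_unit => //; apply: contrapT => c1.
have [p pm cp] := maximal_above fc cO c1.
have [x [nOx px]] := maximal_inverse_proper pm; apply: nOx.
apply: (almost_integral fi) => y iy z az; rewrite -mulrA; apply: px; apply: cp.
by rewrite mulrC; apply: ideal_mul_mem.
Qed.

Lemma frac_mulI c a b : fractional_ideal c -> fractional_ideal a -> fractional_ideal b ->
  ideal_mul c a = ideal_mul c b -> a = b.
Proof.
move=> fc [sa _ _] [sb _ _] e; have fi := frac_inv fc; have [sc _ _] := fc; have [si _ _] := fi.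
rewrite -(ideal_mulO sa) -(ideal_mulO sb) -(frac_mulV fc) [ideal_mul c _]ideal_mulC.
by rewrite -!ideal_mulA // e.
Qed.

Lemma frac_mul_sub a b : fractional_ideal a -> b `<=` O -> ideal_mul a b `<=` a.
Proof.
move=> fa bO; have [sa _ _] := fa; apply: ideal_mul_subP => // x y ax /bO Oy.
by rewrite mulrC; apply: frac_mulO.
Qed.

(** c / cp is a line over O / p: for x in c outside cp, the map u |-> u x induces a bijection O/p ->
    c/cp. It is injective because the ideal of the u with u x in cp is proper and contains p; it is
    surjective because c^-1 (cp + O x) lies between p and O and is not p. *)
Lemma index_mul_maximal c p k : fractional_ideal c -> maximal_ideal p -> has_index O p k ->
  has_index c (ideal_mul c p) k.
Proof.
move=> fc pm [I [r [cI rO Or rI]]]; have [fp pO p1 pmax] := pm.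
have fcp := frac_mul fc fp; have cpc := frac_mul_sub fc pO.
have [sc _ _] := fc; have [scp _ _] := fcp; have [sp _ _] := fp.
have fi := frac_inv fc; have [si _ _] := fi; have [sO _ _] := frac_OK.
have [x cx ncpx] : exists2 x, c x & ~ ideal_mul c p x.
  apply: contrapT => h; apply: p1.
  suff -> : p = O by apply: OK1.
  apply: (frac_mulI fc) => //; first exact: frac_OK.
  rewrite [RHS]ideal_mulC ideal_mulO //; apply/seteqP; split=> // x cx.
  by apply: contrapT => nx; apply: h; exists x.
pose p' : set K := [set u | O u /\ ideal_mul c p (u * x)].
have Dp' : p' = p.
  have [||u pu|[_ q1]|//] := pmax p'.
  - split; first by split; [apply: OK0 | rewrite mul0r; case: scp].
      move=> u v [Ou pu] [Ov pv]; split; first exact: OKD.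
      by rewrite mulrDl; case: scp => _ cD _; apply: cD.
    move=> d u Od [Ou pu]; split; first exact: OKM.
    by rewrite -[_ *: _]/(_ * _) -mulrA; case: scp => _ _; apply.
  - by move=> u [].
  - by split; [apply: pO | rewrite mulrC; apply: ideal_mul_mem].
  - by case: ncpx; rewrite -[x]mul1r.
have sA := submod_adjoin x scp.
have Ac : ideal_adjoin (ideal_mul c p) x = c.
  have Ac : ideal_adjoin (ideal_mul c p) x `<=` c.
    move=> _ [z /cpc cz [u Ou ->]]; case: (sc) => _ cD cM.
    by apply: cD => //; apply: cM.
  have E : ideal_mul (ideal_inv c) (ideal_mul c p) = p.
    by rewrite ideal_mulA // [ideal_mul _ c]ideal_mulC frac_mulV // ideal_mulO.
  have [|||h|h] := pmax (ideal_mul (ideal_inv c) (ideal_adjoin (ideal_mul c p) x)).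
  - exact: submod_mul.
  - move=> u /(ideal_mulS Ac); rewrite ideal_mulC frac_mulV //.
  - rewrite -[X in X `<=` _]E; apply: ideal_mulS; exact: adjoin_sub.
  - apply/seteqP; split=> // z cz; rewrite -(ideal_mulO sA) -(frac_mulV fc).
    rewrite -ideal_mulA // -[z]mulr1; apply: ideal_mul_mem => //.
  - exfalso; apply: ncpx; rewrite -(ideal_mulO scp) -(frac_mulV fc) -ideal_mulA // E -h.
    rewrite ideal_mulA // frac_mulV // ideal_mulO //; exact: adjoin_mem.
exists I, (fun i => x * r i); split=> //.
- by move=> i; rewrite mulrC; apply: frac_mulO.
- move=> y; rewrite -{1}Ac => -[z cpz [u Ou ->]]; have [i ui] := Or _ Ou.
  exists i; rewrite -addrA; case: (scp) => _ cD _; apply: cD => //.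
  by rewrite [u * x]mulrC -mulrBr; apply: ideal_mul_mem.
- move=> i j; rewrite -mulrBr mulrC => h; apply: rI; rewrite -Dp'.
  by split=> //; apply: OKB.
Qed.

(** Induction on [O : b]: a maximal p above b is split off as b = b' p, where b' = p^-1 b is
    strictly larger than b. *)
Lemma index_mul a b k : fractional_ideal a -> fractional_ideal b -> b `<=` O ->
  has_index O b k -> has_index a (ideal_mul a b) k.
Proof.
move=> fa fb bO ik; have [n] := ubnP k; elim: n k a b fa fb bO ik => // n IH k a b fa fb bO ik kn.
have [sa _ _] := fa; have [sb _ _] := fb.
have [b1|b1] := pselect (b 1).
  have bE := ideal_unit sb bO b1.
  have <- : 1%N = k.
    apply: (has_index_uniq (subgrp_OK K)) (has_index1 (subgrp_OK K)) _.
    by rewrite -[X in has_index _ X]bE.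
  by rewrite bE ideal_mulC ideal_mulO //; apply/has_index1/subgrp_frac.
have [p pm bp] := maximal_above fb bO b1; have [fp pO p1 _] := pm.
have [sp _ _] := fp.
have fi := frac_inv fp; have [si _ _] := fi.
pose b' := ideal_mul (ideal_inv p) b; have fb' := frac_mul fi fb; rewrite -/b' in fb'.
have [sb' _ _] := fb'.
have Db : b = ideal_mul b' p.
  by rewrite [RHS]ideal_mulC ideal_mulA // frac_mulV // ideal_mulO.
have b'O : b' `<=` O.
  by rewrite -(frac_mulV fp) [X in _ `<=` X]ideal_mulC; apply: ideal_mulS.
have bb' : b `<=` b' by rewrite {1}Db; apply: frac_mul_sub.
have nbb' : b' <> b.
  move=> e; apply: p1; suff -> : p = O by apply: OK1.
  apply: (frac_mulI fb') => //; first exact: frac_OK.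
  by rewrite -Db [RHS]ideal_mulC ideal_mulO.
have [l [m [il im ->]]] := index_split frac_OK fb' fb bb' b'O ik.
have lk := index_ltn frac_OK fb' fb bb' b'O nbb' ik il.
have [m' im' _] := frac_finite_index frac_OK fp pO.
have mm : m' = m.
  apply: (has_index_uniq (subgrp_frac fb)) im.
  by rewrite Db; apply: index_mul_maximal.
rewrite mm in im'.
have fab' := frac_mul fa fb'; have fab := frac_mul fa fb.
apply: has_index_trans (IH l a b' fa fb' b'O il (leq_trans lk kn)) _; try exact: subgrp_frac.
- exact: frac_mul_sub.
- exact: ideal_mulS.
- rewrite [in X in has_index _ X]Db ideal_mulA //; exact: index_mul_maximal.
Qed.

Lemma coset_indexE a b k : subgrp b -> has_index a b k -> coset_index a b = k.
Proof.
move=> sb [I [r [cI ra ar rI]]].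
have coset_eq x y : [set x + z | z in b] = [set y + z | z in b] <-> b (x - y).
  split=> [e|bxy].
    have : [set y + z | z in b] x by rewrite -e; exists 0; rewrite ?addr0 //; case: sb.
    by case=> z bz <-; rewrite addrC addKr.
  apply/seteqP; split=> _ [z bz <-].
    by exists (x - y + z); [apply: subgrpD | rewrite addrA [y + _]addrC subrK].
  exists (z - (x - y)); first by case: sb => _; apply.
  by rewrite opprB addrCA [x + _]addrC subrK addrC.
pose f i := [set r i + y | y in b].
rewrite /coset_index.
have -> : [set [set x + y | y in b] | x in a] = [set` [fset f i | i in I]%fset].
  apply/seteqP; split=> [_ [x ax <-]|_ /= /imfsetP[i _ ->]].
    by have [i xi] := ar _ ax; apply/imfsetP; exists i => //; apply/coset_eq.
  by exists (r i).
rewrite set_fsetK card_imfset /=; last by move=> i j /coset_eq/rI.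
by rewrite -cI cardT enumT unlock.
Qed.

(** * The absolute norm of fractional ideals *)

Variable R : realType.
Local Notation N := (ideal_norm R).

(** The intersection e of O and a gives two chains from O down to d e, one through d a and one
    through d O, with the same total index. *)
Lemma ideal_normE a (d : K) k l : fractional_ideal a -> O d -> d != 0 -> (forall x, a x -> O (d * x)) ->
  has_index O (scale_set d a) k -> has_index O (scale_set d O) l ->
  N a = k%:R / l%:R.
Proof.
move=> fa Od nzd da ik il.
have fO := frac_OK; have sO := subgrp_OK K; have sa := subgrp_frac fa.
pose e := O `&` a; have se : subgrp e by apply: subgrpI.
have fe : fractional_ideal e.
  have [[a0 aD aM] [x ax nzx] _] := fa; split.
  - split; first by split=> //; apply: OK0.
      by move=> x' y [? ?] [? ?]; split; [apply: OKD | apply: aD].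
    by move=> u x' Ou [? ?]; split; [apply: OKM | apply: aM].
  - by exists (d * x); [split; [apply: da | apply: aM] | rewrite mulf_neq0].
  - by exists 1; split; [apply: OK1 | apply: oner_neq0 | move=> x' [? _]; rewrite mul1r].
have eO : e `<=` O by move=> x [].
have ea : e `<=` a by move=> x [].
have [u iu u0] := frac_finite_index fO fe eO.
have [v iv v0] := frac_finite_index fa fe ea.
rewrite /ideal_norm (coset_indexE se iu) (coset_indexE se iv).
have daO : scale_set d a `<=` O by move=> _ [x ax <-]; apply: da.
have dOO : scale_set d O `<=` O by move=> _ [x ax <-]; apply: OKM.
have de (x y : set K) : x `<=` y -> scale_set d x `<=` scale_set d y.
  by move=> xy _ [t xt <-]; exists t => //; apply: xy.
have sde := subgrp_scale d se.
have i1 := has_index_trans sO daO (subgrp_scale d sa) sde (de _ _ ea) ik (has_index_scale nzd iv).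
have i2 := has_index_trans sO dOO (subgrp_scale d sO) sde (de _ _ eO) il (has_index_scale nzd iu).
have := has_index_uniq sde i1 i2 => E.
have l0 := has_index_gt0 sO il.
apply/eqP; rewrite eqr_div ?pnatr_eq0 -?lt0n // -!natrM.
by rewrite E mulnC.
Qed.

Lemma ideal_norm_gt0 a : fractional_ideal a -> 0 < N a.
Proof.
move=> fa; have [_ _ [d [Od nzd da]]] := fa.
have fda := frac_scale nzd fa; have fdO := frac_scale nzd frac_OK.
have [|k ik k0] := frac_finite_index frac_OK fda; first by move=> _ [x ax <-]; apply: da.
have [|l il l0] := frac_finite_index frac_OK fdO; first by move=> _ [x ax <-]; apply: OKM.
by rewrite (ideal_normE fa Od nzd da ik il) divr_gt0 // ltr0n.
Qed.

Lemma ideal_norm_integral a k : fractional_ideal a -> a `<=` O -> has_index O a k ->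
  N a = k%:R.
Proof.
move=> fa aO ik; have O1 := OK1 K.
rewrite (ideal_normE (d := 1 : K) (k := k) (l := 1) fa O1 (oner_neq0 _)) ?divr1 ?scale_set1 //.
  by move=> x /aO; rewrite mul1r.
exact/has_index1/subgrp_OK.
Qed.

Lemma ideal_norm_OK : N O = 1.
Proof.
rewrite (@ideal_norm_integral _ 1%N) //; first exact: frac_OK.
exact/has_index1/subgrp_OK.
Qed.

Lemma ideal_norm_mul a b : fractional_ideal a -> fractional_ideal b ->
  N (ideal_mul a b) = N a * N b.
Proof.
move=> fa fb; have fO := frac_OK; have sO := subgrp_OK K.
have [_ _ [d [Od nzd da]]] := fa; have [_ _ [e [Oe nze eb]]] := fb.
have fda := frac_scale nzd fa; have fdO := frac_scale nzd fO.
have feb := frac_scale nze fb; have feO := frac_scale nze fO.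
have ebO : scale_set e b `<=` O by move=> _ [x ax <-]; apply: eb.
have eOO : scale_set e O `<=` O by move=> _ [x ax <-]; apply: OKM.
have daO : scale_set d a `<=` O by move=> _ [x ax <-]; apply: da.
have dOO : scale_set d O `<=` O by move=> _ [x ax <-]; apply: OKM.
have [k ik _] := frac_finite_index fO fda daO.
have [l il _] := frac_finite_index fO fdO dOO.
have [k' ik' _] := frac_finite_index fO feb ebO.
have [l' il' _] := frac_finite_index fO feO eOO.
rewrite (ideal_normE fa Od nzd da ik il) (ideal_normE fb Oe nze eb ik' il').
have key (x y : set K) i j : fractional_ideal x -> fractional_ideal y -> x `<=` O -> y `<=` O ->
    has_index O x i -> has_index O y j -> has_index O (ideal_mul x y) (i * j).
  move=> fx fy xO yO ii ij; apply: has_index_trans ii (index_mul fx fy yO ij) => //;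
   try exact: subgrp_frac.
  - exact/subgrp_frac/frac_mul.
  - exact: frac_mul_sub.
rewrite (ideal_normE (d := d * e) (k := k * k') (l := l * l') (frac_mul fa fb)).
- by rewrite !natrM mulf_div.
- exact: OKM.
- by rewrite mulf_neq0.
- move=> _ [t tP ->]; rewrite mulr_sumr big_seq; apply: OK_sum => u /tP[au bu].
  by rewrite mulrACA; apply: OKM; [apply: da | apply: eb].
- have := key _ _ _ _ fda feb daO ebO ik ik'.
  by rewrite -scale_mulE ideal_mulC -scale_mulE scale_setM ideal_mulC.
- have := key _ _ _ _ fdO feO dOO eOO il il'.
  rewrite -scale_mulE ideal_mulC -scale_mulE scale_setM ideal_mulO //.
  by case: fO.
Qed.

(** a = b (b^-1 a), and b^-1 a is integral, so its norm is a positive integer. *)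
Lemma ideal_norm_sub a b : fractional_ideal a -> fractional_ideal b -> a `<=` b ->
  N b <= N a.
Proof.
move=> fa fb ab; have fi := frac_inv fb; have fc := frac_mul fi fa.
have [sa _ _] := fa; have [sb _ _] := fb.
have cO : ideal_mul (ideal_inv b) a `<=` O.
  by rewrite -(frac_mulV fb) [X in _ `<=` X]ideal_mulC; apply: ideal_mulS.
have -> : a = ideal_mul b (ideal_mul (ideal_inv b) a).
  by rewrite ideal_mulA // frac_mulV // ideal_mulO.
have [k ik k0] := frac_finite_index frac_OK fc cO.
rewrite ideal_norm_mul // (ideal_norm_integral fc cO ik).
by rewrite ler_peMr ?ler1n // ltW // ideal_norm_gt0.
Qed.

Lemma ideal_norm_scale (w : (\dim {:K}).-tuple K) (x : K) a : basis_of {:K} w -> fractional_ideal a -> x != 0 ->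
  N (scale_set x a) = ratr `|\det (mult_mx w x)| * N a.
Proof.
move=> bw fa nzx; have fO := frac_OK; have fx := frac_scale nzx fO.
have [sa _ _] := fa.
have -> : scale_set x a = ideal_mul (scale_set x O) a.
  by rewrite -scale_mulE ideal_mulO.
rewrite ideal_norm_mul //; congr (_ * _).
have [m nzm Om] := integral_multiple x.
have nzm' : m%:~R != 0 :> K by rewrite intr_eq0K.
have [w' bw' Ow'] := integral_basis K.
(* [index_OK] requires an integral basis w', whereas w is arbitrary. *)
have detE y : \det (mult_mx w y) = \det (mult_mx w' y).
  pose U : 'M[rat]_(\dim {:K}) := \matrix_(i, j) coord w' j w`_i.
  have cU z : coords w' z = coords w z *m U.
    apply/rowP => j; rewrite mxE {1}(coordsE bw z) linear_sum /= mxE.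
    by apply: eq_bigr => i _; rewrite linearZ /= !mxE.
  pose U' : 'M[rat]_(\dim {:K}) := \matrix_(i, j) coord w j w'`_i.
  have cU' z : coords w z = coords w' z *m U'.
    apply/rowP => j; rewrite mxE {1}(coordsE bw' z) linear_sum /= mxE.
    by apply: eq_bigr => i _; rewrite linearZ /= !mxE.
  have UU : U *m U' = 1%:M.
    rewrite -(mult_mx1 bw); apply/esym/(mult_mx_eqP bw) => z.
    by rewrite mul1r {1}cU' cU mulmxA.
  have E : mult_mx w y = U *m mult_mx w' y *m U'.
    apply: (mult_mx_eqP bw) => z.
    by rewrite cU' coordsM // cU !mulmxA.
  rewrite E !det_mulmx mulrAC -det_mulmx UU det1 mul1r //.
rewrite detE.
have [k ik Dk] := index_OK bw' Ow' Om (mulf_neq0 nzm' nzx).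
have [l il Dl] := index_OK bw' Ow' (OK_int K m) nzm'.
have l0 := has_index_gt0 (subgrp_OK K) il.
rewrite (ideal_normE (d := m%:~R) (k := k) (l := l) fx) ?scale_setM //.
- have := mult_mxM bw' x m%:~R; rewrite mulrC => /(congr1 (fun A => `|\det A|)).
  rewrite det_mulmx normrM Dk Dl => /(congr1 (ratr : rat -> R)).
  rewrite ratr_nat rmorphM /= ratr_nat => ->.
  by rewrite mulrC mulKf // pnatr_eq0 -lt0n.
- exact: OK_int.
- by move=> _ [u Ou <-]; rewrite mulrA; apply: OKM.
Qed.

End IdealArithmetic.

(** * Positive definite matrices *)

Section HermitianMatrices.
Local Open Scope sesquilinear_scope.
Variable C : numClosedFieldType.

Definition posdef n (A : 'M[C]_n) :=
  A^t* = A /\ forall c : 'rV_n, c != 0 -> 0 < (c *m A *m c^t*) 0 0.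

Definition psd n (A : 'M[C]_n) :=
  A^t* = A /\ forall c : 'rV_n, 0 <= (c *m A *m c^t*) 0 0.

Lemma adjM m n p (A : 'M[C]_(m, n)) (B : 'M_(n, p)) : (A *m B)^t* = B^t* *m A^t*.
Proof. by rewrite trmx_mul map_mxM. Qed.

Lemma posdef_psd n (A : 'M[C]_n) : posdef A -> psd A.
Proof.
case=> hA pA; split=> // c; have [->|/pA/ltW //] := eqVneq c 0.
by rewrite !mul0mx mxE.
Qed.

Lemma psd_congr m n (B : 'M[C]_(m, n)) (A : 'M_n) : psd A -> psd (B *m A *m B^t*).
Proof.
case=> hA pA; split; first by rewrite !adjM trmxCK hA mulmxA.
by move=> c; have := pA (c *m B); rewrite adjM !mulmxA.
Qed.

Lemma posdef_congr m n (B : 'M[C]_(m, n)) (A : 'M_n) : row_free B -> posdef A ->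
  posdef (B *m A *m B^t*).
Proof.
move=> fB pA; have [hA _] := psd_congr B (posdef_psd pA); split=> // c nzc.
have := proj2 pA (c *m B); rewrite adjM !mulmxA; apply.
by apply: contraNneq nzc => /(congr1 (mulmx^~ (pinvmx B))); rewrite mulmxKp // mul0mx => ->.
Qed.

Lemma psd_spectral n (A : 'M[C]_n) : psd A -> exists (P : 'M_n) (d : 'rV_n),
  [/\ P \is unitarymx, forall i, 0 <= d 0 i & A = P^t* *m diag_mx d *m P].
Proof.
case=> hA pA; exists (spectralmx A), (spectral_diag A).
have uP := spectral_unitarymx A.
have nA : A \is normalmx.
  by apply/hermitian_normalmx/is_hermitianmxP; rewrite expr0 scale1r hA.
have EA : A = (spectralmx A)^t* *m diag_mx (spectral_diag A) *m spectralmx A.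
  by rewrite -invmx_unitary //; apply/orthomx_spectralP.
split=> // i; set P := spectralmx A in uP EA *; set d := spectral_diag A in EA *.
have PP : P *m P^t* = 1%:M by apply/unitarymxP.
pose e : 'rV[C]_n := delta_mx 0 i.
have := pA (e *m P).
have -> : e *m P *m A *m (e *m P)^t* = e *m diag_mx d *m e^t*.
  rewrite EA adjM !mulmxA -(mulmxA _ P (P^t*)) PP mulmx1.
  by rewrite -(mulmxA _ P (P^t*)) PP mulmx1.
rewrite -rowE row_diag_mx trmx_delta map_delta_mx -scalemxAl mul_delta_mx.
by rewrite !mxE !eqxx mulr1.
Qed.

Lemma posdef_factor n (A : 'M[C]_n) : posdef A ->
  exists2 X : 'M_n, X \in unitmx & A = X *m X^t*.
Proof.
move=> pA; have [P [d [uP d0 EA]]] := psd_spectral (posdef_psd pA).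
have PP : P *m P^t* = 1%:M by apply/unitarymxP.
pose s := \row_i sqrtC (d 0 i).
have sE : diag_mx s *m (diag_mx s)^t* = diag_mx d.
  rewrite tr_diag_mx map_diag_mx mulmx_diag; congr diag_mx; apply/rowP => i.
  by rewrite !mxE /= conj_Creal ?sqrtC_real // -expr2 sqrtCK.
exists (P^t* *m diag_mx s); last first.
  by rewrite adjM trmxCK mulmxA -[_ *m diag_mx s *m _]mulmxA sE.
rewrite -row_free_unit; apply/row_freeP.
have nzd i : d 0 i != 0.
  apply/negP => /eqP z; pose e : 'rV[C]_n := delta_mx 0 i.
  have := proj2 pA (e *m P).
  have nz : e *m P != 0.
    apply/negP => /eqP /(congr1 (mulmx^~ (P^t*))); rewrite -mulmxA PP mulmx1 mul0mx.
    by move/matrixP/(_ 0 i); rewrite !mxE !eqxx => /eqP; rewrite oner_eq0.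
  move/(_ nz); rewrite EA adjM !mulmxA -(mulmxA _ P (P^t*)) PP mulmx1.
  rewrite -(mulmxA _ P (P^t*)) PP mulmx1 -rowE row_diag_mx z scale0r mul0mx mxE.
  by rewrite ltxx.
exists (diag_mx (\row_i (s 0 i)^-1) *m P).
rewrite mulmxA -[_ *m diag_mx s *m _]mulmxA mulmx_diag.
have -> : diag_mx (\row_i (s 0 i * (\row_i (s 0 i)^-1) 0 i)) = 1%:M.
  by apply/matrixP => i j; rewrite !mxE divff // sqrtC_eq0.
by rewrite mulmx1 -invmx_unitary // mulVmx // unitarymx_unit.
Qed.

Lemma posdef_unit n (A : 'M[C]_n) : posdef A -> A \in unitmx.
Proof.
case/posdef_factor => X uX ->; rewrite unitmx_mul uX unitmxE.
by rewrite det_map_mx det_tr unitfE conjC_eq0 -unitfE -unitmxE.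
Qed.

Lemma posdef_det n (A : 'M[C]_n) : posdef A -> 0 < \det A.
Proof.
move=> pA; have uA := posdef_unit pA; have [X _ E] := posdef_factor pA.
rewrite lt_def -unitfE -unitmxE uA E det_mulmx det_map_mx det_tr.
exact: mul_conjC_ge0.
Qed.

(** Writing Q as X times its adjoint reduces to Q = 1, where the determinant is the product of the 1
    + d_i over the eigenvalues d_i >= 0. *)
Lemma posdef_det_le n (Q W : 'M[C]_n) : posdef Q -> psd W -> \det Q <= \det (Q + W).
Proof.
move=> pQ pW; have [X uX EQ] := posdef_factor pQ.
pose W' := invmx X *m W *m (invmx X)^t*.
have pW' : psd W' by apply: psd_congr.
have [P [d [uP d0 EW]]] := psd_spectral pW'.
have PP : P^t* *m P = 1%:M by rewrite -invmx_unitary // mulVmx // unitarymx_unit.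
have EQW : Q + W = X *m (1%:M + W') *m X^t*.
  rewrite mulmxDr mulmx1 mulmxDl EQ; congr (_ + _).
  rewrite /W' !mulmxA mulmxV // mul1mx -mulmxA -adjM mulmxV //.
  by rewrite trmx1 map_mx1 mulmx1.
have E1 : 1%:M + W' = P^t* *m (1%:M + diag_mx d) *m P.
  by rewrite mulmxDr mulmx1 mulmxDl PP EW.
have detE : \det (1%:M + W') = \prod_i (1 + d 0 i).
  rewrite E1 !det_mulmx mulrAC -det_mulmx PP det1 mul1r.
  have -> : 1%:M + diag_mx d = diag_mx (\row_i (1 + d 0 i)).
    by apply/matrixP => i j; rewrite !mxE mulrnDl.
  by rewrite det_diag; apply: eq_bigr => i _; rewrite mxE.
rewrite EQW EQ !det_mulmx detE mulrAC [X in _ <= X]mulrC.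
rewrite [X in X <= _](_ : _ = 1 * (\det X * \det (X^t*))); last by rewrite mul1r.
rewrite ler_wpM2r // ?det_map_mx ?det_tr ?mul_conjC_ge0 //.
elim/big_ind: _ => // [x y x1 y1|i _]; last by rewrite lerDl.
by rewrite -[1]mulr1 ler_pM.
Qed.

(** * Schur complements and Fischer's inequality *)

Section Schur.
Variables (m n : nat) (P : 'M[C]_m) (Q : 'M[C]_(m, n)) (S : 'M[C]_n).

Definition schur := S - Q^t* *m invmx P *m Q.

Local Notation A := (block_mx P Q (Q^t*) S).
Hypothesis pA : posdef A.

Lemma posdef_block_hermitian : P^t* = P /\ S^t* = S.
Proof.
have := proj1 pA; rewrite tr_block_mx map_block_mx => /eq_block_mx[-> _ _ ->]//.
Qed.

Lemma posdef_block_ul : posdef P.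
Proof.
have fB : row_free (row_mx 1%:M 0 : 'M[C]_(m, m + n)).
  by apply/row_freeP; exists (col_mx 1%:M 0); rewrite mul_row_col mul0mx addr0 mulmx1.
have := posdef_congr fB pA.
rewrite mul_row_block !mul0mx !mul1mx !addr0 tr_row_mx map_col_mx mul_row_col.
by rewrite trmx1 map_mx1 trmx0 map_mx0 mulmx1 mulmx0 addr0.
Qed.

Lemma schur_posdef : posdef schur.
Proof.
have uP := posdef_unit posdef_block_ul.
pose Z := - (Q^t* *m invmx P).
have fB : row_free (row_mx Z 1%:M : 'M[C]_(n, m + n)).
  by apply/row_freeP; exists (col_mx 0 1%:M); rewrite mul_row_col mulmx0 add0r mulmx1.
have := posdef_congr fB pA.
rewrite mul_row_block !mul1mx tr_row_mx map_col_mx mul_row_col.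
have -> : Z *m P + Q^t* = 0 by rewrite /Z mulNmx mulmxKV // addNr.
by rewrite mul0mx add0r trmx1 map_mx1 mulmx1 /Z mulNmx addrC.
Qed.

Lemma det_schur : \det A = \det P * \det schur.
Proof.
have uP := posdef_unit posdef_block_ul.
have -> : A = block_mx 1%:M 0 (Q^t* *m invmx P) 1%:M *m block_mx P Q 0 schur.
  rewrite mulmx_block !mul1mx !mul0mx !addr0 mulmxKV // ; congr block_mx.
  by rewrite /schur addrC subrK.
by rewrite det_mulmx det_lblock det_ublock !det1 !mul1r.
Qed.

(** S is the Schur complement plus a positive semidefinite matrix, so [posdef_det_le] applies. *)
Lemma fischer : \det A <= \det P * \det S.
Proof.
have uP := posdef_unit posdef_block_ul.
rewrite det_schur ler_pM2l; last by apply/posdef_det/posdef_block_ul.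
rewrite -[S in X in _ <= X](subrK (Q^t* *m invmx P *m Q)); apply: posdef_det_le schur_posdef _.
have := psd_congr (Q^t* *m invmx P) (posdef_psd posdef_block_ul).
rewrite mulmxKV // adjM trmxCK mulmxA; congr psd.
have [hP _] := posdef_block_hermitian.
have -> : (invmx P)^t* = invmx P by rewrite trmx_inv map_invmx hP.
by [].
Qed.

End Schur.

(** * Koteljanskii's inequality and its equality case *)

Section Three.
Variables (n0 n1 n2 : nat) (P : 'M[C]_n0) (Q1 : 'M[C]_(n0, n1)) (Q2 : 'M[C]_(n0, n2)).
Variables (S1 : 'M[C]_n1) (T : 'M[C]_(n1, n2)) (S2 : 'M[C]_n2).
Local Notation A := (block_mx P (row_mx Q1 Q2) ((row_mx Q1 Q2)^t*) (block_mx S1 T (T^t*) S2)).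
Hypothesis pA : posdef A.

Let schurE : schur P (row_mx Q1 Q2) (block_mx S1 T (T^t*) S2) =
  block_mx (schur P Q1 S1) (T - Q1^t* *m invmx P *m Q2) ((T - Q1^t* *m invmx P *m Q2)^t*) (schur P Q2 S2).
Proof.
rewrite /schur tr_row_mx map_col_mx mul_col_mx mul_col_row opp_block_mx add_block_mx.
congr block_mx; rewrite linearB /= map_mxB !adjM trmxCK mulmxA.
have [hP _] := posdef_block_hermitian pA.
by rewrite trmx_inv map_invmx hP.
Qed.

Let pA1 : posdef (block_mx P Q1 (Q1^t*) S1).
Proof.
pose r : 'M[C]_(n1, n1 + n2) := row_mx 1%:M 0.
have r1 : row_mx Q1 Q2 *m r^t* = Q1.
  by rewrite /r tr_row_mx map_col_mx mul_row_col trmx1 map_mx1 trmx0 map_mx0 mulmx1 mulmx0 ?addr0 ?add0r.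
have r2 : r *m (row_mx Q1 Q2)^t* = Q1^t* by rewrite -[r in LHS]trmxCK -adjM r1.
have r3 : r *m block_mx S1 T (T^t*) S2 *m r^t* = S1.
  rewrite /r mul_row_block tr_row_mx map_col_mx mul_row_col trmx1 map_mx1 trmx0 map_mx0.
  by rewrite mulmx1 mulmx0 !mul0mx !mul1mx ?addr0 ?add0r.
have fB : row_free (block_mx 1%:M 0 0 r : 'M[C]_(n0 + n1, n0 + (n1 + n2))).
  apply/row_freeP; exists (block_mx 1%:M 0 0 (r^t*)).
  have rr : r *m r^t* = 1%:M.
    rewrite /r tr_row_mx map_col_mx mul_row_col trmx1 map_mx1 trmx0 map_mx0.
    by rewrite ?mulmx1 ?mulmx0 ?mul0mx ?addr0 ?add0r.
  by rewrite mulmx_block rr !mul1mx !mul0mx !mulmx0 !addr0 !add0r -scalar_mx_block.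
have := posdef_congr fB pA.
rewrite tr_block_mx map_block_mx !trmx0 !map_mx0 trmx1 map_mx1 !mulmx_block.
by rewrite !mul0mx !mulmx0 !mul1mx !mulmx1 !addr0 !add0r r1 r2 r3.
Qed.

Let pA2 : posdef (block_mx P Q2 (Q2^t*) S2).
Proof.
pose r : 'M[C]_(n2, n1 + n2) := row_mx 0 1%:M.
have r1 : row_mx Q1 Q2 *m r^t* = Q2.
  by rewrite /r tr_row_mx map_col_mx mul_row_col trmx1 map_mx1 trmx0 map_mx0 mulmx1 mulmx0 ?addr0 ?add0r.
have r2 : r *m (row_mx Q1 Q2)^t* = Q2^t* by rewrite -[r in LHS]trmxCK -adjM r1.
have r3 : r *m block_mx S1 T (T^t*) S2 *m r^t* = S2.
  rewrite /r mul_row_block tr_row_mx map_col_mx mul_row_col trmx1 map_mx1 trmx0 map_mx0.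
  by rewrite mulmx1 mulmx0 !mul0mx !mul1mx ?addr0 ?add0r.
have fB : row_free (block_mx 1%:M 0 0 r : 'M[C]_(n0 + n2, n0 + (n1 + n2))).
  apply/row_freeP; exists (block_mx 1%:M 0 0 (r^t*)).
  have rr : r *m r^t* = 1%:M.
    rewrite /r tr_row_mx map_col_mx mul_row_col trmx1 map_mx1 trmx0 map_mx0.
    by rewrite ?mulmx1 ?mulmx0 ?mul0mx ?addr0 ?add0r.
  by rewrite mulmx_block rr !mul1mx !mul0mx !mulmx0 !addr0 !add0r -scalar_mx_block.
have := posdef_congr fB pA.
rewrite tr_block_mx map_block_mx !trmx0 !map_mx0 trmx1 map_mx1 !mulmx_block.
by rewrite !mul0mx !mulmx0 !mul1mx !mulmx1 !addr0 !add0r r1 r2 r3.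
Qed.

(** After division by the square of det P this is Fischer's inequality for the Schur complement of P
    in A: by [schurE] its diagonal blocks are the Schur complements of P in the two principal
    submatrices. *)
Lemma koteljanskii :
  \det P * \det A <= \det (block_mx P Q1 (Q1^t*) S1) * \det (block_mx P Q2 (Q2^t*) S2).
Proof.
rewrite (det_schur pA) (det_schur pA1) (det_schur pA2) schurE mulrA mulrACA.
rewrite ler_pM2l; last by rewrite mulr_gt0 // posdef_det //; apply: posdef_block_ul pA.
by apply: fischer; rewrite -schurE; apply: schur_posdef.
Qed.

(** The condition says that the off-diagonal block of that Schur complement vanishes. *)
Lemma koteljanskii_eq : T = Q1^t* *m invmx P *m Q2 ->
  \det P * \det A = \det (block_mx P Q1 (Q1^t*) S1) * \det (block_mx P Q2 (Q2^t*) S2).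
Proof.
move=> ET; rewrite (det_schur pA) (det_schur pA1) (det_schur pA2) schurE mulrA mulrACA.
by rewrite ET subrr trmx0 map_mx0 det_ublock.
Qed.

End Three.
End HermitianMatrices.

(** * Determinants indexed by finite types *)

Section FiniteFamilies.

Definition sumf (I J : Type) (T : Type) (f : I -> T) (g : J -> T) (s : I + J) : T :=
  match s with inl i => f i | inr j => g j end.

Variable C : comUnitRingType.

(** With arbitrary finite index types, families are concatenated over I + J and tensored over I * J,
    without casts between ordinals. *)
Definition fmx (I J : finType) (A : I -> J -> C) : 'M[C]_(#|I|, #|J|) :=
  \matrix_(i, j) A (enum_val i) (enum_val j).

Definition fdet (I : finType) (A : I -> I -> C) : C := \det (fmx A).

Lemma eq_fmx (I J : finType) (A B : I -> J -> C) : A =2 B -> fmx A = fmx B.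
Proof. by move=> e; apply/matrixP => i j; rewrite !mxE e. Qed.

Lemma eq_fdet (I : finType) (A B : I -> I -> C) : A =2 B -> fdet A = fdet B.
Proof. by move=> e; rewrite /fdet (eq_fmx e). Qed.

Lemma fmx_mul (I J L : finType) (A : I -> J -> C) (B : J -> L -> C) :
  fmx A *m fmx B = fmx (fun i l => \sum_j A i j * B j l).
Proof.
apply/matrixP => i l; rewrite !mxE (reindex (@enum_val J predT)); last first.
  by exists enum_rank => j _; rewrite ?enum_valK ?enum_rankK.
by apply: eq_bigr => j _; rewrite !mxE.
Qed.

Lemma fdet_mul (I : finType) (A B : I -> I -> C) :
  fdet (fun i l => \sum_j A i j * B j l) = fdet A * fdet B.
Proof. by rewrite /fdet -det_mulmx fmx_mul. Qed.

(** Rows and columns undergo the same permutation, so the two signs cancel. *)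
Lemma fdetE (I : finType) n (f : 'I_n -> I) (A : I -> I -> C) : bijective f ->
  fdet A = \det (\matrix_(i, j) A (f i) (f j)).
Proof.
move=> bf; have cn : n = #|I| by have := bij_eq_card bf; rewrite card_ord.
subst n; have [g fK gK] := bf.
have inj_s : injective (fun i => enum_rank (f i)).
  by move=> i j /enum_rank_inj/(bij_inj bf).
pose s := perm inj_s.
have -> : \matrix_(i, j) A (f i) (f j) = row_perm s (col_perm s (fmx A)).
  by apply/matrixP => i j; rewrite !mxE !permE !enum_rankK.
rewrite row_permE col_permE !det_mulmx !det_perm odd_permV mulrCA -signr_addb addbb mulr1.
by [].
Qed.

Lemma fdet_reindex (I J : finType) (f : J -> I) (A : I -> I -> C) : bijective f ->
  fdet (fun i j => A (f i) (f j)) = fdet A.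
Proof.
move=> bf; have bv : bijective (@enum_val J predT).
  by exists enum_rank; [exact: enum_valK | exact: enum_rankK].
rewrite [RHS](fdetE (f := f \o @enum_val J predT)); last exact: bij_comp.
by congr (\det _); apply/matrixP => i j; rewrite !mxE.
Qed.

Lemma fdet_sum (I J : finType) (A : I + J -> I + J -> C) :
  fdet A = \det (block_mx (fmx (fun i j => A (inl i) (inl j))) (fmx (fun i j => A (inl i) (inr j)))
                          (fmx (fun i j => A (inr i) (inl j))) (fmx (fun i j => A (inr i) (inr j)))).
Proof.
pose f (k : 'I_(#|I| + #|J|)) : I + J :=
  match fintype.split k with inl i => inl (enum_val i) | inr j => inr (enum_val j) end.
have bf : bijective f.
  exists (fun s : I + J => unsplit (match s with inl i => inl (enum_rank i) | inr j => inr (enum_rank j) end)).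
    move=> k; rewrite /f -{2}[k]splitK; case: (fintype.split k) => i; by rewrite enum_valK.
  by move=> [i|j]; rewrite /f unsplitK enum_rankK.
rewrite (fdetE _ bf); congr (\det _); apply/matrixP => k l.
rewrite [LHS]mxE /f -[k in RHS]splitK -[l in RHS]splitK.
case: (fintype.split k) => i; case: (fintype.split l) => j /=;
  rewrite ?block_mxEul ?block_mxEur ?block_mxEdl ?block_mxEdr !mxE //.
Qed.

Lemma fdet_unit_tens (n : nat) (J : finType) (B : J -> J -> C) :
  fdet (fun u v : 'I_n * J => (u.1 == v.1)%:R * B u.2 v.2) = fdet B ^+ n.
Proof.
elim: n => [|n IH].
  have c0 : #|{: 'I_0 * J}| = 0%N by rewrite card_prod card_ord.
  rewrite /fdet; move: (fmx _); rewrite c0 => M; by rewrite det_mx00.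
pose f (s : J + 'I_n * J) : 'I_n.+1 * J :=
  match s with inl j => (ord0, j) | inr u => (lift ord0 u.1, u.2) end.
have bf : bijective f.
  exists (fun u => match unlift ord0 u.1 with None => inl u.2 | Some i => inr (i, u.2) end).
    by move=> [j|[i j]]; rewrite /f /= ?unlift_none ?liftK.
  by move=> [i j] /=; case: unliftP => [i' ->|->].
rewrite -(fdet_reindex _ bf) fdet_sum /=.
have z1 : fmx (fun (i : 'I_n * J) (j : J) => (lift ord0 i.1 == ord0)%:R * B i.2 j) = 0.
  by apply/matrixP => i j; rewrite !mxE eq_sym (negPf (neq_lift _ _)) mul0r.
rewrite z1 det_ublock exprS; congr (_ * _).
  by congr (\det _); apply: eq_fmx => i j; rewrite mul1r.
by rewrite -IH; congr (\det _); apply: eq_fmx.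
Qed.

(** A ⊗ B = (A ⊗ 1)(1 ⊗ B), and each factor is block diagonal with equal blocks up to a
    reindexing. *)
Lemma fdet_tens (I J : finType) (A : I -> I -> C) (B : J -> J -> C) :
  fdet (fun u v : I * J => A u.1 v.1 * B u.2 v.2) = fdet A ^+ #|J| * fdet B ^+ #|I|.
Proof.
have unit (I' J' : finType) (B' : J' -> J' -> C) :
    fdet (fun u v : I' * J' => (u.1 == v.1)%:R * B' u.2 v.2) = fdet B' ^+ #|I'|.
  rewrite -(@fdet_unit_tens #|I'|).
  pose f (u : 'I_#|I'| * J') : I' * J' := (enum_val u.1, u.2).
  rewrite -(fdet_reindex (f := f)); last first.
    exists (fun u => (enum_rank u.1, u.2)).
      by move=> [i j]; rewrite /f /= enum_valK.
    by move=> [i j]; rewrite /f /= enum_rankK.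
  by apply: eq_fdet => u v /=; rewrite (inj_eq enum_val_inj).
rewrite -(unit I J B).
have <- : fdet (fun u v : I * J => (u.2 == v.2)%:R * A u.1 v.1) = fdet A ^+ #|J|.
  rewrite -(unit J I A).
  rewrite -(fdet_reindex (f := fun u : J * I => (u.2, u.1))) //.
  by exists (fun u : I * J => (u.2, u.1)); case.
rewrite -fdet_mul; apply: eq_fdet => -[i j] [k l] /=.
rewrite (bigD1 (k, j)) //= !eqxx !mul1r big1 ?addr0 // => -[k' j'] /=.
rewrite xpair_eqE negb_and => /orP[/negPf ->|/negPf nj]; first by rewrite mul0r mulr0.
by rewrite eq_sym nj !mul0r.
Qed.

End FiniteFamilies.

(** * Gram determinants *)

Section HermitianForms.
Local Open Scope sesquilinear_scope.
Context {R : realType} {K : fieldExtType rat} {P : finType}.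
Variable sigma : P -> {rmorphism K -> R[i]}.
Local Notation C := R[i].

Definition indep (V : vectType K) (I : finType) (b : I -> V) :=
  forall c : I -> K, \sum_i c i *: b i = 0 -> forall i, c i = 0.

(** The absolute value of the norm from K to Q. *)
Definition absN (x : K) : R := ratr `|\det (mult_mx (vbasis {:K}) x)|.

Lemma Re_ge0 (z : C) : 0 <= z -> z = ((complex.Re z)%:C)%C /\ 0 <= complex.Re z.
Proof. by case: z => a b; rewrite lecE /= => /andP[/eqP -> ->]. Qed.

Lemma Re_gt0 (z : C) : 0 < z -> 0 < complex.Re z.
Proof. by case: z => a b; rewrite ltcE /= => /andP[_ ->]. Qed.

Lemma Re_mulr (x y : C) : 0 <= x -> 0 <= y ->
  complex.Re (x * y) = complex.Re x * complex.Re y.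
Proof. by move=> /Re_ge0[-> _] /Re_ge0[-> _]; rewrite -rmorphM. Qed.

Lemma Re_le (x y : C) : x <= y -> complex.Re x <= complex.Re y.
Proof. by case: x y => [a b] [c d]; rewrite lecE /= => /andP[_ ->]. Qed.

Lemma absN_places x : infinite_places sigma ->
  absN x = \prod_p complex.Re `|sigma p x| ^+ local_degree (sigma p).
Proof.
move=> places; apply: (@complexI R).
have := norm_places (vbasisP {:K}) places x => E.
rewrite rmorph_prod /= /absN fmorph_rat E; apply: eq_bigr => p _.
by rewrite rmorphXn /=; have [<- _] := Re_ge0 (normr_ge0 (sigma p x)).
Qed.

Section Form.
Variables (E : vectType K) (h : P -> E -> E -> C).
Hypothesis hpos : forall p, pos_def_hermitian (sigma p) (h p).

Lemma herm0l p y : h p 0 y = 0.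
Proof.
have [klin _ _] := hpos p; have := klin 1 0 0 y.
rewrite scaler0 addr0 rmorph1 mul1r => /eqP.
by rewrite -subr_eq0 opprD addNKr oppr_eq0 => /eqP.
Qed.

Lemma hermC p x y : h p y x = (h p x y)^*.
Proof. by have [_ ->] := hpos p. Qed.

Lemma herm_suml p (I : finType) (c : I -> K) (b : I -> E) y :
  h p (\sum_i c i *: b i) y = \sum_i sigma p (c i) * h p (b i) y.
Proof.
have [klin _ _] := hpos p.
elim/big_rec2: _ => [|i u v _ <-]; first exact: herm0l.
by rewrite klin.
Qed.

Lemma herm_sumr p (I : finType) (c : I -> K) (b : I -> E) x :
  h p x (\sum_i c i *: b i) = \sum_i h p x (b i) * (sigma p (c i))^*.
Proof.
rewrite hermC herm_suml rmorph_sum; apply: eq_bigr => i _.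
by rewrite rmorphM /= mulrC -hermC.
Qed.

Definition hmx p (I J : finType) (b : I -> E) (c : J -> E) : 'M[C]_(#|I|, #|J|) :=
  fmx (fun i j => h p (b i) (c j)).

Definition hdet p (I : finType) (b : I -> E) : C := fdet (fun i j => h p (b i) (b j)).

Lemma hmxC p (I J : finType) (b : I -> E) (c : J -> E) : (hmx p b c)^t* = hmx p c b.
Proof. by apply/matrixP => i j; rewrite !mxE -hermC. Qed.

(** Positivity holds on complex combinations of the standard basis. It passes to b because the
    coordinate matrix of b, row free over K, stays row free after applying [sigma p]. *)
Lemma gram_posdef p n (b : 'I_n -> E) : indep b -> posdef (gram (h p) b).
Proof.
move=> ib; pose M : 'M[K]_(n, \dim {:E}) := \matrix_(i, j) coord (vbasis {:E}) j (b i).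
have bE i : b i = \sum_j M i j *: std_basis j.
  rewrite (coord_basis (vbasisP {:E}) (memvf (b i))).
  by apply: eq_bigr => j _; rewrite !mxE.
have fM : row_free M.
  rewrite -kermx_eq0; apply/rowV0P => v /sub_kermxP vM.
  have := ib (fun i => v 0 i).
  have -> : \sum_i v 0 i *: b i = 0.
    under eq_bigr => i _ do rewrite bE scaler_sumr.
    rewrite exchange_big big1 //= => j _.
    under eq_bigr => i _ do rewrite scalerA.
    rewrite -scaler_suml; have := congr1 (fun w : 'rV_(\dim {:E}) => w 0 j) vM.
    by rewrite !mxE => ->; rewrite scale0r.
  by move/(_ erefl) => v0; apply/rowP => i; rewrite mxE v0.
have fsM : row_free (map_mx (sigma p) M) by rewrite row_free_map.
have pG : posdef (gram (h p) (@std_basis K E)).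
  have [_ _ pos] := hpos p; split.
    by apply/matrixP => i j; rewrite !mxE -hermC.
  by move=> c /pos; rewrite map_trmx.
have := posdef_congr fsM pG; congr posdef.
apply/matrixP => i j; rewrite [RHS]mxE !bE.
rewrite herm_sumr !mxE; apply: eq_bigr => k _.
rewrite !mxE herm_suml; congr (_ * _).
by apply: eq_bigr => l _; rewrite !mxE.
Qed.

Lemma indep_bij (I J : finType) (f : J -> I) (b : I -> E) : bijective f -> indep b ->
  indep (b \o f).
Proof.
move=> [g fK gK] ib c e j; have := ib (c \o g) _ (f j); rewrite /= fK; apply.
rewrite (reindex f) /=; last by exists g => x _.
by rewrite -[RHS]e; apply: eq_bigr => i _; rewrite fK.
Qed.

Lemma hmx_posdef p (I : finType) (b : I -> E) : indep b -> posdef (hmx p b b).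
Proof.
move=> ib; apply: (@gram_posdef p _ (b \o @enum_val I predT)).
by apply: indep_bij ib; exists enum_rank; [exact: enum_valK | exact: enum_rankK].
Qed.

Lemma hdet_gt0 p (I : finType) (b : I -> E) : indep b -> 0 < hdet p b.
Proof. by move=> ib; apply: posdef_det; apply: hmx_posdef. Qed.

Lemma hdet_change p (I : finType) (b b' : I -> E) (g : I -> I -> K) :
  (forall i, b' i = \sum_j g i j *: b j) ->
  hdet p b' = `|sigma p (fdet g)| ^+ 2 * hdet p b.
Proof.
move=> gE; rewrite /hdet.
rewrite (eq_fdet (B := fun i k => \sum_j sigma p (g i j) *
    (\sum_l h p (b j) (b l) * (sigma p (g k l))^*))); last first.
  move=> i k; rewrite !gE herm_suml; apply: eq_bigr => j _; congr (_ * _).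
  by rewrite herm_sumr.
rewrite (fdet_mul (fun i j => sigma p (g i j)) (fun j k => \sum_l h p (b j) (b l) * (sigma p (g k l))^*)).
rewrite (fdet_mul (fun j l => h p (b j) (b l)) (fun l k => (sigma p (g k l))^*)).
have -> : fdet (fun i j => sigma p (g i j)) = sigma p (fdet g).
  by rewrite /fdet -det_map_mx; congr (\det _); apply/matrixP => i j; rewrite !mxE.
have -> : fdet (fun l k => (sigma p (g k l))^*) = (sigma p (fdet g))^*.
  rewrite /fdet -det_map_mx -[RHS]det_map_mx -[RHS]det_tr; congr (\det _).
  by apply/matrixP => i j; rewrite !mxE.
by rewrite mulrCA mulrC normCK.
Qed.

Definition hvol (I : finType) (b : I -> E) : R :=
  \prod_p (complex.Re (hdet p b)) `^ ((local_degree (sigma p))%:R / 2).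

Lemma hvol_gt0 (I : finType) (b : I -> E) : indep b -> 0 < hvol b.
Proof. by move=> ib; apply: prodr_gt0 => p _; apply/powR_gt0/Re_gt0/hdet_gt0. Qed.

(** At p the Gram determinant gains the square of |sigma_p(det g)|; the exponent e_p / 2 turns these
    factors into the product formula for |N(det g)|. *)
Lemma hvol_change (I : finType) (b b' : I -> E) (g : I -> I -> K) :
  infinite_places sigma -> indep b ->
  (forall i, b' i = \sum_j g i j *: b j) ->
  hvol b' = absN (fdet g) * hvol b.
Proof.
move=> places ib gE; rewrite (absN_places _ places) /hvol -big_split; apply: eq_bigr => p _ /=.
have hp := ltW (hdet_gt0 p ib); have np := normr_ge0 (sigma p (fdet g)).
have [_ n0] := Re_ge0 np; have [_ h0] := Re_ge0 hp.
rewrite (hdet_change p gE) Re_mulr ?exprn_ge0 //.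
rewrite expr2 Re_mulr // -expr2 powRM ?exprn_ge0 //.
congr (_ * _); rewrite -powR_mulrn // -powRrM mulrCA divff ?pnatr_eq0 // mulr1.
by rewrite powR_mulrn.
Qed.

Lemma hvol_reindex (I J : finType) (f : J -> I) (b : I -> E) : bijective f ->
  hvol (b \o f) = hvol b.
Proof.
move=> bf; apply: eq_bigr => p _; congr (complex.Re _ `^ _).
exact: (fdet_reindex (fun i j => h p (b i) (b j)) bf).
Qed.

(** Enumerates I before J, so that the Gram matrix of a concatenated family is a block matrix on the
    nose. *)
Definition split_enum (I J : finType) n (f : 'I_n -> J) (k : 'I_(#|I| + n)) : I + J :=
  match fintype.split k with inl i => inl (enum_val i) | inr j => inr (f j) end.

Lemma split_enum_bij (I J : finType) n (f : 'I_n -> J) : bijective f ->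
  bijective (@split_enum I J n f).
Proof.
case=> g fK gK.
exists (fun s : I + J => unsplit (match s with inl i => inl (enum_rank i) | inr j => inr (g j) end)).
  move=> k; rewrite /split_enum -{2}[k]splitK.
  by case: (fintype.split k) => i; rewrite ?enum_valK ?fK.
by move=> [i|j]; rewrite /split_enum unsplitK ?enum_rankK ?gK.
Qed.

Lemma enum_val_bij_predT (I : finType) : bijective (@enum_val I predT).
Proof. by exists enum_rank; [exact: enum_valK | exact: enum_rankK]. Qed.

Lemma hdet_cat p (I J : finType) (b : I -> E) (c : J -> E) :
  hdet p (sumf b c) = \det (block_mx (hmx p b b) (hmx p b c) ((hmx p b c)^t*) (hmx p c c)).
Proof. by rewrite hmxC /hdet fdet_sum. Qed.

Section Three.
Variables (I0 I1 I2 : finType) (b0 : I0 -> E) (b1 : I1 -> E) (b2 : I2 -> E).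
Hypothesis ib : indep (sumf b0 (sumf b1 b2)).

Definition three_block p := block_mx (hmx p b0 b0) (row_mx (hmx p b0 b1) (hmx p b0 b2))
  ((row_mx (hmx p b0 b1) (hmx p b0 b2))^t*)
  (block_mx (hmx p b1 b1) (hmx p b1 b2) ((hmx p b1 b2)^t*) (hmx p b2 b2)).

Let f3 := @split_enum I0 _ _ (@split_enum I1 I2 _ (@enum_val I2 predT)).

Let f3_bij : bijective f3.
Proof. by do 2 apply: split_enum_bij; apply: enum_val_bij_predT. Qed.

Let three_blockE p : gram (h p) (sumf b0 (sumf b1 b2) \o f3) = three_block p.
Proof.
rewrite /three_block tr_row_mx map_col_mx !hmxC; apply/matrixP => k l.
rewrite [LHS]mxE /= /f3 /split_enum -[k in RHS]splitK -[l in RHS]splitK.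
case: (fintype.split k) => i; case: (fintype.split l) => j /=;
  rewrite ?block_mxEul ?block_mxEur ?block_mxEdl ?block_mxEdr; first by rewrite !mxE.
- by rewrite -[j in RHS]splitK; case: (fintype.split j) => j' /=;
    rewrite ?row_mxEl ?row_mxEr !mxE.
- by rewrite -[i in RHS]splitK; case: (fintype.split i) => i' /=;
    rewrite ?col_mxEu ?col_mxEd !mxE.
rewrite -[i in RHS]splitK -[j in RHS]splitK.
case: (fintype.split i) => i'; case: (fintype.split j) => j' /=;
  by rewrite ?block_mxEul ?block_mxEur ?block_mxEdl ?block_mxEdr !mxE.
Qed.

Let three_block_posdef p : posdef (three_block p).
Proof. by rewrite -three_blockE; apply/gram_posdef/indep_bij. Qed.

Let hdet_three p : hdet p (sumf b0 (sumf b1 b2)) = \det (three_block p).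
Proof. by rewrite -three_blockE /hdet (fdetE _ f3_bij). Qed.

Let indep_cat (I J : finType) (b : I -> E) (c : J -> E) : indep (sumf b c) ->
  indep b /\ indep c.
Proof.
move=> ibc; split=> d e i.
  have /(_ _ (inl i)) := ibc (sumf d (fun=> 0)); apply; rewrite big_sumType /= e add0r big1 // => j _.
  by rewrite scale0r.
have /(_ _ (inr i)) := ibc (sumf (fun=> 0) d); apply; rewrite big_sumType /= e addr0 big1 // => j _.
by rewrite scale0r.
Qed.

Let sub01 : indep (sumf b0 b1).
Proof.
move=> d e i; have := ib (c := sumf (d \o inl) (sumf (d \o inr) (fun=> 0))).
rewrite !big_sumType /=; rewrite big_sumType /= in e.
rewrite [\sum_(k : I2) _]big1 ?addr0 => [|k _]; last by rewrite scale0r.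
by move=> /(_ e); case: i => i hh; [apply: (hh (inl i)) | apply: (hh (inr (inl i)))].
Qed.

Let sub02 : indep (sumf b0 b2).
Proof.
move=> d e i; have := ib (c := sumf (d \o inl) (sumf (fun=> 0) (d \o inr))).
rewrite !big_sumType /=; rewrite big_sumType /= in e.
rewrite [\sum_(k : I1) _]big1 ?add0r => [|k _]; last by rewrite scale0r.
by move=> /(_ e); case: i => i hh; [apply: (hh (inl i)) | apply: (hh (inr (inr i)))].
Qed.

Let sub0 : indep b0. Proof. by case: (indep_cat ib). Qed.

Let local_pow_mul p x y : 0 <= x -> 0 <= y ->
  (complex.Re x) `^ ((local_degree (sigma p))%:R / 2) * (complex.Re y) `^ ((local_degree (sigma p))%:R / 2)
  = (complex.Re (x * y)) `^ ((local_degree (sigma p))%:R / 2) :> R.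
Proof.
by move=> x0 y0; rewrite Re_mulr // powRM //; [case: (Re_ge0 x0) | case: (Re_ge0 y0)].
Qed.

Lemma hvol_submodular :
  hvol b0 * hvol (sumf b0 (sumf b1 b2)) <= hvol (sumf b0 b1) * hvol (sumf b0 b2).
Proof.
rewrite /hvol -!big_split /=; apply: ler_prod => p _.
have g0 := ltW (hdet_gt0 p sub0); have g012 := ltW (hdet_gt0 p ib).
have g01 := ltW (hdet_gt0 p sub01); have g02 := ltW (hdet_gt0 p sub02).
rewrite mulr_ge0 ?powR_ge0 //= !local_pow_mul //.
have e0 : 0 <= (local_degree (sigma p))%:R / 2 :> R by rewrite divr_ge0 // ler0n.
have ge0 x y : 0 <= x -> 0 <= y -> 0 <= complex.Re (x * y :> C).
  by move=> x0 y0; case: (Re_ge0 (mulr_ge0 x0 y0)).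
apply: ge0_ler_powR => //; rewrite ?nnegrE ?ge0 //; apply: Re_le.
rewrite hdet_three !hdet_cat; exact: koteljanskii (three_block_posdef p).
Qed.

Lemma hvol_modular :
  (forall p, hmx p b1 b2 = hmx p b1 b0 *m invmx (hmx p b0 b0) *m hmx p b0 b2) ->
  hvol b0 * hvol (sumf b0 (sumf b1 b2)) = hvol (sumf b0 b1) * hvol (sumf b0 b2).
Proof.
move=> hE; rewrite /hvol -!big_split /=; apply: eq_bigr => p _.
have g0 := ltW (hdet_gt0 p sub0); have g012 := ltW (hdet_gt0 p ib).
have g01 := ltW (hdet_gt0 p sub01); have g02 := ltW (hdet_gt0 p sub02).
rewrite !local_pow_mul //; congr (complex.Re _ `^ _).
rewrite hdet_three !hdet_cat; apply: (koteljanskii_eq (three_block_posdef p)).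
by rewrite hmxC.
Qed.

End Three.
End Form.
End HermitianForms.

(** * Pseudo-bases and volumes *)

Section IdealProducts.
Variables (R : realType) (K : fieldExtType rat) (I : eqType) (a : I -> set K).
Hypothesis fa : forall i, fractional_ideal (a i).
Local Notation O := (@OK K).
Local Notation IP s := (\big[@ideal_mul K/O]_(i <- s) a i).

Lemma frac_prod (s : seq I) : fractional_ideal (IP s).
Proof.
elim: s => [|i s IH]; first by rewrite big_nil; apply: frac_OK.
by rewrite big_cons; apply: frac_mul.
Qed.

Lemma ideal_norm_prod (s : seq I) : ideal_norm R (IP s) = \prod_(i <- s) ideal_norm R (a i).
Proof.
elim: s => [|i s IH]; first by rewrite !big_nil; apply: ideal_norm_OK.
by rewrite !big_cons ideal_norm_mul ?IH //; apply: frac_prod.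
Qed.

Lemma ideal_prod_mem (s : seq I) (x : I -> K) : (forall i, a i (x i)) ->
  IP s (\prod_(i <- s) x i).
Proof.
move=> ax; elim: s => [|i s IH]; first by rewrite !big_nil; apply: OK1.
by rewrite !big_cons; apply: ideal_mul_mem.
Qed.

(** Reduces u * IP <= c to products with one factor from each ideal. As s has no repetition, the
    factors can be chosen independently through a single function x. *)
Lemma ideal_prod_ind (s : seq I) (c : set K) : uniq s -> OK_submodule (V := K^o) c ->
  forall u, (forall x : I -> K, (forall i, a i (x i)) -> c (u * \prod_(i <- s) x i)) ->
  forall z, IP s z -> c (u * z).
Proof.
move=> us sc; elim: s us => [|i s IH] /= us u h z.
  rewrite big_nil => Oz; have := h (fun i => 0); rewrite big_nil mulr1 => cu.
  rewrite mulrC; case: sc => _ _; apply => //; apply: cu => i.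
  by have [[]] := fa i.
case/andP: us => nis us.
rewrite big_cons => -[t tP ->]; rewrite mulr_sumr big_seq; apply: submod_sum => // w /tP[aw sw].
rewrite mulrA; apply: (IH us) => // x ax.
have := h (fun j => if j == i then w.1 else x j); rewrite big_cons eqxx mulrA.
have -> : \prod_(j <- s) (if j == i then w.1 else x j) = \prod_(j <- s) x j.
  apply: eq_big_seq => j js; case: eqP => // ji; by rewrite -ji js in nis.
by apply=> j; case: eqP => // ->.
Qed.

End IdealProducts.

Section PseudoBases.
Context {R : realType} {K : fieldExtType rat} {P : finType}.
Variable sigma : P -> {rmorphism K -> R[i]}.
Hypothesis places : infinite_places sigma.
Variables (E : vectType K) (h : P -> E -> E -> R[i]).
Hypothesis hpos : forall p, pos_def_hermitian (sigma p) (h p).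
Local Notation O := (@OK K).

(** A version of [pseudo_basis] indexed by any finite type and free of [Kspan]; the two agree on
    ordinals by [pseudo_basisP]. *)
Definition pbasis (N : set E) (I : finType) (a : I -> set K) (b : I -> E) :=
  [/\ forall i, fractional_ideal (a i), indep b &
    N = [set x | exists2 c : I -> K, (forall i, a i (c i)) & x = \sum_i c i *: b i]].

Definition pvol (I : finType) (a : I -> set K) (b : I -> E) : R :=
  (\prod_i ideal_norm R (a i)) * hvol sigma h b.

Lemma pvol_gt0 N (I : finType) (a : I -> set K) (b : I -> E) : pbasis N a b -> 0 < pvol a b.
Proof.
move=> [fa ib _]; rewrite mulr_gt0 //; last exact: hvol_gt0.
by apply: prodr_gt0 => i _; apply: ideal_norm_gt0.
Qed.

Lemma pbasis_bij N (I J : finType) (f : J -> I) (a : I -> set K) (b : I -> E) :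
  bijective f -> pbasis N a b -> pbasis N (a \o f) (b \o f).
Proof.
move=> bf [fa ib ->]; split=> [j||]; first exact: fa; first exact: indep_bij.
have [g fK gK] := bf.
apply/seteqP; split=> _ [c ac ->].
  exists (c \o f) => [j|]; first exact: ac.
  by rewrite (reindex f) //; exists g => x _.
exists (c \o g) => [i|]; first by have := ac (g i); rewrite /= gK.
rewrite [RHS](reindex f) /=; last by exists g => x _.
by apply: eq_bigr => j _; rewrite fK.
Qed.

Lemma pvol_bij (I J : finType) (f : J -> I) (a : I -> set K) (b : I -> E) :
  bijective f -> pvol (a \o f) (b \o f) = pvol a b.
Proof.
move=> bf; rewrite /pvol hvol_reindex // [in RHS](reindex f) //.
by have [g fK gK] := bf; exists g => x _.
Qed.

Lemma frac_neq0 (a : set K) : fractional_ideal a -> exists2 x, a x & x != 0.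
Proof. by case. Qed.

Lemma pbasis_mem N (I : finType) (a : I -> set K) (b : I -> E) i x : pbasis N a b ->
  a i x -> N (x *: b i).
Proof.
move=> [fa _ ->] ax; exists (fun j => if j == i then x else 0).
  by move=> j; case: eqP => [->//|_]; have [[]] := fa j.
rewrite (bigD1 i) //= eqxx big1 ?addr0 // => j /negPf ->.
by rewrite scale0r.
Qed.

(* Expanding det g by Leibniz shows det g * prod a'_j <= prod a_i. *)
Lemma pvol_le_same N N' (I : finType) (a a' : I -> set K) (b b' : I -> E) :
  pbasis N a b -> pbasis N' a' b' -> N' `<=` N -> pvol a b <= pvol a' b'.
Proof.
move=> pN pN' NN; have [fa ib DN] := pN; have [fa' ib' _] := pN'.
have hg j : exists g : I -> K, b' j = \sum_i g i *: b i.
  have [x ax nzx] := frac_neq0 (fa' j).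
  have := NN _ (pbasis_mem pN' ax); rewrite DN => -[c _ e].
  exists (fun i => x^-1 * c i); rewrite -[b' j]scale1r -(mulVf nzx) -scalerA e scaler_sumr.
  by apply: eq_bigr => i _; rewrite scalerA.
have [g gE] := choice hg.
(* Entrywise, a'_j g_ji <= a_i: this is the inclusion N' <= N read in coordinates with respect to
   b. *)
have ga j i y : a' j y -> a i (y * g j i).
  move=> ay; have := NN _ (pbasis_mem pN' ay); rewrite DN => -[c ac].
  rewrite gE scaler_sumr => /eqP; rewrite -subr_eq0 -sumrB => /eqP e.
  suff : y * g j i - c i = 0 by move/eqP; rewrite subr_eq0 => /eqP ->.
  apply: (ib (fun i => y * g j i - c i)).
  by rewrite -[RHS]e; apply: eq_bigr => k _; rewrite scalerBl scalerA.
have nzg : fdet g != 0.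
  apply/negP => /det0P[v nzv vg].
  suff v0 : v = 0 by rewrite v0 eqxx in nzv.
  apply/rowP => k; rewrite mxE.
  have := ib' (fun j => v 0 (enum_rank j)) _ (enum_val k); rewrite enum_valK; apply.
  under eq_bigr => j _ do rewrite gE scaler_sumr.
  rewrite exchange_big big1 //= => i _.
  under eq_bigr => j _ do rewrite scalerA.
  rewrite -scaler_suml.
  have := congr1 (fun w : 'rV_#|I| => w 0 (enum_rank i)) vg; rewrite !mxE => e.
  rewrite (reindex (@enum_val I predT)); last exact: (onW_bij _ (enum_val_bij_predT I)).
  rewrite (eq_bigr (fun j => v 0 j * fmx g j (enum_rank i))) ?e ?scale0r // => j _.
  by rewrite enum_valK !mxE enum_rankK.
have fIP := frac_prod fa (index_enum I); have fIP' := frac_prod fa' (index_enum I).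
set IP := bigop _ _ _ in fIP; set IP' := bigop _ _ _ in fIP'.
have sub : scale_set (fdet g) IP' `<=` IP.
  move=> _ [z z' <-]; have [sIP _ _] := fIP.
  apply: (ideal_prod_ind fa' (index_enum_uniq I) sIP (u := fdet g)) z' => x ax.
  rewrite /fdet /determinant mulr_suml; apply: submod_sum => // s _.
  (* The permutation s transported to I. Grouping a Leibniz term by columns, its factor x_(f' i)
     g_(f' i, i) lies in a_i by [ga]. *)
  pose f i := enum_val (s (enum_rank i)).
  pose f' i := enum_val (s^-1%g (enum_rank i)).
  have fK : cancel f f' by move=> i; rewrite /f /f' enum_valK permK enum_rankK.
  have fK' : cancel f' f by move=> i; rewrite /f /f' enum_valK permKV enum_rankK.
  have -> : (-1) ^+ s * (\prod_i fmx g i (s i)) * \prod_(i <- index_enum I) x i =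
     (-1) ^+ s * \prod_i (x (f' i) * g (f' i) i).
    rewrite -mulrA; congr (_ * _).
    rewrite [in RHS](reindex f) /=; last by exists f' => i _.
    under [in RHS]eq_bigr => i _ do rewrite fK.
    rewrite big_split /= mulrC; congr (_ * _).
    rewrite [in RHS](reindex (@enum_val I predT)) /=; last exact: (onW_bij _ (enum_val_bij_predT I)).
    by apply: eq_bigr => i _; rewrite mxE /f enum_valK.
  case: sIP => _ _; apply; last by apply: ideal_prod_mem => // i; apply: ga.
  by case: (odd_perm s); rewrite ?expr1 ?expr0; [apply: OKN | ]; apply: OK1.
have fs := frac_scale nzg fIP'.
have := ideal_norm_sub R fs fIP sub; rewrite (ideal_norm_scale R (vbasisP {:K}) fIP' nzg).
have -> : ideal_norm R IP = \prod_i ideal_norm R (a i) := ideal_norm_prod R fa (index_enum I).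
have -> : ideal_norm R IP' = \prod_i ideal_norm R (a' i) := ideal_norm_prod R fa' (index_enum I).
move=> le.
have hb := hvol_gt0 hpos ib.
rewrite /pvol (hvol_change hpos places ib gE) mulrA ler_pM2r //.
by rewrite mulrC.
Qed.

Lemma card_bij (I J : finType) : #|I| = #|J| -> exists f : J -> I, bijective f.
Proof.
move=> e; exists (enum_val \o cast_ord (esym e) \o enum_rank).
apply: bij_comp; last by exists enum_val; [exact: enum_rankK | exact: enum_valK].
apply: bij_comp; first exact: enum_val_bij_predT.
by exists (cast_ord e); [exact: cast_ordKV | exact: cast_ordK].
Qed.

Lemma pvol_le N N' (I J : finType) (a : I -> set K) (b : I -> E) (a' : J -> set K) (b' : J -> E) :
  pbasis N a b -> pbasis N' a' b' -> #|I| = #|J| -> N' `<=` N -> pvol a b <= pvol a' b'.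
Proof.
move=> pN pN' /card_bij[f bf] NN; rewrite -(pvol_bij a b bf).
exact: pvol_le_same (pbasis_bij bf pN) pN' NN.
Qed.

(** A subspace U of least dimension containing N is the smallest one: U ∩ W also contains N, hence
    equals U. So [xget] does not fall back on its default. *)
Lemma Kspan_spec (N : set E) : (forall x, N x -> x \in Kspan N) /\
  forall W : {vspace E}, (forall x, N x -> x \in W) -> (Kspan N <= W)%VS.
Proof.
apply: (@xgetPex _ 0%VS [set U : {vspace E} | (forall x, N x -> x \in U) /\
    forall W : {vspace E}, (forall x, N x -> x \in W) -> (U <= W)%VS]).
pose Q n := `[< exists2 U : {vspace E}, \dim U = n & forall x, N x -> x \in U >].
have exQ : exists n, Q n by exists (\dim {:E}); apply/asboolP; exists fullv => // x _; rewrite memvf.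
case: (ex_minnP exQ) => m /asboolP[U dU NU] mmin; exists U; split=> // W NW.
have : Q (\dim (U :&: W)).
  by apply/asboolP; exists (U :&: W)%VS => // x Nx; rewrite memv_cap NU ?NW.
move/mmin; rewrite -dU => le.
by have /eqP <- : (U :&: W == U)%VS; [rewrite eqEdim capvSl | exact: capvSr].
Qed.

Definition fspan (I : finType) (b : I -> E) : {vspace E} := (\sum_i <[b i]>)%VS.

Lemma fspanP (I : finType) (b : I -> E) x :
  reflect (exists c : I -> K, x = \sum_i c i *: b i) (x \in fspan b).
Proof.
apply: (iffP memv_sumP) => [[v vb ->]|[c ->]].
  have hc i : exists k, v i = k *: b i by apply/vlineP/vb.
  by have [c cE] := choice hc; exists c; apply: eq_bigr => i _; rewrite cE.
by exists (fun i => c i *: b i) => // i _; apply/rpredZ/memv_line.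
Qed.

Lemma fspan_mem (I : finType) (b : I -> E) i : b i \in fspan b.
Proof.
by apply/memv_sumP; exists (fun j => if j == i then b i else 0);
  [move=> j _; case: eqP => [->|_]; rewrite ?memv_line ?mem0v
  |rewrite (bigD1 i) //= eqxx big1 ?addr0 // => j /negPf ->].
Qed.

Lemma fspan_sub (I : finType) (b : I -> E) (W : {vspace E}) :
  (forall i, b i \in W) -> (fspan b <= W)%VS.
Proof. by move=> bW; apply/subvP => _ /fspanP[c ->]; apply: memv_suml => i _; apply/rpredZ/bW. Qed.

Lemma fspan_seq l (b : 'I_l -> E) : fspan b = <<[seq b i | i <- enum 'I_l]>>%VS.
Proof. by rewrite span_def big_map big_enum. Qed.

Lemma indep_free l (b : 'I_l -> E) : indep b <-> free [seq b i | i <- enum 'I_l].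
Proof.
have E1 (k : 'I_l -> K) : \sum_(i < l) k i *: (mktuple b)`_i = \sum_i k i *: b i.
  by apply: eq_bigr => i _; rewrite -tnth_nth tnth_mktuple.
split=> [ib|/(@freeP _ _ _ (mktuple b)) f c e i].
  by apply/(@freeP _ _ _ (mktuple b)) => k; rewrite E1 => /ib.
by apply: f; rewrite E1.
Qed.

Lemma dim_fspan (I : finType) (b : I -> E) : indep b -> \dim (fspan b) = #|I|.
Proof.
move=> ib; have bv := enum_val_bij_predT I.
have -> : fspan b = fspan (b \o @enum_val I predT).
  by rewrite /fspan (reindex (@enum_val I predT)) //; exact: onW_bij.
rewrite fspan_seq; have /indep_free := indep_bij bv ib; rewrite /free => /eqP ->.
by rewrite size_map -cardE card_ord.
Qed.

Lemma pbasis_Kspan N (I : finType) (a : I -> set K) (b : I -> E) : pbasis N a b ->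
  Kspan N = fspan b.
Proof.
move=> pN; have [fa ib DN] := pN; have [NK Kmin] := Kspan_spec N.
apply/eqP; rewrite eqEsubv; apply/andP; split.
  by apply: Kmin => x; rewrite DN => -[c _ ->]; apply/fspanP; exists c.
apply: fspan_sub => i; have [x ax nzx] := frac_neq0 (fa i).
have := NK _ (pbasis_mem pN ax).
by move/(rpredZ x^-1); rewrite scalerA mulVf // scale1r.
Qed.

Lemma pbasis_rank N (I : finType) (a : I -> set K) (b : I -> E) : pbasis N a b ->
  rank N = #|I|.
Proof. by move=> pN; rewrite /rank (pbasis_Kspan pN) dim_fspan //; case: pN. Qed.

Lemma pseudo_basisP N l (a : 'I_l -> set K) (b : 'I_l -> E) :
  pseudo_basis N a b <-> pbasis N a b.
Proof.
split=> [[fa /andP[/eqP sb fb] DN]|pN]; first by split=> //; apply/indep_free.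
have [fa ib DN] := pN; split=> //; rewrite (pbasis_Kspan pN) fspan_seq.
by rewrite /basis_of eqxx; apply/indep_free.
Qed.

Lemma pseudo_volE N l (a : 'I_l -> set K) (b : 'I_l -> E) : pbasis N a b ->
  pseudo_vol sigma h a b = pvol a b.
Proof.
move=> [fa ib _]; rewrite /pseudo_vol /pvol -ideal_norm_prod //; congr (_ * _).
apply: eq_bigr => p _; congr (complex.Re _ `^ _).
by rewrite /hdet (fdetE (f := @id 'I_l)); [congr (\det _) | exists id].
Qed.

(** [pvol_le], used in both directions for the same N, makes the choice of [xget] irrelevant. *)
Lemma volE N (I : finType) (a : I -> set K) (b : I -> E) : pbasis N a b ->
  vol sigma h N = pvol a b.
Proof.
move=> pN; rewrite /vol.
case: xgetP => [v _ [l [a' [b' [/pseudo_basisP pN' ->]]]]|/(_ (pvol a b)) []].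
  rewrite (pseudo_volE pN').
  have cI : #|I| = #|'I_l| by rewrite -(pbasis_rank pN) -(pbasis_rank pN').
  by apply/eqP; rewrite eq_le !(@pvol_le N N).
have bv := enum_val_bij_predT I.
exists #|I|, (a \o @enum_val I predT), (b \o @enum_val I predT).
have pN' := pbasis_bij bv pN.
by split; [apply/pseudo_basisP | rewrite (pseudo_volE pN') pvol_bij].
Qed.

(** Bounded denominators serve as finite generation: the property passes trivially to submodules,
    and it makes the image of N under a functional a fractional ideal as soon as that image is
    nonzero. *)
Definition bounded_mod (N : set E) := forall phi : 'Hom(E, K^o),
  exists d : K, [/\ O d, d != 0 & forall x, N x -> O (d * phi x)].

Definition inter (N : set E) (U : {vspace E}) : set E := [set x | N x /\ x \in U].

Lemma submod_inter N U : OK_submodule N -> OK_submodule (inter N U).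
Proof.
move=> [N0 ND NM]; split; first by split; rewrite ?mem0v.
  by move=> x y [Nx Ux] [Ny Uy]; split; [apply: ND | rewrite rpredD].
by move=> u x Ou [Nx Ux]; split; [apply: NM | rewrite rpredZ].
Qed.

Lemma bounded_sub N N' : N' `<=` N -> bounded_mod N -> bounded_mod N'.
Proof. by move=> NN bN phi; have [d [Od nzd h']] := bN phi; exists d; split=> // x /NN/h'. Qed.

Lemma submodE_sum (N : set E) (I : Type) (s : seq I) (Q : pred I) (f : I -> E) :
  OK_submodule N -> (forall i, Q i -> N (f i)) -> N (\sum_(i <- s | Q i) f i).
Proof. by move=> [N0 ND _] hf; apply: big_ind. Qed.

Lemma pbasis_sumf0 N (I : finType) (a : I -> set K) (b : I -> E) : pbasis N a b ->
  pbasis N (sumf a (fun i : void => O)) (sumf b (fun i : void => 0)).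
Proof.
pose f (s : I + void) : I := match s with inl i => i | inr v => match v with end end.
have bf : bijective f by exists inl => // -[] // [].
move/(pbasis_bij bf).
have -> : a \o f = sumf a (fun i : void => O) by apply/funext => -[] // [].
by have -> : b \o f = sumf b (fun i : void => 0) by apply/funext => -[] // [].
Qed.

Lemma functional_at (U : {vspace E}) x : x \notin U ->
  exists2 phi : 'Hom(E, K^o), (forall y, y \in U -> phi y = 0) & phi x = 1.
Proof.
move=> nxU; pose v := x - projv U x.
have nzv : v != 0.
  by apply: contra nxU; rewrite subr_eq0 => /eqP ->; apply: memv_proj.
have [j nzj] : exists j, coord (vbasis {:E}) j v != 0.
  apply: contrapT => /forallNP hj; move/negP: nzv; apply.
  rewrite (coord_basis (vbasisP {:E}) (memvf v)) big1 // => j _.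
  by have /negP := hj j; rewrite negbK => /eqP ->; rewrite scale0r.
pose l : 'Hom(E, K^o) := linfun (coord (vbasis {:E}) j : E -> K^o).
pose psi : 'Hom(E, K^o) := (l \o (\1 - projv U))%VF.
have psiE y : psi y = coord (vbasis {:E}) j (y - projv U y).
  by rewrite comp_lfunE add_lfunE opp_lfunE id_lfunE lfunE.
exists ((psi x)^-1 *: psi) => [y Uy|].
  by rewrite scale_lfunE (psiE y) projv_id // subrr linear0 scaler0.
rewrite scale_lfunE /= -[_ *: _]/(_ * _) mulVf //.
by rewrite psiE.
Qed.

Lemma sum_unitE (V : nmodType) (f : unit -> V) : \sum_u f u = f tt.
Proof. by rewrite (bigD1 tt) //= big1 ?addr0 // => -[]. Qed.

Lemma pbasis_interU N U (I : finType) (a : I -> set K) (b : I -> E) :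
  pbasis (inter N U) a b -> forall i, b i \in U.
Proof.
move=> pN i; have [fa _ _] := pN; have [x ax nzx] := frac_neq0 (fa i).
have [_ /(rpredZ x^-1)] := pbasis_mem pN ax.
by rewrite scalerA mulVf // scale1r.
Qed.

(** Splits the surjection phi from N ∩ W onto the fractional ideal A, with kernel N ∩ U.
    Invertibility writes 1 as a sum of u1 u2 with u1 in A^-1 and u2 = phi(y_u); then b1, the sum of
    the u1 y_u, satisfies phi(b1) = 1 and A b1 <= N. *)
Lemma pbasis_extend1 N (U : {vspace E}) x (I : finType) (a : I -> set K) (b : I -> E) :
  OK_submodule N -> bounded_mod N -> N x -> x \notin U -> pbasis (inter N U) a b ->
  exists (a1 : set K) (b1 : E), b1 \in (U + <[x]>)%VS /\
    pbasis (inter N (U + <[x]>)%VS) (sumf a (fun i : unit => a1)) (sumf b (fun i : unit => b1)).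
Proof.
move=> sN bN Nx nxU pU; have [fa ib DU] := pU.
have [phi phiU phix] := functional_at nxU.
set W := (U + <[x]>)%VS; have sW := submod_inter W sN.
have kerW y : y \in W -> phi y = 0 -> y \in U.
  case/memv_addP => u Uu [v /vlineP[k ->] ->]; rewrite linearD linearZ /= phix phiU // add0r.
  move=> k0; have -> : k = 0 by rewrite -[RHS]k0; exact/esym/mulr1.
  by rewrite scale0r addr0.
pose A : set K := [set phi y | y in inter N W].
have [N0 ND NM] := sN; have [W0 WD WM] := sW.
have xW : x \in W by rewrite -[x]add0r memv_add ?mem0v ?memv_line.
have fA : fractional_ideal A.
  split.
  - split; first by exists 0; rewrite ?linear0.
      by move=> _ _ [y Wy <-] [z Wz <-]; exists (y + z); [apply: WD | rewrite linearD].
    by move=> u _ Ou [y Wy <-]; exists (u *: y); [apply: WM | rewrite linearZ].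
  - exists 1; last exact: oner_neq0.
    by exists x.
  - have [d [Od nzd dN]] := bN phi; exists d; split=> // _ [y [Ny _] <-].
    exact: dN.
have : ideal_mul (ideal_inv A) A 1 by rewrite ideal_mulC frac_mulV //; apply: OK1.
case=> t tP e1.
have ht (u : K * K) : exists y, u \in t -> inter N W y /\ phi y = u.2.
  have [ut|] := boolP (u \in t); last by exists 0.
  by have [_ [y Wy e]] := tP u ut; exists y.
have [y yE] := choice ht.
pose b1 := \sum_(u <- t) u.1 *: y u.
have b1W : b1 \in W.
  by rewrite /b1 big_seq memv_suml // => u ut; have [[_ ?] _] := yE u ut; apply: rpredZ.
have phib1 : phi b1 = 1.
  rewrite e1 /b1 linear_sum big_seq [RHS]big_seq; apply: eq_bigr => u ut.
  by have [_ e] := yE u ut; rewrite linearZ /= e.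
have Ab1 c : A c -> N (c *: b1).
  move=> Ac; rewrite /b1 scaler_sumr big_seq; apply: submodE_sum => // u ut.
  rewrite scalerA; have [[Ny _] _] := yE u ut; apply: NM => //.
  by rewrite mulrC; have [iu _] := tP u ut; apply: iu.
have phib i : phi (b i) = 0 by apply: phiU; apply: pbasis_interU pU i.
have phisum (c : I -> K) : phi (\sum_i c i *: b i) = 0.
  by rewrite linear_sum big1 // => i _; rewrite linearZ /= phib scaler0.
exists A, b1; split=> //; split.
- by case.
- move=> c; rewrite big_sumType /= sum_unitE => e.
  have c1 : c (inr tt) = 0.
    have := congr1 phi e; rewrite linearD linearZ /= (phisum (c \o inl)) phib1 linear0 add0r => <-.
    by apply/esym; exact: mulr1.
  move: e; rewrite c1 scale0r addr0 => /ib c0.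
  by move=> [i|[]] //; apply: (c0 i).
- apply/seteqP; split=> [y0 [Ny Wy]|_ [c ac ->]].
    have Ay : A (phi y0) by exists y0.
    have : inter N U (y0 - phi y0 *: b1).
      split; first by rewrite -scaleN1r; apply: ND => //; apply: NM; [apply/OKN/OK1 | exact: Ab1].
      apply: kerW; first by rewrite rpredB // rpredZ.
      rewrite linearB linearZ /= phib1; apply/eqP; rewrite subr_eq0; apply/eqP/esym; exact: mulr1.
    rewrite DU => -[c ac e]; exists (sumf c (fun=> phi y0)); first by case.
    by rewrite big_sumType /= sum_unitE -e subrK.
  rewrite big_sumType /= sum_unitE.
  have [Nu Uu] : inter N U (\sum_i c (inl i) *: b i).
    by rewrite DU; exists (c \o inl) => // i; apply: (ac (inl i)).
  split; first by apply: ND => //; apply/Ab1/(ac (inr tt)).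
  by rewrite rpredD ?rpredZ //; apply: (subvP (addvSl U <[x]>)).
Qed.

Lemma sumfA (I J L : Type) (T : Type) (f : I -> T) (g : J -> T) (k : L -> T) :
  sumf f (sumf g k) = sumf (sumf f g) k \o
    (fun s : I + (J + L) => match s with inl i => inl (inl i) | inr (inl j) => inl (inr j) | inr (inr l) => inr l end).
Proof. by apply/funext => -[i|[j|l]]. Qed.

Lemma sum_assoc_bij (I J L : finType) : bijective
  (fun s : I + (J + L) => match s with inl i => inl (inl i) | inr (inl j) => inl (inr j) | inr (inr l) => inr l end).
Proof.
exists (fun s : I + J + L => match s with inl (inl i) => inl i | inl (inr j) => inr (inl j) | inr l => inr (inr l) end).
  by move=> [i|[j|l]].
by move=> [[i|j]|l].
Qed.

Lemma pbasis_extend N : OK_submodule N -> bounded_mod N ->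
  forall (U : {vspace E}) (I : finType) (a : I -> set K) (b : I -> E),
  pbasis (inter N U) a b -> exists (J : finType) (a' : J -> set K) (b' : J -> E),
  pbasis N (sumf a a') (sumf b b').
Proof.
move=> sN bN U; have [n] := ubnP (\dim {:E} - \dim U).
elim: n U => // n IH U Un I a b pU.
have [NU|/existsNP[x /not_implyP[Nx /negP nxU]]] := pselect (forall x, N x -> x \in U).
  exists void, (fun=> O), (fun=> 0); apply: pbasis_sumf0.
  by have -> : N = inter N U by apply/seteqP; split=> [x Nx|x []] //; split=> //; apply: NU.
have [a1 [b1 [_ p1]]] := pbasis_extend1 sN bN Nx nxU pU.
have lt : (\dim U < \dim (U + <[x]>))%N.
  rewrite ltnNge; apply: contra nxU => le.
  have /eqP -> : (U == U + <[x]>)%VS by rewrite eqEdim addvSl.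
  by apply: (subvP (addvSr U <[x]>)); apply: memv_line.
have [|J [a' [b' p']]] := IH (U + <[x]>)%VS _ _ _ _ p1.
  rewrite ltnS in Un; apply: leq_trans Un; apply: ltn_sub2l => //.
  by apply: leq_trans lt _; apply: dimvS; apply: subvf.
exists (unit + J)%type, (sumf (fun=> a1) a'), (sumf (fun=> b1) b').
by rewrite !sumfA; apply: pbasis_bij p'; apply: sum_assoc_bij.
Qed.

Lemma pbasis_exists N : OK_submodule N -> bounded_mod N ->
  exists (I : finType) (a : I -> set K) (b : I -> E), pbasis N a b.
Proof.
move=> sN bN.
have p0 : pbasis (inter N 0%VS) (fun i : void => O) (fun i : void => 0).
  split=> [[]|c _ []|]; apply/seteqP; split=> [x [_]|_ [c _ ->]].
    by rewrite memv0 => /eqP ->; exists (fun=> 0) => [[]|]; rewrite big1 // => -[].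
  by rewrite big1 => [|[]] //; split; rewrite ?mem0v //; case: sN.
have [J [a [b p]]] := pbasis_extend sN bN p0.
by exists (void + J)%type, (sumf (fun i : void => O) a), (sumf (fun i : void => 0) b).
Qed.

(** What is retained of [OK_lattice] for volumes: bounded denominators and K L = E. Tensor products
    inherit it through pseudo-bases. *)
Definition full_lattice (L : set E) := [/\ OK_submodule L, bounded_mod L &
  forall x, exists2 d : K, d != 0 & L (d *: x)].

Section Lattice.
Variable L : set E.
Hypothesis lL : full_lattice L.

Lemma submod_interL U : OK_submodule (inter L U).
Proof. by apply: submod_inter; case: lL. Qed.

Lemma bounded_interL U : bounded_mod (inter L U).
Proof. by apply: (@bounded_sub L) => [x []|] //; case: lL. Qed.

Lemma inter_pbasis_exists U : exists (I : finType) (a : I -> set K) (b : I -> E),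
  pbasis (inter L U) a b.
Proof. exact: pbasis_exists (submod_interL U) (bounded_interL U). Qed.

Lemma Kspan_inter U : Kspan (inter L U) = U.
Proof.
have [NK Kmin] := Kspan_spec (inter L U); apply/eqP; rewrite eqEsubv.
apply/andP; split; first by apply: Kmin => x [].
apply/subvP => x Ux; have [_ _ span] := lL; have [d nzd Ld] := span x.
have : d *: x \in Kspan (inter L U) by apply: NK; split; rewrite ?rpredZ.
by move/(rpredZ d^-1); rewrite scalerA mulVf // scale1r.
Qed.

Lemma rank_inter U : rank (inter L U) = \dim U.
Proof. by rewrite /rank Kspan_inter. Qed.

Lemma pbasis_fspan U (I : finType) (a : I -> set K) (b : I -> E) :
  pbasis (inter L U) a b -> fspan b = U.
Proof. by move=> pU; rewrite -(pbasis_Kspan pU) Kspan_inter. Qed.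

Lemma pbasis_card U (I : finType) (a : I -> set K) (b : I -> E) :
  pbasis (inter L U) a b -> #|I| = \dim U.
Proof. by move=> pU; rewrite -(pbasis_rank pU) rank_inter. Qed.

Definition vol_inter U : R := vol sigma h (inter L U).

Lemma vol_inter_gt0 U : 0 < vol_inter U.
Proof.
by have [I [a [b pU]]] := inter_pbasis_exists U; rewrite /vol_inter (volE pU); apply: pvol_gt0 pU.
Qed.

Lemma vol_inter0 : vol_inter 0%VS = 1.
Proof.
have [I [a [b pU]]] := inter_pbasis_exists 0%VS; rewrite /vol_inter (volE pU).
have cI : #|I| = 0%N by rewrite (pbasis_card pU) dimv0.
have nI : I -> False by move=> i; have := card0_eq cI i; rewrite inE.
rewrite /pvol big1 ?mul1r => [|i _]; last by case: (nI i).
apply: big1 => p _; suff -> : hdet h p b = 1 by rewrite /= powR1.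
rewrite /hdet /fdet; move: (fmx _); rewrite cI => M; exact: det_mx00.
Qed.

(** A pseudo-basis of L ∩ U ∩ W is extended to L ∩ U and to L ∩ W. Together they give a submodule of
    L ∩ (U + W) of full rank, whose volume can only be larger. For it the ideal norms on both sides
    agree, and the Gram determinants obey Koteljanskii's inequality. *)
Lemma vol_inter_submodular U W : vol_inter (U :&: W)%VS * vol_inter (U + W)%VS <= vol_inter U * vol_inter W.
Proof.
have [I0 [a0 [b0 p0]]] := inter_pbasis_exists (U :&: W)%VS.
have interS (X Y : {vspace E}) : (X <= Y)%VS -> inter (inter L Y) X = inter L X.
  move=> XY; apply/seteqP; split=> [x [[]]|x [Lx Xx]] //; split=> //; split=> //.
  exact: (subvP XY).
have ext X : (U :&: W <= X)%VS -> exists (J : finType) (a' : J -> set K) (b' : J -> E),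
    pbasis (inter L X) (sumf a0 a') (sumf b0 b').
  move=> UX; apply: (pbasis_extend (submod_interL X) (bounded_interL X) (U := (U :&: W)%VS)).
  by rewrite interS.
have [I1 [a1 [b1 p1]]] := ext U (capvSl _ _).
have [I2 [a2 [b2 p2]]] := ext W (capvSr _ _).
have [fa1 ib1 D1] := p1; have [fa2 ib2 D2] := p2.
have sp0 := pbasis_fspan p0.
have ib : indep (sumf b0 (sumf b1 b2)).
  move=> c; rewrite !big_sumType /= => e.
  have U2 : \sum_i c (inr (inr i)) *: b2 i \in fspan b0.
    rewrite sp0 memv_cap; apply/andP; split; last first.
      by apply: memv_suml => i _; apply/rpredZ/(pbasis_interU p2 (inr i)).
    move/eqP: e; rewrite addrA addrC addr_eq0 => /eqP ->; rewrite rpredN rpredD //.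
      by apply: memv_suml => i _; apply/rpredZ/(pbasis_interU p1 (inl i)).
    by apply: memv_suml => i _; apply/rpredZ/(pbasis_interU p1 (inr i)).
  have /fspanP[d dE] := U2.
  have z2 : forall i, sumf (fun i => - d i) (fun i => c (inr (inr i))) i = 0.
    apply: ib2; rewrite big_sumType /= dE -big_split big1 // => i _.
    by rewrite /= scaleNr addNr.
  have c2 i : c (inr (inr i)) = 0 by apply: (z2 (inr i)).
  have z1 : forall i, sumf (fun i => c (inl i)) (fun i => c (inr (inl i))) i = 0.
    apply: ib1; rewrite big_sumType /= -[RHS]e; congr (_ + _).
    by rewrite [X in _ + X]big1 ?addr0 // => i _; rewrite c2 scale0r.
  by move=> [i|[i|i]] //; [apply: (z1 (inl i)) | apply: (z1 (inr i))].
pose a := sumf a0 (sumf a1 a2); pose b := sumf b0 (sumf b1 b2).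
pose N := [set x | exists2 c, (forall i, a i (c i)) & x = \sum_i c i *: b i].
have pN : pbasis N a b.
  split=> // -[i|[i|i]]; [exact: (fa1 (inl i)) | exact: (fa1 (inr i)) | exact: (fa2 (inr i))].
have NL : N `<=` inter L (U + W)%VS.
  have [sL _ _] := lL.
  move=> _ [c ac ->]; rewrite !big_sumType /= addrA.
  have [L1 U1] : inter L U (\sum_i c (inl i) *: b0 i + \sum_i c (inr (inl i)) *: b1 i).
    rewrite D1; exists (sumf (fun i => c (inl i)) (fun i => c (inr (inl i)))).
      by case=> i; [apply: (ac (inl i)) | apply: (ac (inr (inl i)))].
    by rewrite big_sumType.
  have [L2 U2] : inter L W (\sum_i c (inr (inr i)) *: b2 i).
    rewrite D2; exists (sumf (fun i => 0) (fun i => c (inr (inr i)))).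
      by case=> i; [have [[]] := fa2 (inl i) | apply: (ac (inr (inr i)))].
    by rewrite big_sumType /= [X in X + _]big1 ?add0r // => i _; rewrite scale0r.
  split; first by case: sL => _ LD _; apply: LD.
  exact: memv_add.
have [J [a' [b' p']]] := inter_pbasis_exists (U + W)%VS.
have le : vol_inter (U + W)%VS <= pvol a b.
  rewrite /vol_inter (volE p'); apply: (pvol_le p' pN _ NL).
  rewrite (pbasis_card p') !card_sum; apply/eqP; rewrite -(eqn_add2r #|I0|).
  have d0 := pbasis_card p0; have d1 := pbasis_card p1; have d2 := pbasis_card p2.
  rewrite card_sum in d1; rewrite card_sum in d2.
  by rewrite d0 dimv_sum_cap -d1 -d2 -d0 addnACA [X in _ == X]addnAC.
apply: le_trans (ler_wpM2l (ltW (vol_inter_gt0 _)) le) _.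
rewrite /vol_inter (volE p0) (volE p1) (volE p2) /pvol !big_sumType /=.
set n0 := \prod_i ideal_norm R (a0 i); set n1 := \prod_i _; set n2 := \prod_i _.
have sm := hvol_submodular hpos ib.
have prod_ge0 (J' : finType) (a'' : J' -> set K) : (forall i, fractional_ideal (a'' i)) ->
    0 <= \prod_i ideal_norm R (a'' i).
  by move=> fa; apply: prodr_ge0 => i _; apply/ltW/ideal_norm_gt0.
have n00 : 0 <= n0 by apply: prod_ge0; case: p0.
have n10 : 0 <= n1 by apply: prod_ge0 => i; apply: (fa1 (inr i)).
have n20 : 0 <= n2 by apply: prod_ge0 => i; apply: (fa2 (inr i)).
rewrite mulrACA [X in _ <= X]mulrACA.
have -> : n0 * (n0 * (n1 * n2)) = n0 * n1 * (n0 * n2) by rewrite mulrACA !mulrA.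
by apply: ler_wpM2l => //; rewrite !mulr_ge0.
Qed.

End Lattice.

(** If g x = 0 with x <> 0, the 1 by 1 Gram matrix of x vanishes at a place. That some place exists
    follows from the existence of an embedding. *)
Lemma isometry_inj (g : 'End(E)) :
  (forall p x y, h p (g x) (g y) = h p x y) -> injective g.
Proof.
move=> gh.
suff gK x : g x = 0 -> x = 0.
  by move=> x y /eqP; rewrite -subr_eq0 -linearB => /eqP/gK/eqP; rewrite subr_eq0 => /eqP.
move=> gx; apply/eqP; apply: contrapT => /negP nzx.
have ix : indep (fun i : 'I_1 => x).
  move=> c; rewrite big_ord1 => /eqP; rewrite scaler_eq0 (negPf nzx) orbF => /eqP c0 i.
  by rewrite ord1.
have [p] : exists p : P, True.
  have [f _] : exists f : {rmorphism K -> R[i]}, True.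
    have [_ [tau _]] := embeddings_enum R K.
    by have /card_gt0P[j _] : (0 < #|'I_(\dim {:K})|)%N; [rewrite card_ord dim_gt0 | exists (tau j)].
  by have [p _] := places f; exists p.
have := posdef_det (gram_posdef hpos p ix).
by rewrite det_mx11 mxE -gh gx (herm0l hpos) ltxx.
Qed.

Lemma vol_inter_isometry L (g : 'End(E)) U : full_lattice L -> [set g x | x in L] = L ->
  (forall p x y, h p (g x) (g y) = h p x y) -> vol_inter L (g @: U)%VS = vol_inter L U.
Proof.
move=> lL gL gh; have [I [a [b pU]]] := inter_pbasis_exists lL U.
have [fa ib DU] := pU.
have gI := isometry_inj gh.
have pg : pbasis (inter L (g @: U)%VS) a (g \o b).
  split=> //.
    move=> c e; apply: ib; apply: gI; rewrite linear0 linear_sum -[RHS]e.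
    by apply: eq_bigr => i _; rewrite linearZ.
  apply/seteqP; split=> [y [Ly /memv_imgP[x Ux yE]]|_ [c ac ->]].
    have [x' Lx' e] : [set g x | x in L] y by rewrite gL.
    have Lx : L x by rewrite (gI x x') // e.
    have : inter L U x by [].
    rewrite DU => -[c ac xE]; exists c => //.
    by rewrite yE xE linear_sum; apply: eq_bigr => i _; rewrite linearZ.
  have -> : \sum_i c i *: (g \o b) i = g (\sum_i c i *: b i).
    by rewrite linear_sum; apply: eq_bigr => i _; rewrite linearZ.
  have [Lx Ux] : inter L U (\sum_i c i *: b i) by rewrite DU; exists c.
  split; last exact: memv_img.
  have : [set g x | x in L] (g (\sum_i c i *: b i)) by exists (\sum_i c i *: b i).
  by rewrite gL.
have hE : hvol sigma h (g \o b) = hvol sigma h b.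
  apply: eq_bigr => p _; have -> // : hdet h p (g \o b) = hdet h p b.
  by apply: eq_fdet => i j; rewrite /= gh.
by rewrite /vol_inter (volE pU) (volE pg) /pvol hE.
Qed.

End PseudoBases.

(** * Invariant submodular functions and irreducible modules *)

Section SubmodularMinimum.
Variables (R : realType) (K : fieldExtType rat) (E : vectType K) (phi : {vspace E} -> R).
Hypothesis phi_sub : forall U W, phi (U :&: W)%VS + phi (U + W)%VS <= phi U + phi W.

Definition coord_space (S : {set 'I_(\dim {:E})}) : {vspace E} :=
  (\sum_(i in S) <[(vbasis {:E})`_i]>)%VS.

(** Exchange argument: S is chosen maximal with [coord_space S] meeting U trivially, so each
    remaining basis vector already lies in U + [coord_space S]. *)
Lemma coord_complement U : exists S,
  (U :&: coord_space S = 0)%VS /\ (U + coord_space S = fullv)%VS.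
Proof.
pose Q (S : {set 'I_(\dim {:E})}) := (U :&: coord_space S == 0)%VS.
have Q0 : Q finset.set0 by rewrite /Q /coord_space big_set0 capv0.
case: (@arg_maxnP _ finset.set0 Q (fun S => #|S|) Q0) => S /eqP QS Smax.
exists S; split=> //; apply/eqP; rewrite eqEsubv subvf /=.
rewrite -(span_basis (vbasisP {:E})); apply/span_subvP => x /(nthP 0)[k].
rewrite size_tuple => kn <-; pose i := Ordinal kn; rewrite -[k]/(val i).
have [iS|niS] := boolP (i \in S).
  apply: (subvP (addvSr _ _)); apply: (subvP (sumv_sup i iS (subvv _))); exact: memv_line.
have : ~~ Q (i |: S).
  by apply/negP => /Smax; rewrite /geq /= cardsU1 niS add1n ltnn.
rewrite /Q -subv0 => /subvPn[u]; rewrite memv_cap memv0 => /andP[Uu].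
rewrite /coord_space big_setU1 //= => /memv_addP[_ /vlineP[c ->] [w Sw uE]] nzu.
have nzc : c != 0.
  apply: contra nzu => /eqP c0; rewrite -memv0 -QS memv_cap Uu uE c0 scale0r add0r.
  exact: Sw.
have -> : (vbasis {:E})`_i = c^-1 *: (u - w).
  by rewrite uE addrK scalerA mulVf // scale1r.
by rewrite rpredZ // memv_add // rpredN.
Qed.

(** Submodularity for U and a coordinate complement C gives phi(U) >= phi(E) + phi(0) - phi(C), and
    there are finitely many C. *)
Lemma phi_bounded : exists B, forall U, B <= phi U.
Proof.
exists (phi fullv + phi 0%VS - \sum_(S : {set 'I_(\dim {:E})}) `|phi (coord_space S)|) => U.
have [S [c0 cf]] := coord_complement U.
have := phi_sub U (coord_space S); rewrite c0 cf addrC -lerBlDr => le.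
apply: le_trans le; rewrite lerD2l lerN2; apply: le_trans (ler_norm _) _.
by rewrite (bigD1 S) //= lerDl sumr_ge0.
Qed.

(* Almost minimisers are closed under sums, up to doubling the error. *)
Lemma submodular_stable_ge0 (G : set 'End(E)) :
  (forall g U, G g -> phi (g @: U)%VS = phi U) ->
  (forall U, stable G U -> 0 <= phi U) -> forall U, 0 <= phi U.
Proof.
move=> phiG phi0 U0; rewrite leNgt; apply/negP => neg.
have [B phiB] := phi_bounded; pose D : set R := range phi; pose I := inf D.
have hD : has_inf D by split; [exists (phi U0), U0 | exists B => _ [U _ <-]].
have Ile U : I <= phi U by apply: ge_inf; [case: hD | exists U].
have I0 : I < 0 by apply: le_lt_trans neg.
pose d := \dim {:E}.
(* n bounds the codimension, hence the number of enlargements, each of which doubles e. *)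
have key n U e : (d - \dim U <= n)%N -> 0 <= e -> phi U <= I + e ->
    exists2 S, stable G S & phi S <= I + 2 ^+ n * e.
  elim: n U e => [|n IH] U e dU e0 pU.
    exists U; last by rewrite expr0 mul1r.
    have -> : U = fullv by apply/eqP; rewrite eqEdim subvf -subn_eq0 -leqn0.
    by move=> g _; apply: subvf.
  have [sU|/existsNP[g /not_implyP[Gg /negP ngU]]] := pselect (stable G U).
    exists U => //; apply: le_trans pU _; rewrite lerD2l ler_peMl //.
    by rewrite exprn_ege1 // ler1n.
  have [| |//|S sS pS] := IH (U + g @: U)%VS (e + e).
  - have lt : (\dim U < \dim (U + g @: U))%N.
      rewrite ltnNge; apply: contra ngU => le.
      have /eqP {2}-> : (U == U + g @: U)%VS by rewrite eqEdim addvSl.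
      exact: addvSr.
    by rewrite -ltnS; apply: leq_trans dU; apply: ltn_sub2l => //; apply: leq_trans lt (dimvS (subvf _)).
  - exact: addr_ge0.
  - have := phi_sub U (g @: U)%VS; rewrite phiG // => le.
    rewrite -(lerD2l (phi (U :&: g @: U)%VS)); apply: le_trans le _.
    apply: le_trans (lerD pU pU) _; rewrite addrACA [X in _ <= X]addrA.
    by rewrite lerD2r lerD2r.
  exists S => //; apply: le_trans pS _.
  by rewrite exprSr -mulrA mulr_natl mulr2n.
(* After at most d doublings the error is at most -I/2, so a stable S would have phi(S) <= I/2 <
   0. *)
pose e := - I / 2 ^+ d.+1.
have e0 : 0 < e by rewrite divr_gt0 ?oppr_gt0 // exprn_gt0.
have [_ [U _ <-] Ulow] := inf_adherent e0 hD.
have [S sS] := key d U e (leq_subr _ _) (ltW e0) (ltW Ulow).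
have -> : 2 ^+ d * e = - I / 2.
  by rewrite /e exprSr invfM mulrCA mulVKf // expf_neq0 // pnatr_eq0.
move=> le; have := le_trans (phi0 S sS) le; rewrite leNgt => /negP; apply.
by move: (I) I0 => J; lra.
Qed.

End SubmodularMinimum.

(** * Schur's lemma for absolutely irreducible modules *)

Section Schur.
Variables (K : fieldExtType rat) (E : vectType K) (G : set 'End(E)).

Definition ucoord (U : {vspace E}) (x : E) : 'rV[K]_(\dim U) :=
  \row_j coord (vbasis U) j x.

Lemma ucoordE (U : {vspace E}) x : x \in U -> x = \sum_j ucoord U x 0 j *: (vbasis U)`_j.
Proof. by move=> Ux; rewrite {1}(coord_vbasis Ux); apply: eq_bigr => j _; rewrite mxE. Qed.

Lemma ucoord_sum (U : {vspace E}) (I : finType) (c : I -> K) (b : I -> E) :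
  ucoord U (\sum_i c i *: b i) = \sum_i c i *: ucoord U (b i).
Proof.
apply/rowP => j; rewrite mxE linear_sum summxE; apply: eq_bigr => i _.
by rewrite linearZ !mxE.
Qed.

Lemma ucoord_restr (U : {vspace E}) (g : 'End(E)) x : x \in U -> ucoord U (g x) = ucoord U x *m restr_mx U g.
Proof.
move=> Ux; rewrite {1}(ucoordE Ux) linear_sum; apply/rowP => j; rewrite !mxE linear_sum.
by apply: eq_bigr => k _; rewrite !linearZ /= !mxE.
Qed.

Lemma ucoord_eq0 (U : {vspace E}) x : x \in U -> ucoord U x = 0 -> x = 0.
Proof. by move=> Ux e; rewrite (ucoordE Ux) e big1 // => j _; rewrite mxE scale0r. Qed.

Lemma stable_mem (U : {vspace E}) g x : stable G U -> G g -> x \in U -> g x \in U.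
Proof. by move=> sU Gg Ux; apply: (subvP (sU g Gg)); apply: memv_img. Qed.

Lemma abs_irr_irreducible (U W : {vspace E}) : absolutely_irreducible G U -> stable G W ->
  (W <= U)%VS -> W != 0%VS -> W = U.
Proof.
move=> [sU U0 [iota irr]] sW WU nzW.
pose M : 'M[K]_(\dim W, \dim U) := \matrix_i ucoord U (vbasis W)`_i.
have WUx x : x \in W -> x \in U := fun Wx => subvP WU _ Wx.
have Wb (i : 'I_(\dim W)) : (vbasis W)`_i \in W by apply/vbasis_mem/mem_nth; rewrite size_tuple.
have memM x : x \in W -> (ucoord U x <= M)%MS.
  move=> Wx; rewrite (coord_vbasis Wx) ucoord_sum summx_sub // => i _.
  by rewrite scalemx_sub // -[ucoord _ _](rowK (fun i => ucoord U (vbasis W)`_i)) row_sub.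
have stab g : G g -> stablemx (map_mx iota <<M>>%MS) (map_mx iota (restr_mx U g)).
  move=> Gg; rewrite -map_mxM map_submx; rewrite (eqmxMr _ (genmxE M)) genmxE.
  apply/row_subP => i; rewrite row_mul rowK -ucoord_restr ?WUx //; apply: memM.
  exact: stable_mem sW Gg (Wb i).
have nzM : map_mx iota <<M>>%MS != 0.
  rewrite map_mx_eq0 -mxrank_eq0 genmxE mxrank_eq0; apply: contra nzW => /eqP M0.
  rewrite -subv0; apply/subvP => x Wx; rewrite memv0; apply/eqP/(ucoord_eq0 (WUx _ Wx)).
  by have /submxP[D ->] := memM x Wx; rewrite M0 mulmx0.
have := irr _ stab nzM; rewrite row_full_map /row_full genmxE => /eqP rk.
by apply/eqP; rewrite eqEdim WU -rk rank_leq_row.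
Qed.

(** Over [algC] an eigenspace of tau is nonzero and stable, hence everything. The eigenvalue is a
    diagonal entry of the matrix of tau over K, so it comes from K. *)
Lemma abs_irr_scalar (U : {vspace E}) (tau : 'End(E)) : absolutely_irreducible G U ->
  (forall x, x \in U -> tau x \in U) ->
  (forall g x, G g -> x \in U -> tau (g x) = g (tau x)) ->
  exists c, forall x, x \in U -> tau x = c *: x.
Proof.
move=> [sU U0 [iota irr]] tU tG; pose T := restr_mx U tau.
have Ub (i : 'I_(\dim U)) : (vbasis U)`_i \in U by apply/vbasis_mem/mem_nth; rewrite size_tuple.
have [l el] := eigenvalue_closed (map_mx iota T) U0.
have comm g : G g -> T *m restr_mx U g = restr_mx U g *m T.
  move=> Gg; apply/row_matrixP => i; rewrite !row_mul.
  have -> : row i T = ucoord U (tau (vbasis U)`_i) by apply/rowP => j; rewrite !mxE.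
  have -> : row i (restr_mx U g) = ucoord U (g (vbasis U)`_i) by apply/rowP => j; rewrite !mxE.
  rewrite -!ucoord_restr ?tG //; [exact: stable_mem | exact: tU].
have stab g : G g -> stablemx (eigenspace (map_mx iota T) l) (map_mx iota (restr_mx U g)).
  by move=> Gg; apply: comm_mx_stable_eigenspace; rewrite /comm_mx -!map_mxM comm.
have := irr _ stab el; rewrite -sub1mx => /eigenspaceP; rewrite mul1mx => TE.
have {TE}TE i j : iota (T i j) = l *+ (i == j).
  by have := congr1 (fun M : 'M_(\dim U) => M i j) TE; rewrite !mxE => ->; rewrite mulr_natr.
have [c TE'] : exists c, T = c%:M.
  pose i0 := Ordinal U0; exists (T i0 i0).
  apply/matrixP => i j; apply: (fmorph_inj iota).
  by rewrite [in RHS]mxE [in RHS]rmorphMn /= !TE eqxx.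
exists c => x Ux; have := ucoord_restr tau Ux; rewrite -/T TE' mul_mx_scalar => e.
rewrite (ucoordE (tU _ Ux)) e [in RHS](ucoordE Ux) scaler_sumr.
by apply: eq_bigr => j _; rewrite mxE scalerA.
Qed.

(** The kernel in U and the image in V are stable, so an equivariant map that is not zero on U would
    be an isomorphism. *)
Lemma abs_irr_hom0 (U V : {vspace E}) (tau : 'End(E)) : absolutely_irreducible G U ->
  absolutely_irreducible G V -> ~ KG_isomorphic G U V ->
  (forall x, x \in U -> tau x \in V) ->
  (forall g x, G g -> x \in U -> tau (g x) = g (tau x)) ->
  forall x, x \in U -> tau x = 0.
Proof.
move=> iU iV niso tUV tG; have [sU U0 _] := iU.
pose W := (U :&: lker tau)%VS.
have sW : stable G W.
  move=> g Gg; apply/subvP => _ /memv_imgP[x Wx ->]; move: Wx; rewrite !memv_cap !memv_ker.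
  case/andP=> Ux /eqP tx; rewrite tG // tx linear0 eqxx andbT.
  exact: stable_mem sU Gg _.
have [W0|nzW] := eqVneq W 0%VS; last first.
  have WU := abs_irr_irreducible iU sW (capvSl _ _) nzW => x.
  by rewrite -WU memv_cap memv_ker => /andP[_ /eqP].
exfalso; apply: niso; exists tau; split=> //; last first.
  move=> x y Ux Uy e; apply/eqP; rewrite -subr_eq0 -memv0 -W0 memv_cap rpredB //.
  by rewrite /= memv_ker linearB /= e subrr.
apply: (abs_irr_irreducible iV).
- move=> g Gg; apply/subvP => _ /memv_imgP[_ /memv_imgP[x Ux ->] ->].
  rewrite -tG //; apply: memv_img; exact: stable_mem sU Gg _.
- by apply/subvP => _ /memv_imgP[x Ux ->]; apply: tUV.
- rewrite -dimv_eq0 -lt0n limg_dim_eq //.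
Qed.

End Schur.

(** * Tensor products *)

Section Bilinear.
Variables (K : fieldExtType rat) (E F : vectType K).

Definition spans (V : vectType K) (I : finType) (b : I -> V) :=
  forall x, exists c : I -> K, x = \sum_i c i *: b i.

Definition bilin (V : vectType K) (B : E -> F -> V) :=
  (forall a x x' y, B (a *: x + x') y = a *: B x y + B x' y) /\
  (forall a x y y', B x (a *: y + y') = a *: B x y + B x y').

Lemma lfun_of_linear (V W : vectType K) (f : V -> W) :
  (forall a u v, f (a *: u + v) = a *: f u + f v) ->
  exists g : 'Hom(V, W), forall u, g u = f u.
Proof.
move=> lf; pose F0 : {linear V -> W} := HB.pack f (GRing.isLinear.Build K V W *:%R f lf).
by exists (linfun F0) => u; rewrite lfunE.
Qed.

Lemma dual_functional (V : vectType K) (I : finType) (b : I -> V) i : indep b ->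
  exists phi : 'Hom(V, K^o), forall k, phi (b k) = (k == i)%:R.
Proof.
move=> ib; pose b' k := if k == i then 0 else b k.
have nU : b i \notin fspan b'.
  apply/negP => /fspanP[c e]; pose d k := if k == i then 1 else - c k.
  suff d0 : \sum_k d k *: b k = 0.
    by have := ib d d0 i; rewrite /d eqxx => /eqP; rewrite oner_eq0.
  rewrite (bigD1 i) //= /d eqxx scale1r e (bigD1 i) //= /b' eqxx scaler0 add0r -big_split.
  by rewrite big1 // => k /negPf ki; rewrite /= ki scaleNr subrr.
have [phi phiU phi1] := functional_at nU; exists phi => k.
case: eqP => [->//|/eqP /negPf ki]; apply: phiU.
by have := fspan_mem b' k; rewrite /b' ki.
Qed.

Section Sums.
Variables (V : vectType K) (B : E -> F -> V).
Hypothesis bB : bilin B.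

Lemma bilin0l y : B 0 y = 0.
Proof.
have := bB.1 1 0 0 y; rewrite scaler0 addr0 scale1r => /eqP.
by rewrite -subr_eq0 opprD addNKr oppr_eq0 => /eqP.
Qed.

Lemma bilin0r x : B x 0 = 0.
Proof.
have := bB.2 1 x 0 0; rewrite scaler0 addr0 scale1r => /eqP.
by rewrite -subr_eq0 opprD addNKr oppr_eq0 => /eqP.
Qed.

Lemma bilin_suml (I : finType) (c : I -> K) (b : I -> E) y :
  B (\sum_i c i *: b i) y = \sum_i c i *: B (b i) y.
Proof. by elim/big_rec2: _ => [|i u v _ <-]; [apply: bilin0l | rewrite bB.1]. Qed.

Lemma bilin_sumr (I : finType) (c : I -> K) (b : I -> F) x :
  B x (\sum_i c i *: b i) = \sum_i c i *: B x (b i).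
Proof. by elim/big_rec2: _ => [|i u v _ <-]; [apply: bilin0r | rewrite bB.2]. Qed.

Lemma bilin_sum (I J : finType) (c : I -> K) (b : I -> E) (d : J -> K) (b' : J -> F) :
  B (\sum_i c i *: b i) (\sum_j d j *: b' j) =
  \sum_(u : I * J) (c u.1 * d u.2) *: B (b u.1) (b' u.2).
Proof.
rewrite bilin_suml; under eq_bigr => i _ do rewrite bilin_sumr scaler_sumr.
by rewrite pair_big; apply: eq_bigr => u _; rewrite scalerA.
Qed.

Lemma bilinDl x x' y : B (x + x') y = B x y + B x' y.
Proof. by have := bB.1 1 x x' y; rewrite !scale1r. Qed.

Lemma bilinDr x y y' : B x (y + y') = B x y + B x y'.
Proof. by have := bB.2 1 x y y'; rewrite !scale1r. Qed.

Lemma bilinZl a x y : B (a *: x) y = a *: B x y.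
Proof. by have := bB.1 a x 0 y; rewrite addr0 bilin0l addr0. Qed.

Lemma bilinZr a x y : B x (a *: y) = a *: B x y.
Proof. by have := bB.2 a x y 0; rewrite addr0 bilin0r addr0. Qed.

End Sums.

(** An abstract tensor product, given by one pair of bases whose products form a basis. It covers
    [tens], the exchange of the two factors, and scalar multiplication, which presents E as E ⊗
    K. *)
Definition is_tensor (T : vectType K) (t : E -> F -> T) := bilin t /\
  exists (I J : finType) (e : I -> E) (f : J -> F),
    [/\ spans e, spans f, indep (fun u : I * J => t (e u.1) (f u.2)) &
        spans (fun u : I * J => t (e u.1) (f u.2))] /\ (indep e /\ indep f).

Section Tensor.
Variables (T : vectType K) (t : E -> F -> T).
Hypothesis tT : is_tensor t.

Lemma tens_bilin : bilin t. Proof. by case: tT. Qed.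

Lemma indep_coord_uniq (V : vectType K) (I : finType) (b : I -> V) (c d : I -> K) :
  indep b -> \sum_i c i *: b i = \sum_i d i *: b i -> c =1 d.
Proof.
move=> ib /eqP; rewrite -subr_eq0 -sumrB => /eqP e i.
apply/eqP; rewrite -subr_eq0; apply/eqP; apply: (ib (fun i => c i - d i)).
by rewrite -[RHS]e; apply: eq_bigr => j _; rewrite scalerBl.
Qed.

Lemma tens_univ (V : vectType K) (B : E -> F -> V) : bilin B ->
  exists g : 'Hom(T, V), forall x y, g (t x y) = B x y.
Proof.
move=> bB; have [bt [I [J [e [f [[se sf iw sw] [ie if_]]]]]]] := tT.
have [k kE] := choice sw.
pose G u := \sum_(v : I * J) k u v *: B (e v.1) (f v.2).
have kU u (c : I * J -> K) : u = \sum_v c v *: t (e v.1) (f v.2) -> k u =1 c.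
  by move=> uE; apply: indep_coord_uniq iw _; rewrite -kE.
have lG a u v : G (a *: u + v) = a *: G u + G v.
  have h := kU (a *: u + v) (fun w => a * k u w + k v w) => /=.
  rewrite /G scaler_sumr -big_split /=; apply: eq_bigr => w _.
  rewrite h ?scalerDl ?scalerA // [u in LHS]kE [v in LHS]kE scaler_sumr -big_split.
  by apply: eq_bigr => w' _; rewrite /= scalerDl scalerA.
have [g gE] := lfun_of_linear lG; exists g => x y; rewrite gE.
have [c xE] := se x; have [d yE] := sf y.
have h := kU (t x y) (fun v => c v.1 * d v.2).
rewrite [in RHS]xE [in RHS]yE (bilin_sum bB); apply: eq_bigr => w _.
by rewrite h // xE yE (bilin_sum bt).
Qed.

(** Contraction with a functional dual to b_i turns a relation among the b_i ⊗ c_k into one among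
    the c_k. *)
Lemma tens_indep (I J : finType) (b : I -> E) (c : J -> F) : indep b -> indep c ->
  indep (fun u : I * J => t (b u.1) (c u.2)).
Proof.
move=> ib ic d e [i j].
have [phi phiE] := dual_functional i ib.
have bB : bilin (fun x y => phi x *: y : F).
  split=> [a x x' y|a x y y']; first by rewrite linearP scalerDl scalerA.
  by rewrite scalerDr !scalerA mulrC.
have [g gE] := tens_univ bB.
have : \sum_k d (i, k) *: c k = 0.
  have := congr1 g e; rewrite linear0 linear_sum => ge; rewrite -[RHS]ge.
  have -> : \sum_u g (d u *: t (b u.1) (c u.2)) = \sum_i \sum_k g (d (i, k) *: t (b i) (c k)).
    by rewrite pair_bigA; apply: eq_bigr; case.
  rewrite [RHS](bigD1 i) //= [X in _ = _ + X]big1 ?addr0.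
    by apply: eq_bigr => k _; rewrite linearZ /= gE phiE eqxx scale1r.
  move=> i' ne; rewrite big1 // => k _.
  by rewrite linearZ /= gE phiE (negPf ne) scale0r scaler0.
by move/ic/(_ j).
Qed.

Lemma tens_spans (I J : finType) (b : I -> E) (c : J -> F) : spans b -> spans c ->
  spans (fun u : I * J => t (b u.1) (c u.2)).
Proof.
move=> sb sc u; have [bt [I' [J' [e [f [[_ _ _ sw] _]]]]]] := tT.
suff : u \in fspan (fun u : I * J => t (b u.1) (c u.2)) by case/fspanP => k ->; exists k.
have [k ->] := sw u; apply: memv_suml => v _; apply: rpredZ.
have [c1 ->] := sb (e v.1); have [c2 ->] := sc (f v.2).
rewrite (bilin_sum bt); apply: memv_suml => w _; apply: rpredZ.
exact: (fspan_mem (fun u : I * J => t (b u.1) (c u.2))).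
Qed.

Lemma vbasis_spans (V : vectType K) (U : {vspace V}) x : x \in U ->
  exists c : 'I_(\dim U) -> K, x = \sum_i c i *: (vbasis U)`_i.
Proof. by move=> Ux; exists (fun i => coord (vbasis U) i x); apply: coord_vbasis. Qed.

Lemma vbasis_indep (V : vectType K) (U : {vspace V}) :
  indep (fun i : 'I_(\dim U) => (vbasis U)`_i).
Proof. by move=> c e i; apply: (freeP (basis_free (vbasisP U))) e i. Qed.

Lemma vbasis_memn (V : vectType K) (U : {vspace V}) (i : 'I_(\dim U)) : (vbasis U)`_i \in U.
Proof. by apply/vbasis_mem/mem_nth; rewrite size_tuple. Qed.

Definition tensv (A : {vspace E}) (B : {vspace F}) : {vspace T} :=
  fspan (fun u : 'I_(\dim A) * 'I_(\dim B) => t (vbasis A)`_u.1 (vbasis B)`_u.2).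

Lemma tensv_mem (A : {vspace E}) (B : {vspace F}) x y : x \in A -> y \in B -> t x y \in tensv A B.
Proof.
move=> /vbasis_spans[c ->] /vbasis_spans[d ->]; rewrite (bilin_sum tens_bilin).
apply: memv_suml => u _; apply: rpredZ.
exact: (fspan_mem (fun u : 'I_(\dim A) * 'I_(\dim B) => t (vbasis A)`_u.1 (vbasis B)`_u.2)).
Qed.

Lemma tensv_sub (A : {vspace E}) (B : {vspace F}) (W : {vspace T}) : (forall x y, x \in A -> y \in B -> t x y \in W) ->
  (tensv A B <= W)%VS.
Proof. by move=> h; apply: fspan_sub => u; apply: h; apply: vbasis_memn. Qed.

Lemma tensv_ind (W : {vspace T}) (A : {vspace E}) (B : {vspace F}) u : (forall x y, x \in A -> y \in B -> t x y \in W) ->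
  u \in tensv A B -> u \in W.
Proof. by move/tensv_sub/subvP; apply. Qed.

Lemma tensvS (A A' : {vspace E}) (B B' : {vspace F}) : (A <= A')%VS -> (B <= B')%VS -> (tensv A B <= tensv A' B')%VS.
Proof.
move=> /subvP sA /subvP sB; apply: tensv_sub => x y /sA Ax /sB By; exact: tensv_mem.
Qed.

Lemma dim_tensv (A : {vspace E}) (B : {vspace F}) : \dim (tensv A B) = (\dim A * \dim B)%N.
Proof.
rewrite dim_fspan ?card_prod ?card_ord //.
exact: (tens_indep (@vbasis_indep E A) (@vbasis_indep F B)).
Qed.

Lemma tensvDl (A A' : {vspace E}) (B : {vspace F}) : (tensv (A + A') B = tensv A B + tensv A' B)%VS.
Proof.
apply/eqP; rewrite eqEsubv subv_add !tensvS ?addvSl ?addvSr ?subvv // !andbT.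
apply: tensv_sub => x y /memv_addP[u Au [v Av ->]] By.
by rewrite (bilinDl tens_bilin) memv_add // tensv_mem.
Qed.

Lemma tensvDr (A : {vspace E}) (B B' : {vspace F}) : (tensv A (B + B') = tensv A B + tensv A B')%VS.
Proof.
apply/eqP; rewrite eqEsubv subv_add !tensvS ?addvSl ?addvSr ?subvv // !andbT.
apply: tensv_sub => x y Ax /memv_addP[u Bu [v Bv ->]].
by rewrite (bilinDr tens_bilin) memv_add // tensv_mem.
Qed.

Lemma tensv0r (A : {vspace E}) : tensv A 0%VS = 0%VS.
Proof. by apply/eqP; rewrite -dimv_eq0 dim_tensv dimv0 muln0. Qed.

Lemma tensv0l (B : {vspace F}) : tensv 0%VS B = 0%VS.
Proof. by apply/eqP; rewrite -dimv_eq0 dim_tensv dimv0. Qed.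

Lemma tensv_full : tensv fullv fullv = fullv.
Proof.
apply/vspaceP => u; rewrite memvf.
have sE (V : vectType K) : spans (fun i : 'I_(\dim {:V}) => (vbasis {:V})`_i).
  by move=> x; apply: vbasis_spans; apply: memvf.
have [c ->] := tens_spans (sE E) (sE F) u.
by apply: memv_suml => v _; apply: rpredZ; apply: tensv_mem; apply: vbasis_memn.
Qed.

Lemma tens_action : exists A : 'End(E) -> 'End(T), forall g x y, A g (t x y) = t (g x) y.
Proof.
suff /choice[A AE] : forall (g : 'End(E)), exists k : 'End(T), forall x y, k (t x y) = t (g x) y by exists A.
move=> g.
apply: (tens_univ (B := fun x y => t (g x) y)).
split=> [a x x' y|a x y y']; first by rewrite linearP (tens_bilin.1).
exact: tens_bilin.2.
Qed.

Lemma tens_actionr : exists A : 'End(F) -> 'End(T), forall g x y, A g (t x y) = t x (g y).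
Proof.
suff /choice[A AE] : forall (g : 'End(F)), exists k : 'End(T), forall x y, k (t x y) = t x (g y) by exists A.
move=> g.
apply: (tens_univ (B := fun x y => t x (g y))).
split=> [a x x' y|a x y y']; first exact: tens_bilin.1.
by rewrite linearP (tens_bilin.2).
Qed.

Lemma tens_contract (phi : 'Hom(F, K^o)) : exists g : 'Hom(T, E), forall x y, g (t x y) = phi y *: x.
Proof.
apply: (@tens_univ _ (fun x y => phi y *: x)); split=> [a x x' y|a x y y'].
  by rewrite scalerDr !scalerA mulrC.
by rewrite linearP scalerDl scalerA.
Qed.

Lemma tens_contractl (phi : 'Hom(E, K^o)) : exists g : 'Hom(T, F), forall x y, g (t x y) = phi x *: y.
Proof.
apply: (@tens_univ _ (fun x y => phi x *: y)); split=> [a x x' y|a x y y'].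
  by rewrite linearP scalerDl scalerA.
by rewrite scalerDr !scalerA mulrC.
Qed.

Lemma lfun_tens_ext (V : vectType K) (g g' : 'Hom(T, V)) :
  (forall x y, g (t x y) = g' (t x y)) -> forall u, g u = g' u.
Proof.
move=> h u; have /fspanP[c ->] : u \in tensv fullv fullv by rewrite tensv_full memvf.
by rewrite !linear_sum; apply: eq_bigr => v _; rewrite !linearZ /= h.
Qed.

End Tensor.

Section Projections.
Variables (V : vectType K) (r : nat) (U : 'I_r -> {vspace V}).
Hypotheses (Ufull : (\sum_i U i)%VS = fullv) (Udir : directv (\sum_i U i)).

Lemma proj_family : exists pi : 'I_r -> 'End(V), [/\ forall i x, pi i x \in U i,
  forall x, x = \sum_i pi i x &
  forall (v : 'I_r -> V) x, (forall i, v i \in U i) -> x = \sum_i v i -> forall i, pi i x = v i].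
Proof.
pose pi i := sumv_pi_for (erefl (\sum_i U i)%VS) i.
have piU i x : pi i x \in U i by apply: memv_sum_pi.
have piS x : x = \sum_i pi i x.
  by rewrite {1}(sumv_pi_sum (erefl (\sum_i U i)%VS)) // Ufull memvf.
exists pi; split=> // v x vU xE i.
have := directv_sum_unique Udir (fun i => pi i x) v (fun i _ => piU i x) (fun i _ => vU i).
by rewrite -piS -xE eqxx => /esym/forallP/(_ i)/eqP.
Qed.

End Projections.

End Bilinear.

(** * Stable subspaces of a tensor product *)

Section StableTensor.
Variables (K : fieldExtType rat) (E F T : vectType K) (t : E -> F -> T).
Hypothesis tT : is_tensor t.
Variables (G : set 'End(E)) (r : nat) (U : 'I_r -> {vspace E}).
Hypotheses (Uirr : forall i, absolutely_irreducible G (U i))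
  (Uniso : forall i j, i != j -> ~ KG_isomorphic G (U i) (U j))
  (Ufull : (\sum_i U i)%VS = fullv) (Udir : directv (\sum_i U i)).
Variable A : 'End(E) -> 'End(T).
Hypothesis AE : forall g x y, A g (t x y) = t (g x) y.

Let GT : set 'End(T) := [set A g | g in G].

Lemma dual_basis_family (V : vectType K) : exists (phi : 'I_(\dim {:V}) -> 'Hom(V, K^o)),
  forall x, x = \sum_j phi j x *: (vbasis {:V})`_j.
Proof.
have /choice[phi phiE] : forall j : 'I_(\dim {:V}), exists phi : 'Hom(V, K^o),
    forall k : 'I_(\dim {:V}), phi (vbasis {:V})`_k = (k == j)%:R.
  by move=> j; apply: dual_functional; apply: vbasis_indep.
exists phi => x; have [c xE] := vbasis_spans (memvf x); rewrite [LHS]xE.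
apply: eq_bigr => j _; rewrite xE linear_sum (bigD1 j) //= linearZ /= phiE eqxx.
rewrite big1 ?addr0 => [|k /negPf kj]; first by rewrite /GRing.scale /= mulr1.
by rewrite linearZ /= phiE kj scaler0.
Qed.

Lemma tens_lfun (y : F) : exists f : 'Hom(E, T), forall x, f x = t x y.
Proof. by apply: lfun_of_linear => a u v; apply: (tens_bilin tT).1. Qed.

Lemma tens_lfunr (x : E) : exists f : 'Hom(F, T), forall y, f y = t x y.
Proof. by apply: lfun_of_linear => a u v; apply: (tens_bilin tT).2. Qed.

(** In a minimal nonzero stable S <= Z some map [kap i j], the U_i-component of the j-th
    F-coordinate, is nonzero, hence an isomorphism of S onto U_i. By Schur's lemma the F-coordinates
    of its inverse are scalars c_j on U_i, so the inverse is u |-> u ⊗ x with x the vector of the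
    c_j. *)
Lemma stable_tensor_pure (Z : {vspace T}) : stable GT Z -> Z != 0%VS ->
  exists i x, x != 0 /\ forall u, u \in U i -> t u x \in Z.
Proof.
move=> sZ nzZ.
pose Q n := `[< exists S : {vspace T}, [/\ (S <= Z)%VS, stable GT S, S != 0%VS & \dim S = n] >].
have exQ : exists n, Q n by exists (\dim Z); apply/asboolP; exists Z.
case: (ex_minnP exQ) => n /asboolP[S [SZ sS nzS dS]] nmin.
have [phi phiE] := dual_basis_family F.
have /choice[gc gcE] := fun j => tens_contract tT (phi j).
have /choice[tau tauE] := fun j : 'I_(\dim {:F}) => tens_lfun (vbasis {:F})`_j.
have dec z : z = \sum_j t (gc j z) (vbasis {:F})`_j.
  transitivity ((\sum_j (tau j \o gc j))%VF z).
    rewrite -[LHS]id_lfunE; apply: (lfun_tens_ext tT) => x y.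
    rewrite id_lfunE sum_lfunE {1}(phiE y) (bilin_sumr (tens_bilin tT)).
    by apply: eq_bigr => j _; rewrite comp_lfunE tauE gcE (bilinZl (tens_bilin tT)).
  by rewrite sum_lfunE; apply: eq_bigr => j _; rewrite comp_lfunE tauE.
have [pi [piU piS piuniq]] := proj_family Ufull Udir.
have piG i g x : G g -> pi i (g x) = g (pi i x).
  move=> Gg; apply: (piuniq (fun i => g (pi i x))) => [k|].
    by apply: stable_mem (Gg) (piU k x); case: (Uirr k).
  by rewrite -linear_sum /= -piS.
pose kap i j := (pi i \o gc j)%VF.
have kapG i j g u : G g -> kap i j (A g u) = g (kap i j u).
  move=> Gg; transitivity ((kap i j \o A g)%VF u); first by rewrite comp_lfunE.
  transitivity ((g \o kap i j)%VF u); last by rewrite comp_lfunE.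
  apply: (lfun_tens_ext tT) => x y; rewrite !comp_lfunE AE !gcE -piG //.
  by congr (pi i _); rewrite linearZ.
have kapU i j u : kap i j u \in U i by rewrite comp_lfunE.
have [i [j [s Ss nzk]]] : exists i j, exists2 s, s \in S & kap i j s != 0.
  apply: contrapT => no; move: nzS; rewrite -vpick0 => /eqP; apply.
  rewrite [LHS]dec big1 // => j _; rewrite (_ : gc j _ = 0) ?(bilin0l (tens_bilin tT)) //.
  rewrite [LHS]piS big1 // => i _; apply/eqP/negPn/negP => nz; apply: no.
  by exists i, j, (vpick S); rewrite ?memv_pick // comp_lfunE.
pose k := kap i j.
have inj u : u \in S -> k u = 0 -> u = 0.
  move=> Su ku; pose S' := (S :&: lker k)%VS.
  have sS' : stable GT S'.
    move=> _ [g Gg <-]; apply/subvP => _ /memv_imgP[x S'x ->].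
    move: S'x; rewrite !memv_cap !memv_ker => /andP[Sx /eqP kx].
    rewrite /k kapG // -/k kx linear0 eqxx andbT.
    by apply: stable_mem sS _ Sx; exists g.
  have [S'0|nzS'] := eqVneq S' 0%VS.
    by apply/eqP; rewrite -memv0 -S'0 memv_cap Su memv_ker ku eqxx.
  have /nmin : Q (\dim S').
    by apply/asboolP; exists S'; split=> //; apply: subv_trans (capvSl _ _) SZ.
  rewrite -dS => le; have /eqP SS' : S' == S by rewrite eqEdim capvSl.
  by move: Ss; rewrite -SS' memv_cap memv_ker => /andP[_ ks]; rewrite -/k ks in nzk.
have imS : (k @: S = U i)%VS.
  apply: (abs_irr_irreducible (Uirr i)).
  - move=> g Gg; apply/subvP => _ /memv_imgP[_ /memv_imgP[x Sx ->] ->].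
    by rewrite -kapG //; apply: memv_img; apply: stable_mem sS _ Sx; exists g.
  - by apply/subvP => _ /memv_imgP[x Sx ->]; apply: kapU.
  - by apply: contra nzk => /eqP k0; rewrite -memv0 -k0 memv_img.
(* The inverse of [k] on U_i, extended linearly to all of E. *)
have [th [thS thk]] : exists th : 'Hom(E, T), (forall x, th x \in S) /\ forall x, x \in U i -> k (th x) = x.
  pose q := (k \o projv S)%VF; exists (projv S \o q^-1)%VF; split=> [x|x].
    by rewrite comp_lfunE memv_proj.
  rewrite -imS => /memv_imgP[v Sv ->]; rewrite (comp_lfunE (projv S)) -[LHS](comp_lfunE k).
  have kv : k v \in limg q.
    by apply/memv_imgP; exists v; rewrite ?memvf // /q (comp_lfunE k) projv_id.
  exact: limg_lfunVK kv.
have thG g x : G g -> x \in U i -> th (g x) = A g (th x).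
  move=> Gg Ux; have Ugx : g x \in U i by apply: stable_mem Gg Ux; case: (Uirr i).
  apply/eqP; rewrite -subr_eq0; apply/eqP; apply: inj.
    by rewrite rpredB //; apply: stable_mem sS _ (thS x); exists g.
  by rewrite linearB /= thk // [X in _ - X]kapG // -/k thk // subrr.
have thkG i' j' g x : G g -> x \in U i -> (kap i' j' \o th)%VF (g x) = g ((kap i' j' \o th)%VF x).
  by move=> Gg Ux; rewrite !(comp_lfunE (kap i' j') th) thG // kapG.
have /choice[c cE] : forall j', exists c, forall x, x \in U i -> (kap i j' \o th)%VF x = c *: x.
  move=> j'; apply: (abs_irr_scalar (Uirr i)) => [x Ux|]; first by rewrite comp_lfunE.
  exact: thkG.
have gcth j' x : x \in U i -> gc j' (th x) = c j' *: x.
  move=> Ux; rewrite [LHS]piS (bigD1 i) //= big1 ?addr0.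
    by rewrite -cE // !comp_lfunE.
  move=> i' ne; have := abs_irr_hom0 (Uirr i) (Uirr i') (tau := (kap i' j' \o th)%VF).
  move=> /(_ _ _ _ x Ux); rewrite !comp_lfunE; apply.
  - by apply: Uniso; rewrite eq_sym.
  - by move=> y Uy; rewrite comp_lfunE.
  - by move=> g y Gg Uy; apply: thkG.
pose x := \sum_j' c j' *: (vbasis {:F})`_j'.
have thE u : u \in U i -> th u = t u x.
  move=> Uu; rewrite [LHS]dec (bilin_sumr (tens_bilin tT)); apply: eq_bigr => j' _.
  by rewrite gcth // (bilinZl (tens_bilin tT)).
exists i, x; split=> [|u Uu]; last by rewrite -thE //; apply: (subvP SZ).
apply: contra nzk => /eqP x0; rewrite -/k.
have := thk _ (kapU i j s); rewrite (thE _ (kapU i j s)) x0 (bilin0r (tens_bilin tT)) linear0.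
by move=> <-.
Qed.

(** X_i consists of the y with U_i ⊗ y <= W. With complements Y_i of the X_i, T is the sum of all
    U_i ⊗ X_i and U_i ⊗ Y_i, so what W may have beyond the first sum shows up in its intersection Z
    with the second. If Z <> 0, it contains some U_i ⊗ y with y <> 0, and y lies in both X_i and
    Y_i. *)
Lemma stable_tensor_structure (W : {vspace T}) : stable GT W ->
  exists X : 'I_r -> {vspace F}, (forall i y, y \in X i <-> forall x, x \in U i -> t x y \in W) /\
    W = (\sum_i tensv t (U i) (X i))%VS.
Proof.
move=> sW; have /choice[f fE] := tens_lfunr.
pose X i := (\bigcap_(k < \dim (U i)) (f (vbasis (U i))`_k @^-1: W))%VS.
have XP i y : reflect (forall x, x \in U i -> t x y \in W) (y \in X i).
  apply: (iffP idP) => [Xy x /vbasis_spans[c ->]|h].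
    rewrite (bilin_suml (tens_bilin tT)); apply: memv_suml => k _; apply: rpredZ.
    have /subv_bigcapP/(_ k isT) : (<[y]> <= X i)%VS by [].
    by rewrite -memvE -memv_preim fE.
  rewrite memvE; apply/subv_bigcapP => k _; rewrite -memvE -memv_preim fE.
  by apply: h; apply: vbasis_memn.
exists X; split=> [i y|]; first by split=> [/XP//|]; move/XP.
pose W' := (\sum_i tensv t (U i) (X i))%VS.
have W'W : (W' <= W)%VS.
  by apply/subv_sumP => i _; apply: tensv_sub => x y Ux /XP; apply.
apply/eqP; rewrite eqEsubv W'W andbT.
have [pi [piU piS piuniq]] := proj_family Ufull Udir.
have piG i g x : G g -> pi i (g x) = g (pi i x).
  move=> Gg; apply: (piuniq (fun i => g (pi i x))) => [k|].
    by apply: stable_mem (Gg) (piU k x); case: (Uirr k).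
  by rewrite -linear_sum /= -piS.
pose Y i := (X i)^C%VS; pose pY i : 'End(F) := daddv_pi (Y i) (X i).
have XY i : (X i :&: Y i = 0)%VS by apply: capv_compl.
have YX i : (Y i :&: X i = 0)%VS by rewrite capvC.
have pYY i y : pY i y \in Y i by apply: memv_pi.
have pYX i y : y - pY i y \in X i.
  have yS : y \in (Y i + X i)%VS by rewrite addvC addv_complf memvf.
  by rewrite -{1}(daddv_pi_add (YX i) yS) addrC addKr memv_pi.
have bp : bilin (fun x y => \sum_i t (pi i x) (pY i y)).
  split=> [a x x' y|a x y y']; rewrite scaler_sumr -big_split; apply: eq_bigr => i _ /=.
    by rewrite linearP (tens_bilin tT).1.
  by rewrite linearP (tens_bilin tT).2.
have [p pE] := tens_univ tT bp.
pose Z0 := (\sum_i tensv t (U i) (Y i))%VS.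
have pZ u : p u \in Z0.
  have : u \in tensv t fullv fullv by rewrite tensv_full ?memvf.
  rewrite memv_preim; apply: tensv_ind => x y _ _; rewrite -memv_preim pE.
  apply: memv_sumr => i _; exact: (tensv_mem tT).
have pW u : u - p u \in W'.
  have -> : u - p u = (\1 - p)%VF u by rewrite add_lfunE opp_lfunE id_lfunE.
  have : u \in tensv t fullv fullv by rewrite tensv_full ?memvf.
  rewrite memv_preim; apply: tensv_ind => x y _ _; rewrite -memv_preim.
  rewrite add_lfunE opp_lfunE id_lfunE pE {1}(piS x).
  have -> : t (\sum_i pi i x) y = \sum_i t (pi i x) y.
    have [k kE] := tens_lfun y; rewrite -kE linear_sum; apply: eq_bigr => i _; exact: kE.
  rewrite -sumrB; apply: memv_sumr => i _.
  have -> : t (pi i x) y - t (pi i x) (pY i y) = t (pi i x) (y - pY i y).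
    by rewrite -!fE linearB.
  exact: (tensv_mem tT).
pose Z := (W :&: Z0)%VS.
have [Z00|nzZ] := eqVneq Z 0%VS.
  apply/subvP => u Wu; have Wpu : p u \in W.
    by rewrite -[p u](subKr u) rpredB //; apply: (subvP W'W).
  have : p u \in Z by rewrite memv_cap Wpu pZ.
  rewrite Z00 memv0 => /eqP pu0; by have := pW u; rewrite pu0 subr0.
have sZ : stable GT Z.
  move=> _ [g Gg <-]; apply/subvP => _ /memv_imgP[u Zu ->]; move: Zu.
  rewrite !memv_cap => /andP[Wu Z0u]; rewrite (stable_mem sW _ Wu) /=; last by exists g.
  move: Z0u; rewrite memv_preim; apply/subvP; apply/subv_sumP => i _.
  apply: tensv_sub => x y Ux Yy; rewrite -memv_preim AE.
  apply: (subvP (sumv_sup i isT (subvv _))); apply: (tensv_mem tT) => //.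
  by apply: stable_mem Gg Ux; case: (Uirr i).
have [i [y [nzy Zy]]] := stable_tensor_pure sZ nzZ.
have Xy : y \in X i by apply/XP => x /Zy; rewrite memv_cap => /andP[].
have : vpick (U i) != 0 by rewrite vpick0 -dimv_eq0 -lt0n; case: (Uirr i).
set x := vpick (U i) => nzx; have Ux : x \in U i by apply: memv_pick.
have nx0 : x \notin (0%VS : {vspace E}) by rewrite memv0.
have [phi _ phix] := functional_at nx0.
(* Contracting the first factor with a functional supported on U_i recovers y from x ⊗ y and sends
   the sum of the U_j ⊗ Y_j into Y_i. *)
have [g gE] := tens_contractl tT (phi \o pi i)%VF.
have piE j k z : z \in U j -> pi k z = if k == j then z else 0.
  move=> Uz; apply: (piuniq (fun k => if k == j then z else 0)).
    by move=> l; case: eqP => [->|_] //; apply: mem0v.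
  by rewrite (bigD1 j) //= eqxx big1 ?addr0 // => l /negPf ->.
have pii : pi i x = x by rewrite (piE i) ?eqxx.
move: nzy; rewrite -memv0 -(XY i) memv_cap Xy /=.
suff -> : y \in Y i by [].
have -> : y = g (t x y) by rewrite gE comp_lfunE pii phix scale1r.
have := Zy x Ux; rewrite memv_cap => /andP[_]; rewrite memv_preim; apply/subvP.
apply/subv_sumP => j _; apply: tensv_sub => x' y' Ux' Yy'.
rewrite -memv_preim gE comp_lfunE; case: (eqVneq j i) => [ji|ne].
  by apply: rpredZ; rewrite -ji.
by rewrite (piE j) // eq_sym (negPf ne) linear0 scale0r mem0v.
Qed.

Lemma stable_structure_stable (H : set 'End(F)) (A' : 'End(F) -> 'End(T)) (W : {vspace T})
    (X : 'I_r -> {vspace F}) :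
  (forall h x y, A' h (t x y) = t x (h y)) -> stable [set A' h | h in H] W ->
  (forall i y, y \in X i <-> forall x, x \in U i -> t x y \in W) ->
  forall i, stable H (X i).
Proof.
move=> A'E sW XP i h Hh; apply/subvP => _ /memv_imgP[y Xy ->]; apply/XP => x Ux.
by rewrite -A'E; apply: stable_mem sW _ ((XP i y).1 Xy x Ux); exists h.
Qed.

End StableTensor.

Lemma scale_is_tensor (K : fieldExtType rat) (E : vectType K) :
  is_tensor (fun (x : E) (c : K^o) => c *: x).
Proof.
split.
  split=> [a x x' y|a x y y']; first by rewrite scalerDr !scalerA mulrC.
  by rewrite scalerDl scalerA.
exists 'I_(\dim {:E}), unit, (fun i : 'I_(\dim {:E}) => (vbasis {:E})`_i), (fun _ => 1 : K^o).
have i1 : indep (fun _ : unit => 1 : K^o).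
  by move=> c; rewrite sum_unitE => e []; have := e; rewrite /GRing.scale /= mulr1.
have s1 : spans (fun _ : unit => 1 : K^o).
  by move=> x; exists (fun=> x); rewrite sum_unitE; rewrite /GRing.scale /= mulr1.
have sE : spans (fun i : 'I_(\dim {:E}) => (vbasis {:E})`_i).
  by move=> x; apply: vbasis_spans; apply: memvf.
have eq (c : 'I_(\dim {:E}) * unit -> K) :
    \sum_u c u *: ((1 : K^o) *: (vbasis {:E})`_u.1) = \sum_i c (i, tt) *: (vbasis {:E})`_i.
  transitivity (\sum_i \sum_(j : unit) c (i, j) *: ((1 : K) *: (vbasis {:E})`_i)).
    by rewrite pair_bigA; apply: eq_bigr; case.
  by apply: eq_bigr => i _; rewrite sum_unitE scale1r.
split; last by split=> //; apply: vbasis_indep.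
split=> //.
  by move=> c; rewrite eq => /(vbasis_indep (U:=fullv)) c0 [i []]; apply: (c0 i).
move=> x; have [c ->] := sE x; exists (fun u => c u.1); by rewrite eq.
Qed.

(** The structure theorem for E = E ⊗ K: each X_i is a subspace of a line, so it is 0 or
    everything. *)
Lemma stable_sum (K : fieldExtType rat) (E : vectType K) (G : set 'End(E)) r (U : 'I_r -> {vspace E}) :
  (forall i, absolutely_irreducible G (U i)) ->
  (forall i j, i != j -> ~ KG_isomorphic G (U i) (U j)) ->
  (\sum_i U i)%VS = fullv -> directv (\sum_i U i) ->
  forall W, stable G W -> exists S : {set 'I_r}, W = (\sum_(i in S) U i)%VS.
Proof.
move=> Uirr Uniso Ufull Udir W sW; have tT := scale_is_tensor E.
have sW' : stable [set id g | g in G] W by move=> _ [g Gg <-]; apply: sW.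
have [g x y|X [XP WE]] := @stable_tensor_structure K E K^o E _ tT G r U Uirr Uniso Ufull Udir id _ W sW'.
  by rewrite linearZ.
exists [set i | X i != 0%VS]%SET; rewrite {1}WE [RHS]big_mkcond /=; apply: eq_bigr => i _.
rewrite inE; case: eqVneq => [->|nzX]; first exact: tensv0r.
apply/eqP; rewrite eqEsubv; apply/andP; split.
  by apply: tensv_sub => x c Ux _; apply: rpredZ.
have /eqP X1 : X i == fullv.
  rewrite eqEdim subvf dimvf /= /dim /=; rewrite lt0n dimv_eq0 //.
apply/subvP => x Ux; rewrite -[x]scale1r; apply: (tensv_mem tT (x := x) (y := 1 : K^o)) => //.
by rewrite X1 memvf.
Qed.

(** * Volumes in a tensor product of lattices *)

Section PseudoBasisFamilies.
Context {K : fieldExtType rat}.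
Local Notation O := (@OK K).

Lemma OK_prod (I : Type) (s : seq I) (Q : pred I) (f : I -> K) :
  (forall i, Q i -> O (f i)) -> O (\prod_(i <- s | Q i) f i).
Proof. by move=> h; apply: big_ind => //; [exact: OK1 | exact: OKM]. Qed.

Lemma common_denom (I : finType) (Q : I -> K -> Prop) :
  (forall i, exists d, [/\ O d, d != 0 & Q i d]) ->
  (forall i u d, O u -> Q i d -> Q i (u * d)) ->
  exists d, [/\ O d, d != 0 & forall i, Q i d].
Proof.
move=> /choice[d dP] QM; exists (\prod_i d i); split.
- by apply: OK_prod => i _; case: (dP i).
- by apply/prodf_neq0 => i _; case: (dP i).
- move=> i; rewrite (bigD1 i) //= mulrC; apply: (QM); last by case: (dP i).
  by apply: OK_prod => j _; case: (dP j).
Qed.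

Lemma denom (x : K) : exists d, [/\ O d, d != 0 & O (d * x)].
Proof.
have [m nzm Om] := integral_multiple x; exists m%:~R; split=> //; first exact: OK_int.
by rewrite intr_eq0K.
Qed.

Variable E : vectType K.

Lemma pbasis_bounded N (I : finType) (a : I -> set K) (b : I -> E) :
  pbasis N a b -> bounded_mod N.
Proof.
move=> [fa _ ->] phi.
have [i|i u d Ou h c ac|d [Od nzd dP]] :=
  common_denom (Q := fun i d => forall c, a i c -> O (d * (c * phi (b i)))).
- have [_ _ [d [Od nzd da]]] := fa i; have [e [Oe nze eb]] := denom (phi (b i)).
  exists (d * e); split; [exact: OKM | by rewrite mulf_neq0 |].
  by move=> c ac; rewrite mulrACA; apply: OKM => //; apply: da.
- by rewrite -mulrA; apply: OKM => //; apply: h.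
exists d; split=> // _ [c ac ->]; rewrite linear_sum mulr_sumr; apply: OK_sum => i _.
by rewrite linearZ; apply: dP.
Qed.

Lemma pbasis_dense N (I : finType) (a : I -> set K) (b : I -> E) :
  pbasis N a b -> forall x, x \in fspan b -> exists d, [/\ O d, d != 0 & N (d *: x)].
Proof.
move=> [fa _ ->] x /fspanP[c ->].
have [i|i u d Ou h|d [Od nzd dP]] := common_denom (Q := fun i d => a i (d * c i)).
- have [[_ _ aM] [y ay nzy] _] := fa i; have [e [Oe nze ec]] := denom (c i * y^-1).
  have [_ _ [D [OD nzD aD]]] := fa i.
  exists (e * (D * y)); split; [by apply: OKM => //; apply: aD | by rewrite !mulf_neq0 |].
  have -> : e * (D * y) * c i = (D * y) * y * (e * (c i * y^-1)).
    by rewrite -{1}(divfK nzy (c i)) mulrACA mulrC.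
  by rewrite mulrC; apply: (aM) => //; apply: aM => //; apply: aD.
- by rewrite -mulrA; have [[_ _ aM] _ _] := fa i; apply: aM.
exists d; split=> //; exists (fun i => d * c i) => //.
by rewrite scaler_sumr; apply: eq_bigr => i _; rewrite scalerA.
Qed.

Lemma extend_coords (I J : finType) (f : J -> I) (c : J -> K) : injective f ->
  exists c' : I -> K, [/\ forall j, c' (f j) = c j, forall i, c' i = 0 \/ exists j, i = f j &
    forall b : I -> E, \sum_i c' i *: b i = \sum_j c j *: b (f j)].
Proof.
move=> fI; pose c' i := if [pick j | f j == i] is Some j then c j else 0.
have c'f j : c' (f j) = c j.
  by rewrite /c'; case: pickP => [k /eqP/fI ->//|/(_ j)]; rewrite eqxx.
exists c'; split=> // [i|b].
  by rewrite /c'; case: pickP => [j /eqP <-|_]; [right; exists j | left].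
rewrite (bigID (mem [set f j | j in {: J}]%SET)) /= [X in _ + X]big1 ?addr0.
  rewrite big_imset /=; last by move=> j k _ _; apply: fI.
  by apply: eq_bigr => j _; rewrite c'f.
move=> i ni; rewrite /c'; case: pickP => [j /eqP ji|_]; last exact: scale0r.
by case/negP: ni; apply/imsetP; exists j.
Qed.

(** Lets one pseudo-basis of the whole lattice compute the volumes of all the subspaces spanned by
    parts of it. *)
Lemma pbasis_restrict N (I J : finType) (f : J -> I) (a : I -> set K) (b : I -> E) :
  injective f -> pbasis N a b -> pbasis (inter N (fspan (b \o f))) (a \o f) (b \o f).
Proof.
move=> fI [fa ib ->]; split=> [j|c e j|]; first exact: fa.
  have [c' [c'f _ c's]] := extend_coords c fI.
  by rewrite -c'f; apply: ib; rewrite c's.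
apply/seteqP; split=> [x [[c ac xc] /fspanP[d xd]]|x [c ac xE]].
  have [d' [d'f _ d's]] := extend_coords d fI; exists d => // j.
  have : c =1 d' by apply: (indep_coord_uniq ib); rewrite -xc d's.
  by rewrite /= -d'f => <-.
split; last by apply/fspanP; exists c.
have [c' [c'f c'0 c's]] := extend_coords c fI; exists c'; last by rewrite c's.
move=> i; case: (c'0 i) => [->|[j ->]]; first by have [[]] := fa i.
by rewrite c'f; apply: ac.
Qed.

Lemma indep_restrict (I J : finType) (f : J -> I) (b : I -> E) : injective f ->
  indep b -> indep (b \o f).
Proof.
move=> fI ib c e j; have [c' [c'f _ c's]] := extend_coords c fI.
by rewrite -c'f; apply: ib; rewrite c's.
Qed.

End PseudoBasisFamilies.

Section TensorLattice.
Context {R : realType} {K : fieldExtType rat} {P : finType}.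
Variable sigma : P -> {rmorphism K -> R[i]}.
Hypothesis places : infinite_places sigma.
Variables (E F T : vectType K) (t : E -> F -> T).
Hypothesis tT : is_tensor t.
Variables (h : P -> E -> E -> R[i]) (h' : P -> F -> F -> R[i]) (hT : P -> T -> T -> R[i]).
Hypothesis hpos : forall p, pos_def_hermitian (sigma p) (h p).
Hypothesis hpos' : forall p, pos_def_hermitian (sigma p) (h' p).
Hypothesis hposT : forall p, pos_def_hermitian (sigma p) (hT p).
Hypothesis hTE : forall p x x' y y', hT p (t x y) (t x' y') = h p x x' * h' p y y'.

Definition tens_set (N : set E) (N' : set F) : set T :=
  [set u | exists2 s : seq (E * F), (forall z, z \in s -> N z.1 /\ N' z.2) &
     u = \sum_(z <- s) t z.1 z.2].

Lemma tens_set_pure N N' x y : N x -> N' y -> tens_set N N' (t x y).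
Proof.
move=> Nx Ny; exists [:: (x, y)]; last by rewrite big_seq1.
by move=> z; rewrite inE => /eqP ->.
Qed.

Lemma tens_set0 N N' : tens_set N N' 0.
Proof. by exists [::]; rewrite ?big_nil. Qed.

Lemma tens_setD N N' u v : tens_set N N' u -> tens_set N N' v -> tens_set N N' (u + v).
Proof.
move=> [s sP ->] [s' s'P ->]; exists (s ++ s'); last by rewrite big_cat.
by move=> z; rewrite mem_cat => /orP[/sP|/s'P].
Qed.

Lemma tens_set_sum N N' (I : Type) (s : seq I) (f : I -> T) :
  (forall i, tens_set N N' (f i)) -> tens_set N N' (\sum_(i <- s) f i).
Proof.
move=> hf; elim: s => [|i s IH]; first by rewrite big_nil; apply: tens_set0.
by rewrite big_cons; apply: tens_setD.
Qed.

Lemma submod_tens N N' : OK_submodule N -> OK_submodule (tens_set N N').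
Proof.
move=> [N0 ND NM]; split; [exact: tens_set0 | by move=> u v; apply: tens_setD |].
move=> a _ Oa [s sP ->]; exists [seq (a *: z.1, z.2) | z <- s].
  by move=> _ /mapP[z /sP[Nz N'z] ->]; split=> //; apply: NM.
rewrite big_map scaler_sumr; apply: eq_bigr => z _.
by rewrite (bilinZl (tens_bilin tT)).
Qed.

Lemma pbasis_tens N N' (I J : finType) (a : I -> set K) (b : I -> E)
    (a' : J -> set K) (b' : J -> F) : pbasis N a b -> pbasis N' a' b' ->
  pbasis (tens_set N N') (fun u : I * J => ideal_mul (a u.1) (a' u.2))
    (fun u : I * J => t (b u.1) (b' u.2)).
Proof.
move=> pN pN'; have [fa ib DN] := pN; have [fa' ib' DN'] := pN'.
split=> [u||]; [exact: frac_mul | exact (tens_indep tT ib ib') |].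
have fm (u : I * J) : fractional_ideal (ideal_mul (a u.1) (a' u.2)) by apply: frac_mul.
apply/seteqP; split=> [_ [s sP ->]|_ [c cP ->]].
  elim: s sP => [|z s IH] sP.
    exists (fun=> 0); first by move=> u; have [[]] := fm u.
    by rewrite big_nil big1 // => u _; rewrite scale0r.
  have [|d dP e] := IH; first by move=> w ws; apply: sP; rewrite inE ws orbT.
  have [] : N z.1 /\ N' z.2 by apply: sP; rewrite inE eqxx.
  rewrite {1}DN {1}DN' => -[c ac zc] [c' ac' zc'].
  exists (fun u => c u.1 * c' u.2 + d u).
    move=> u; have [[_ mD _] _ _] := fm u; apply: mD => //.
    exact: ideal_mul_mem.
  rewrite big_cons e zc zc' (bilin_sum (tens_bilin tT)) -big_split.
  by apply: eq_bigr => u _; rewrite scalerDl.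
apply: tens_set_sum => u; have [s sP ->] := cP u.
rewrite scaler_suml big_seq; apply: (big_ind (tens_set N N')).
- exact: tens_set0.
- by move=> x y; apply: tens_setD.
move=> w /sP[aw a'w].
have -> : (w.1 * w.2) *: t (b u.1) (b' u.2) = t (w.1 *: b u.1) (w.2 *: b' u.2).
  by rewrite (bilinZl (tens_bilin tT)) (bilinZr (tens_bilin tT)) scalerA.
exact: tens_set_pure (pbasis_mem pN aw) (pbasis_mem pN' a'w).
Qed.

Lemma hvol_tens (I J : finType) (b : I -> E) (b' : J -> F) : indep b -> indep b' ->
  hvol sigma hT (fun u : I * J => t (b u.1) (b' u.2)) =
  hvol sigma h b ^+ #|J| * hvol sigma h' b' ^+ #|I|.
Proof.
move=> ib ib'; rewrite /hvol -!prodrXl -big_split; apply: eq_bigr => p _ /=.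
have d0 := hdet_gt0 hpos p ib; have d0' := hdet_gt0 hpos' p ib'.
have -> : hdet hT p (fun u : I * J => t (b u.1) (b' u.2)) =
    hdet h p b ^+ #|J| * hdet h' p b' ^+ #|I|.
  by rewrite /hdet -fdet_tens; apply: eq_fdet => u v; rewrite hTE.
have ReX (z : R[i]) n : 0 < z -> complex.Re (z ^+ n) = complex.Re z ^+ n.
  move=> z0; elim: n => [|n IH]; first by rewrite !expr0.
  by rewrite !exprS Re_mulr ?IH ?exprn_ge0 // ltW.
rewrite Re_mulr ?exprn_ge0 ?ltW // !ReX // powRM ?exprn_ge0 ?ltW ?Re_gt0 //.
have powX (x y : R) n : 0 < x -> (x ^+ n) `^ y = (x `^ y) ^+ n.
  move=> x0; elim: n => [|n IH]; first by rewrite !expr0 powR1.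
  by rewrite !exprS powRM ?IH ?exprn_ge0 ?ltW.
by rewrite !powX ?Re_gt0.
Qed.

Variables (L : set E) (M : set F).
Hypotheses (lL : full_lattice L) (lM : full_lattice M).
Local Notation LT := (tens_set L M).

Lemma pbasis_spans (V : vectType K) (N : set V) (I : finType) (a : I -> set K) (b : I -> V) :
  full_lattice N -> pbasis N a b -> spans b.
Proof.
move=> [_ _ dN] [_ _ DN] x; have [d nzd] := dN x; rewrite DN => -[c _ e].
exists (fun i => d^-1 * c i); rewrite -[LHS](scalerK nzd) e scaler_sumr.
by apply: eq_bigr => i _; rewrite scalerA.
Qed.

Lemma full_tens : full_lattice LT.
Proof.
have [sL bL _] := lL; have [sM bM _] := lM.
have [I [a [b pL]]] := pbasis_exists sL bL.
have [J [a' [b' pM]]] := pbasis_exists sM bM.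
have pT := pbasis_tens pL pM.
split; [exact: submod_tens | exact: pbasis_bounded pT |].
move=> x; have sT := tens_spans tT (pbasis_spans lL pL) (pbasis_spans lM pM).
have [d [_ nzd Td]] := pbasis_dense pT (introT (fspanP _ _) (sT x)).
by exists d.
Qed.

Lemma adapted_pbasis (V : vectType K) (N : set V) (U : {vspace V}) : full_lattice N ->
  exists (I : finType) (a : I -> set K) (b : I -> V) (J : finType) (a' : J -> set K) (b' : J -> V),
    pbasis (inter N U) a b /\ pbasis N (sumf a a') (sumf b b').
Proof.
move=> lN; have [sN bN _] := lN; have [I [a [b pU]]] := inter_pbasis_exists lN U.
have [J [a' [b' pN]]] := pbasis_extend sN bN pU.
by exists I, a, b, J, a', b'.
Qed.

Lemma tensv_fspan (I J : finType) (b : I -> E) (b' : J -> F) :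
  tensv t (fspan b) (fspan b') = fspan (fun u : I * J => t (b u.1) (b' u.2)).
Proof.
apply/eqP; rewrite eqEsubv; apply/andP; split.
  apply: tensv_sub => _ _ /fspanP[c ->] /fspanP[d ->]; rewrite (bilin_sum (tens_bilin tT)).
  apply: memv_suml => u _; apply: rpredZ.
  exact: (fspan_mem (fun u : I * J => t (b u.1) (b' u.2))).
by apply: fspan_sub => u; apply: (tensv_mem tT); apply: fspan_mem.
Qed.

(** Pseudo-bases adapted to A and to B are tensored; the pairs from A and B give a pseudo-basis of
    the intersection of the tensor lattice with A ⊗ B. *)
Lemma vol_inter_tens (A : {vspace E}) (B : {vspace F}) :
  vol_inter sigma hT LT (tensv t A B) = vol_inter sigma h L A ^+ \dim B * vol_inter sigma h' M B ^+ \dim A.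
Proof.
have [I [a [b [I1 [a1 [b1 [pA pL]]]]]]] := adapted_pbasis A lL.
have [J [a' [b' [J1 [a1' [b1' [pB pM]]]]]]] := adapted_pbasis B lM.
have pT := pbasis_tens pL pM.
have fI : injective (fun u : I * J => (inl u.1, inl u.2) : (I + I1) * (J + J1)).
  by move=> [i j] [k l] [-> ->].
have := pbasis_restrict fI pT.
set f := (fun u : I * J => (inl u.1, inl u.2) : (I + I1) * (J + J1)).
have -> : fspan ((fun u : (I + I1) * (J + J1) => t (sumf b b1 u.1) (sumf b' b1' u.2)) \o f) = tensv t A B.
  by rewrite -(pbasis_fspan lL pA) -(pbasis_fspan lM pB) tensv_fspan.
move=> pAB; have [fa ib _] := pA; have [fa' ib' _] := pB.
rewrite /vol_inter (volE places hposT pAB) (volE places hpos pA) (volE places hpos' pB) /pvol /=.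
rewrite (hvol_tens ib ib') -(pbasis_card lL pA) -(pbasis_card lM pB) !exprMn mulrACA; congr (_ * _).
rewrite -!prodrXl.
transitivity (\prod_i \prod_j (ideal_norm R (a i) * ideal_norm R (a' j))).
  by rewrite pair_bigA; apply: eq_bigr => u _; apply: ideal_norm_mul.
under eq_bigr => i _ do rewrite big_split prodr_const.
by rewrite big_split /=; congr (_ * _); rewrite prodr_const -prodrXl.
Qed.

End TensorLattice.

(** * Equality in Koteljanskii's inequality through orthogonal projections *)

Section ModularVolumes.
Context {R : realType} {K : fieldExtType rat} {P : finType}.
Variable sigma : P -> {rmorphism K -> R[i]}.
Variables (E : vectType K) (h : P -> E -> E -> R[i]).
Hypothesis hpos : forall p, pos_def_hermitian (sigma p) (h p).

(** X holds the coefficients of the orthogonal projection of b1 onto the complex span of b0; the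
    second condition says that the remainder is also orthogonal to b2. *)
Lemma hvol_modular_coeff (I0 I1 I2 : finType) (b0 : I0 -> E) (b1 : I1 -> E) (b2 : I2 -> E) :
  indep (sumf b0 (sumf b1 b2)) ->
  (forall p, exists X : I1 -> I0 -> R[i],
    (forall i k, h p (b1 i) (b0 k) = \sum_l X i l * h p (b0 l) (b0 k)) /\
    (forall i k, h p (b1 i) (b2 k) = \sum_l X i l * h p (b0 l) (b2 k))) ->
  hvol sigma h b0 * hvol sigma h (sumf b0 (sumf b1 b2)) =
  hvol sigma h (sumf b0 b1) * hvol sigma h (sumf b0 b2).
Proof.
move=> ib hX; apply: (hvol_modular hpos ib) => p; have [X [X0 X2]] := hX p.
have ib0 : indep b0 by apply: (indep_restrict (f := inl) _ ib) => x y [].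
have -> : hmx h p b1 b0 = fmx X *m hmx h p b0 b0.
  by rewrite fmx_mul; apply: eq_fmx => i k; apply: X0.
rewrite mulmxK; last exact: posdef_unit (hmx_posdef hpos p ib0).
by rewrite fmx_mul; apply: eq_fmx => i k; apply: X2.
Qed.

Lemma gram_solve p (I0 I1 : finType) (b0 : I0 -> E) (b1 : I1 -> E) : indep b0 ->
  exists X : I1 -> I0 -> R[i],
    forall i k, h p (b1 i) (b0 k) = \sum_l X i l * h p (b0 l) (b0 k).
Proof.
move=> ib0; pose N := hmx h p b1 b0 *m invmx (hmx h p b0 b0).
pose X i k := N (enum_rank i) (enum_rank k); exists X => i k.
have NX : N = fmx X by apply/matrixP => u v; rewrite [RHS]mxE /X !enum_valK.
have e : hmx h p b1 b0 = fmx X *m hmx h p b0 b0.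
  by rewrite -NX mulmxKV //; apply: posdef_unit (hmx_posdef hpos p ib0).
rewrite fmx_mul in e; have := congr1 (fun A : 'M_(_, _) => A (enum_rank i) (enum_rank k)) e.
by rewrite /hmx !mxE !enum_rankK.
Qed.

Lemma sumf_comp (I J L : Type) (X : Type) (b : L -> X) (f : I -> L) (g : J -> L) :
  sumf (b \o f) (b \o g) = b \o sumf f g.
Proof. by apply/funext => -[]. Qed.

Lemma fspan_sumf (I J : finType) (b : I -> E) (c : J -> E) :
  fspan (sumf b c) = (fspan b + fspan c)%VS.
Proof. by rewrite /fspan big_sumType. Qed.

Lemma sum_delta (C : comPzRingType) (I J : finType) (Y A : I -> C) (B : J -> C) j :
  \sum_(u : I * J) Y u.1 * (u.2 == j)%:R * (A u.1 * B u.2) = (\sum_i Y i * A i) * B j.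
Proof.
transitivity (\sum_i \sum_k Y i * (k == j)%:R * (A i * B k)).
  by rewrite pair_bigA.
rewrite mulr_suml; apply: eq_bigr => i _; rewrite (bigD1 j) //= eqxx mulr1 big1 ?addr0 ?mulrA //.
by move=> k /negPf ->; rewrite mulr0 mul0r.
Qed.

End ModularVolumes.

(** * The lower bound for A ⊗ V1 + B ⊗ V2 *)

Section TensorBound.
Context {R : realType} {K : fieldExtType rat} {P : finType}.
Variable sigma : P -> {rmorphism K -> R[i]}.
Hypothesis places : infinite_places sigma.
Variables (E F T : vectType K) (t : E -> F -> T).
Hypothesis tT : is_tensor t.
Variables (h : P -> E -> E -> R[i]) (h' : P -> F -> F -> R[i]) (hT : P -> T -> T -> R[i]).
Hypothesis hpos : forall p, pos_def_hermitian (sigma p) (h p).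
Hypothesis hpos' : forall p, pos_def_hermitian (sigma p) (h' p).
Hypothesis hposT : forall p, pos_def_hermitian (sigma p) (hT p).
Hypothesis hTE : forall p x x' y y', hT p (t x y) (t x' y') = h p x x' * h' p y y'.
Variables (L : set E) (M : set F).
Hypotheses (lL : full_lattice L) (lM : full_lattice M).
Local Notation LT := (tens_set t L M).

Lemma spans_full (V : vectType K) (I : finType) (b : I -> V) : spans b -> fspan b = fullv.
Proof.
by move=> sb; apply/vspaceP => x; rewrite memvf; have [c ->] := sb x; apply/fspanP; exists c.
Qed.

(** The families g0, g1, g2 span B ⊗ V1, B1 ⊗ V1 and B ⊗ C, with B1 and C complements of B and V1.
    Projecting b1 ⊗ v onto B ⊗ V1 only projects b1 onto B; the remainder is orthogonal to all of B ⊗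
    F, which is the equality case. *)
Lemma vol_inter_tens_modular (B : {vspace E}) (V1 : {vspace F}) :
  vol_inter sigma hT LT (tensv t B V1) * vol_inter sigma hT LT (tensv t fullv V1 + tensv t B fullv) =
  vol_inter sigma hT LT (tensv t fullv V1) * vol_inter sigma hT LT (tensv t B fullv).
Proof.
have [I [a [b [I1 [a1 [b1 [pB pL]]]]]]] := adapted_pbasis B lL.
have [J [a' [v [J1 [a1' [c [pV pM]]]]]]] := adapted_pbasis V1 lM.
have pT := pbasis_tens tT pL pM; move: pT.
set aT := (fun u : (I + I1) * (J + J1) => _); set bT := (fun u : (I + I1) * (J + J1) => t _ _).
move=> pT; have [_ ibT _] := pT.
pose g0 (u : I * J) : (I + I1) * (J + J1) := (inl u.1, inl u.2).
pose g1 (u : I1 * J) : (I + I1) * (J + J1) := (inr u.1, inl u.2).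
pose g2 (u : I * J1) : (I + I1) * (J + J1) := (inl u.1, inr u.2).
have inj3 : injective (sumf g0 (sumf g1 g2)).
  by move=> [[i j]|[[i j]|[i j]]] [[k l]|[[k l]|[k l]]] //= [-> ->].
have inj0 : injective g0 by move=> [i j] [k l] [-> ->].
have inj01 : injective (sumf g0 g1) by move=> [[i j]|[i j]] [[k l]|[k l]] //= [-> ->].
have inj02 : injective (sumf g0 g2) by move=> [[i j]|[i j]] [[k l]|[k l]] //= [-> ->].
have fB := pbasis_fspan lL pB; have fV := pbasis_fspan lM pV.
have fE := spans_full (pbasis_spans lL pL); have fF := spans_full (pbasis_spans lM pM).
have s0 : fspan (bT \o g0) = tensv t B V1 by rewrite -fB -fV (tensv_fspan tT).
have s1 : fspan (bT \o g1) = tensv t (fspan b1) V1 by rewrite -fV (tensv_fspan tT).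
have s2 : fspan (bT \o g2) = tensv t B (fspan c) by rewrite -fB (tensv_fspan tT).
have s01 : fspan (bT \o sumf g0 g1) = tensv t fullv V1.
  by rewrite -sumf_comp fspan_sumf s0 s1 -(tensvDl tT) -fB -fspan_sumf fE.
have s02 : fspan (bT \o sumf g0 g2) = tensv t B fullv.
  by rewrite -sumf_comp fspan_sumf s0 s2 -(tensvDr tT) -fV -fspan_sumf fF.
have s012 : fspan (bT \o sumf g0 (sumf g1 g2)) = (tensv t fullv V1 + tensv t B fullv)%VS.
  rewrite -s01 -s02 -!sumf_comp !fspan_sumf.
  move: (fspan (bT \o g0)) (fspan (bT \o g1)) (fspan (bT \o g2)) => X0 X1 X2.
  by rewrite (addvC X0 X2) [RHS]addvA [RHS]addvC -[(X0 + X1 + X2)%VS]addvA [RHS]addvA addvv.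
have p0 := pbasis_restrict inj0 pT; have p01 := pbasis_restrict inj01 pT.
have p02 := pbasis_restrict inj02 pT; have p012 := pbasis_restrict inj3 pT.
rewrite s0 in p0; rewrite s01 in p01; rewrite s02 in p02; rewrite s012 in p012.
rewrite /vol_inter (volE places hposT p0) (volE places hposT p01) (volE places hposT p02).
rewrite (volE places hposT p012) /pvol !big_sumType /=.
have ib := indep_restrict inj3 ibT; rewrite -!sumf_comp in ib *.
have [_ ib0 _] := pB.
have eqv : hvol sigma hT (bT \o g0) * hvol sigma hT (sumf (bT \o g0) (sumf (bT \o g1) (bT \o g2))) =
    hvol sigma hT (sumf (bT \o g0) (bT \o g1)) * hvol sigma hT (sumf (bT \o g0) (bT \o g2)).
  apply: (hvol_modular_coeff hposT ib) => p.
  have [Y YE] := gram_solve hpos p b1 ib0.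
  (* The projection coefficients of the first factor, times the identity on the indices of V1. *)
  exists (fun u w => Y u.1 w.1 * (w.2 == u.2)%:R); split=> -[i j] [k l].
    rewrite [LHS]hTE [in LHS]/= YE.
    rewrite -(sum_delta (Y i) (fun m => h p (b m) (b k)) (fun m => h' p (v m) (v l)) j).
    by apply: eq_bigr => w _; rewrite hTE.
  rewrite [LHS]hTE [in LHS]/= YE.
  rewrite -(sum_delta (Y i) (fun m => h p (b m) (b k)) (fun m => h' p (v m) (c l)) j).
  by apply: eq_bigr => w _; rewrite hTE.
set n0 := \prod_i ideal_norm R (aT (g0 i)); set n1 := \prod_i ideal_norm R (aT (g1 i)).
set n2 := \prod_i ideal_norm R (aT (g2 i)).
rewrite mulrACA [RHS]mulrACA eqv; congr (_ * _).
move: (n0) (n1) (n2) => x y z; by lra.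
Qed.

Lemma ln_vol_inter_tens (Y : {vspace E}) (Z : {vspace F}) : ln (vol_inter sigma hT LT (tensv t Y Z)) =
  ln (vol_inter sigma h L Y) * (\dim Z)%:R + ln (vol_inter sigma h' M Z) * (\dim Y)%:R.
Proof.
have LV : 0 < vol_inter sigma h L Y by apply: vol_inter_gt0.
have MV : 0 < vol_inter sigma h' M Z by apply: vol_inter_gt0.
rewrite (vol_inter_tens places tT hpos hpos' hposT hTE lL lM) lnM ?posrE ?exprn_gt0 //.
by rewrite !lnXn // !mulr_natr.
Qed.

(** Dimension count for A = B = E, which contains the general case. *)
Lemma tensv_disjoint (V1 V2 : {vspace F}) (A B : {vspace E}) : (V1 :&: V2 = 0)%VS ->
  (tensv t A V1 :&: tensv t B V2 = 0)%VS.
Proof.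
move=> V12; have d : (\dim (tensv t fullv V1 :&: tensv t fullv V2) = 0)%N.
  have := dimv_sum_cap (tensv t fullv V1) (tensv t fullv V2).
  rewrite -(tensvDr tT) !(dim_tensv tT) -mulnDr -(dimv_sum_cap V1 V2) V12 dimv0 addn0 => /eqP.
  by rewrite -[X in _ == X]addn0 eqn_add2l => /eqP.
apply/eqP; rewrite -subv0; move/eqP: d; rewrite dimv_eq0 => /eqP <-.
by apply: capvS; apply: tensvS; rewrite ?subvv ?subvf.
Qed.

Variables (l m : R).
Hypothesis lmin : forall A, l * (\dim A)%:R <= ln (vol_inter sigma h L A).
Hypothesis mmin : forall B, m * (\dim B)%:R <= ln (vol_inter sigma h' M B).

Lemma vol_inter_tens_bound (V1 V2 : {vspace F}) (A B : {vspace E}) :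
  (V1 + V2 = fullv)%VS -> (V1 :&: V2 = 0)%VS ->
  (l + m) * (\dim (tensv t A V1 + tensv t B V2))%:R <= ln (vol_inter sigma hT LT (tensv t A V1 + tensv t B V2)).
Proof.
wlog ab : V1 V2 A B / (\dim B <= \dim A)%N.
  move=> th V12 V0; case: (leqP (\dim B) (\dim A)) => [|/ltnW] ba; first exact: th.
  by rewrite addvC; apply: th => //; rewrite ?(addvC V2) ?(capvC V2).
move=> V12 V0; set W := (_ + _)%VS; set X := tensv t fullv V1.
have lT := full_tens tT lL lM.
have A1X : (tensv t A V1 <= X)%VS by apply: tensvS; rewrite ?subvv ?subvf.
have WX : (W :&: X)%VS = tensv t A V1.
  rewrite -vspace_modl // capvC tensv_disjoint // addv0 //.
have WpX : (W + X)%VS = (X + tensv t B fullv)%VS.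
  rewrite -V12 (tensvDr tT) /W addvC addvA [RHS]addvA.
  have /addv_idPl -> : (tensv t A V1 <= X)%VS by [].
  by have /addv_idPl -> : (tensv t B V1 <= X)%VS by apply: tensvS; rewrite ?subvv ?subvf.
have := vol_inter_submodular places hposT lT W X; rewrite WX WpX => sub.
have mod := vol_inter_tens_modular B V1; rewrite -/X in mod.
have Vpos Z : 0 < vol_inter sigma hT LT Z by apply: vol_inter_gt0.
have lsub : ln (vol_inter sigma hT LT (tensv t A V1)) + ln (vol_inter sigma hT LT (X + tensv t B fullv)) <=
    ln (vol_inter sigma hT LT W) + ln (vol_inter sigma hT LT X).
  by rewrite -!lnM ?posrE // ler_ln ?posrE ?mulr_gt0.
have lmod : ln (vol_inter sigma hT LT (tensv t B V1)) + ln (vol_inter sigma hT LT (X + tensv t B fullv)) =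
    ln (vol_inter sigma hT LT X) + ln (vol_inter sigma hT LT (tensv t B fullv)).
  by rewrite -!lnM ?posrE // mod.
have lt1 := ln_vol_inter_tens.
have dW : \dim W = (\dim A * \dim V1 + \dim B * \dim V2)%N.
  by rewrite dimv_disjoint_sum ?tensv_disjoint // !(dim_tensv tT).
have dF : \dim {:F} = (\dim V1 + \dim V2)%N by rewrite -V12 dimv_disjoint_sum.
have dFR : (\dim {:F})%:R = (\dim V1)%:R + (\dim V2)%:R :> R by rewrite dF natrD.
have dWR : (\dim W)%:R = (\dim A)%:R * (\dim V1)%:R + (\dim B)%:R * (\dim V2)%:R :> R.
  by rewrite dW natrD !natrM.
rewrite (lt1 A V1) in lsub; rewrite (lt1 B V1) (lt1 B fullv) dFR in lmod; rewrite dWR.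
have := lmin A; have := lmin B; have := mmin V1; have := mmin fullv; rewrite dFR.
have ba : (\dim B)%:R <= (\dim A)%:R :> R by rewrite ler_nat.
move: lsub lmod ba (ler0n R (\dim B)) (ler0n R (\dim V1)) (ler0n R (\dim V2)).
move: (\dim A)%:R (\dim B)%:R (\dim V1)%:R (\dim V2)%:R => a b d1 d2.
move: (ln (vol_inter sigma h L A)) (ln (vol_inter sigma h L B)) (ln (vol_inter sigma h' M V1)) (ln (vol_inter sigma h' M fullv)).
move: (ln (vol_inter sigma hT LT W)) (ln (vol_inter sigma hT LT X)) (ln (vol_inter sigma hT LT _)).
move=> w x S fA fB f1 fF lsub lmod ba b0 d10 d20 hF h1 hB hA.
(* The bounds for A, B, F and V1 are multiplied by dim V1, dim V2, dim B and dim A - dim B; what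
   remains is linear. *)
have a1 := ler_wpM2r d10 hA; have a2 := ler_wpM2r d20 hB; have a3 := ler_wpM2r b0 hF.
have ba0 : 0 <= a - b by rewrite subr_ge0.
have a4 := ler_wpM2r ba0 h1.
by lra.
Qed.

End TensorBound.

(** * Slopes *)

Section Slopes.
Context {R : realType} {K : fieldExtType rat} {P : finType}.
Variable sigma : P -> {rmorphism K -> R[i]}.
Hypothesis places : infinite_places sigma.
Local Notation O := (@OK K).
Variables (E : vectType K) (h : P -> E -> E -> R[i]).
Hypothesis hpos : forall p, pos_def_hermitian (sigma p) (h p).

(** L is generated over O_K by the images under g of the unit vectors, so a common denominator of n
    values of phi suffices. *)
Lemma fg_projective_bounded (L : set E) : fg_projective L -> bounded_mod L.
Proof.
move=> [n [f [g]]] /= [fL gL fl gl gf] phi.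
pose e i : 'rV[K]_n := delta_mx 0 i.
have Oe i j : O (e i 0 j) by rewrite mxE eqxx; case: (j == i); [exact: OK1 | exact: OK0].
have O0 : forall j, O ((0 : 'rV[K]_n) 0 j) by move=> j; rewrite mxE; apply: OK0.
have g0 : g 0 = 0.
  have := gl 1 0 0 (OK1 K) O0 O0; rewrite scaler0 addr0 scale1r => /eqP.
  by rewrite -subr_eq0 opprD addNKr oppr_eq0 => /eqP.
have gsum (s : seq 'I_n) (c : 'I_n -> K) : (forall i, O (c i)) ->
    (forall j, O ((\sum_(i <- s) c i *: e i) 0 j)) /\
    g (\sum_(i <- s) c i *: e i) = \sum_(i <- s) c i *: g (e i).
  move=> Oc; elim: s => [|i s [IH1 IH2]]; first by rewrite !big_nil.
  rewrite !big_cons; split=> [j|]; last by rewrite gl // IH2.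
  by rewrite mxE mxE; apply: OKD => //; apply: OKM.
have [i|i u d Ou h'|d [Od nzd dP]] := common_denom (Q := fun i d => O (d * phi (g (e i)))).
- exact: denom.
- by rewrite -mulrA; apply: OKM.
exists d; split=> // x Lx; have Of := fL x Lx.
have [_ e1] := gsum (index_enum 'I_n) (fun i => f x 0 i) Of.
rewrite -(gf x Lx) [f x]row_sum_delta e1 linear_sum mulr_sumr; apply: OK_sum => i _.
by have := OKM (Of i) (dP i); rewrite mulrCA linearZ.
Qed.

Lemma OK_lattice_full (L : set E) : OK_lattice sigma L h -> full_lattice L.
Proof.
move=> [sL pL [b bb bL] _]; split=> [//||x]; first exact: fg_projective_bounded.
have [L0 LD LM] := sL.
have [i|i u d Ou h'|d [Od nzd dP]] :=
  common_denom (Q := fun (i : 'I_(size b)) d => O (d * coord (in_tuple b) i x)).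
- exact: denom.
- by rewrite -mulrA; apply: OKM.
exists d => //; have xb : x \in <<in_tuple b>>%VS by rewrite (span_basis bb) memvf.
rewrite (coord_span xb) scaler_sumr; apply: submodE_sum => // i _.
by rewrite scalerA; apply: LM => //; apply/bL/mem_nth.
Qed.

Section Lattice.
Variable L : set E.
Hypothesis lL : full_lattice L.
Local Notation VL := (vol_inter sigma h L).

Lemma sublattice_inter (U : {vspace E}) : sublattice L (inter L U).
Proof.
split; [exact: submod_interL | by move=> x [] |].
move=> a x Oa nza Lx [_ Uax]; split=> //.
by have := rpredZ a^-1 Uax; rewrite scalerA mulVf // scale1r.
Qed.

(** An element of L in the K-span of N has a nonzero integral multiple in N, and purity brings it
    back into N. So sublattices correspond to subspaces of E. *)
Lemma sublatticeE N : sublattice L N -> N = inter L (Kspan N).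
Proof.
move=> [sN NL pN]; have [NK _] := Kspan_spec N; have [_ bL _] := lL.
apply/seteqP; split=> [x Nx|x [Lx Kx]]; first by split; [apply: NL | apply: NK].
have [I [a [b pb]]] := pbasis_exists sN (bounded_sub NL bL).
rewrite (pbasis_Kspan pb) in Kx; have [d [Od nzd Nd]] := pbasis_dense pb Kx.
exact: pN Nd.
Qed.

Lemma slopesP m : slopes sigma h L m <->
  exists2 U : {vspace E}, U != 0%VS & m = VL U `^ (\dim U)%:R^-1.
Proof.
split=> [[N [sN [x Nx nzx] ->]]|[U nzU ->]].
  have NE := sublatticeE sN; exists (Kspan N); last by rewrite /slope /vol_inter -NE.
  apply: contra nzx => /eqP K0; have [NK _] := Kspan_spec N.
  by have := NK x Nx; rewrite K0 memv0.
exists (inter L U); split; [exact: sublattice_inter | | by rewrite /slope rank_inter].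
have [_ _ dL] := lL; have [d nzd Ld] := dL (vpick U).
exists (d *: vpick U); last by rewrite scaler_eq0 negb_or nzd vpick0.
by split=> //; apply/rpredZ/memv_pick.
Qed.

Lemma dim_gt0R (U : {vspace E}) : U != 0%VS -> 0 < (\dim U)%:R :> R.
Proof. by rewrite ltr0n lt0n dimv_eq0. Qed.

Lemma mu_minE (c : R) (U0 : {vspace E}) : U0 != 0%VS ->
  ln (VL U0) = c * (\dim U0)%:R -> (forall U, c * (\dim U)%:R <= ln (VL U)) ->
  mu_min sigma h L = expR c.
Proof.
move=> nzU0 e0 le; have VE U : VL U `^ (\dim U)%:R^-1 = expR (ln (VL U) / (\dim U)%:R).
  by rewrite /powR gt_eqF ?vol_inter_gt0 // mulrC.
have mP : slopes sigma h L (expR c) /\ lbound (slopes sigma h L) (expR c).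
  split; first by apply/slopesP; exists U0; rewrite // VE e0 mulfK // gt_eqF ?dim_gt0R.
  move=> _ /slopesP[U nzU ->]; rewrite VE ler_expR ler_pdivlMr ?dim_gt0R //.
apply: xget_unique => // m [ms mb]; apply/eqP; rewrite eq_le.
by case: mP => cs cb; rewrite mb // cb.
Qed.

(** There is no nonzero sublattice, so [xget] returns its default. *)
Lemma mu_min_trivial : {:E}%VS = 0%VS -> mu_min sigma h L = 0.
Proof.
move=> E0; apply: xgetPN => m [[N [_ [x _ nzx] _]] _].
by move: nzx; rewrite -memv0 -E0 memvf.
Qed.

(** Since dim is modular and invariant under injective maps, ln vol - c dim is submodular and
    G-invariant, and [submodular_stable_ge0] applies. *)
Lemma stable_slope_bound (G : set 'End(E)) (c : R) :
  (forall g, G g -> [set g x | x in L] = L /\ forall p x y, h p (g x) (g y) = h p x y) ->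
  (forall U, stable G U -> c * (\dim U)%:R <= ln (VL U)) ->
  forall U, c * (\dim U)%:R <= ln (VL U).
Proof.
move=> GL st U; rewrite -subr_ge0.
pose phi U := ln (VL U) - c * (\dim U)%:R; rewrite -/(phi U).
apply: (@submodular_stable_ge0 R K E phi _ G) => [U1 U2|g U1 Gg|U1 sU1].
- rewrite /phi addrACA [leRHS]addrACA -!lnM ?posrE ?vol_inter_gt0 //.
  rewrite -!opprD -!mulrDr -!natrD [(\dim (U1 :&: U2) + _)%N]addnC dimv_sum_cap lerD2r.
  by rewrite ler_ln ?posrE ?mulr_gt0 ?vol_inter_gt0 //; apply: vol_inter_submodular.
- have [gL gh] := GL g Gg; have gI := isometry_inj places hpos gh.
  rewrite /phi (vol_inter_isometry places hpos _ lL gL gh) limg_dim_eq //.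
  by have /lker0P/eqP -> := gI; apply: capv0.
- by rewrite /phi subr_ge0; apply: st.
Qed.

(** Shows that the minimal slope is attained: the stable subspaces are the sums over subsets S of
    the components, so c is a minimum over finitely many S. *)
Lemma multiplicity_free_min (G : set 'End(E)) r : subgroup G (Aut_lattice L h) ->
  multiplicity_free G r -> {:E}%VS != 0%VS ->
  exists c (U0 : {vspace E}), [/\ U0 != 0%VS, ln (VL U0) = c * (\dim U0)%:R &
    forall U, c * (\dim U)%:R <= ln (VL U)].
Proof.
move=> [GA _ _ _] [W [Wirr Wniso Wfull Wdir]] nzE.
pose Q (S : {set 'I_r}) := (\sum_(i in S) W i)%VS != 0%VS.
pose f (S : {set 'I_r}) := ln (VL (\sum_(i in S) W i)%VS) / (\dim (\sum_(i in S) W i)%VS)%:R.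
have QT : Q [set: 'I_r]%SET.
  by rewrite /Q; under eq_bigl => i do rewrite inE; rewrite Wfull.
case: (arg_minP f QT) => S0 QS0 S0min.
exists (f S0), (\sum_(i in S0) W i)%VS; split=> //.
  by rewrite /f mulfVK // gt_eqF // dim_gt0R.
apply: (stable_slope_bound (G := G)) => [g /GA[]//|U sU].
have [S ->] := stable_sum Wirr Wniso Wfull Wdir sU.
have [->|QS] := eqVneq (\sum_(i in S) W i)%VS 0%VS.
  by rewrite dimv0 mulr0 vol_inter0 // ln1.
by have := S0min S QS; rewrite /f ler_pdivlMr // dim_gt0R.
Qed.

End Lattice.
End Slopes.

(** For s < 2 zero subspaces fill the missing places, so that one shape A ⊗ V1 + B ⊗ V2 serves all s
    <= 2. *)
Lemma two_components (K : fieldExtType rat) (F : vectType K) (H : set 'End(F)) s :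
  multiplicity_free H s -> (s <= 2)%N ->
  exists V1 V2 : {vspace F}, [/\ (V1 + V2 = fullv)%VS, (V1 :&: V2 = 0)%VS &
    forall X, stable H X -> exists p q : bool,
      X = ((if p then V1 else 0%VS) + (if q then V2 else 0%VS))%VS].
Proof.
move=> [U [Uirr Uniso Ufull Udir]] s2.
have st := stable_sum Uirr Uniso Ufull Udir.
case: s s2 U Uirr Uniso Ufull Udir st => [|[|[|//]]] _ U _ _ Ufull Udir st.
- exists 0%VS, 0%VS; split=> [||X /st[S ->]]; rewrite ?cap0v //.
    by rewrite addv0 -Ufull big_ord0.
  by exists false, false; rewrite addv0 big1 // => -[].
- exists (U ord0), 0%VS; split=> [||X /st[S ->]]; rewrite ?capv0 //.
    by rewrite addv0 -Ufull big_ord1.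
  by exists (ord0 \in S), false; rewrite addv0 big_mkcond big_ord1.
exists (U ord0), (U (lift ord0 ord0)); split=> [||X /st[S ->]].
- by rewrite -Ufull big_ord_recl big_ord1.
- move/directvP: Udir => /=; rewrite !big_ord_recl !big_ord0 addv0 addn0 -dimv_sum_cap => /eqP.
  by rewrite -[X in X == _]addn0 eqn_add2l eq_sym dimv_eq0 => /eqP.
by exists (ord0 \in S), (lift ord0 ord0 \in S); rewrite big_mkcond big_ord_recl big_ord1.
Qed.

(** * Exchange of the two factors *)

Section Flip.
Variables (K : fieldExtType rat) (E F T : vectType K) (t : E -> F -> T).

Definition flip (y : F) (x : E) := t x y.

Lemma flip_is_tensor : is_tensor t -> is_tensor flip.
Proof.
move=> tT; have [[tl tr] [I [J [e [f [[se sf iw sw] [ie if_]]]]]]] := tT.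
split; first by split=> [a x x' y|a x y y']; [apply: tr | apply: tl].
pose g (u : J * I) : I * J := (u.2, u.1).
have bg : bijective g by exists (fun u => (u.2, u.1)) => -[].
exists J, I, f, e; split=> //; split=> //; first exact: (indep_bij bg iw).
move=> x; have [c ->] := sw x; exists (c \o g).
by rewrite (reindex g) //; apply: onW_bij.
Qed.

Lemma tens_set_flip (L : set E) (M : set F) : tens_set flip M L = tens_set t L M.
Proof.
have sw (A B : eqType) (s : seq (A * B)) (a : set A) (b : set B) :
    (forall z, z \in s -> a z.1 /\ b z.2) ->
    forall z, z \in [seq (z.2, z.1) | z <- s] -> b z.1 /\ a z.2.
  by move=> sP _ /mapP[z /sP[az bz] ->].
apply/seteqP; split=> _ [s sP ->]; exists [seq (z.2, z.1) | z <- s]; rewrite ?big_map //.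
  exact: sw sP.
exact: sw sP.
Qed.

End Flip.

(** * Automorphisms acting on one factor *)

Section TensorGroups.
Context {R : realType} {K : fieldExtType rat} {P : finType}.
Variable sigma : P -> {rmorphism K -> R[i]}.
Variables (E F T : vectType K) (t : E -> F -> T).
Hypothesis tT : is_tensor t.
Variables (h : P -> E -> E -> R[i]) (h' : P -> F -> F -> R[i]) (hT : P -> T -> T -> R[i]).
Hypothesis hposT : forall p, pos_def_hermitian (sigma p) (hT p).
Hypothesis hTE : forall p x x' y y', hT p (t x y) (t x' y') = h p x x' * h' p y y'.
Variables (L : set E) (M : set F).

Lemma tens_aut (g : 'End(E)) (A : 'End(T)) : (forall x y, A (t x y) = t (g x) y) ->
  Aut_lattice L h g -> Aut_lattice (tens_set t L M) hT A.
Proof.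
move=> AE [gL gh]; split.
  apply/seteqP; split=> [_ [_ [s sP ->] <-]|_ [s sP ->]].
    rewrite linear_sum big_seq; apply: (big_ind (tens_set t L M)) => [|u v|z zs].
    - exact: tens_set0.
    - exact: tens_setD.
    have [Lz Mz] := sP z zs; rewrite /= AE; apply: tens_set_pure => //.
    by rewrite -gL; exists z.1.
  elim: s sP => [|z s IH] sP.
    by rewrite big_nil; exists 0; [apply: tens_set0 | rewrite linear0].
  have [|v Lv vE] := IH; first by move=> w ws; apply: sP; rewrite inE ws orbT.
  have [] := sP z; first by rewrite inE eqxx.
  rewrite -{1}gL => -[x Lx xz] Mz; exists (t x z.2 + v).
    by apply: tens_setD => //; apply: tens_set_pure.
  by rewrite linearD big_cons /= AE xz vE.
move=> p u v.
have sE (V : vectType K) : spans (fun i : 'I_(\dim {:V}) => (vbasis {:V})`_i).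
  by move=> x; apply: vbasis_spans; apply: memvf.
have [c ->] := tens_spans tT (sE E) (sE F) u; have [d ->] := tens_spans tT (sE E) (sE F) v.
have Asum (k : 'I_(\dim {:E}) * 'I_(\dim {:F}) -> K) :
    A (\sum_u k u *: t (vbasis {:E})`_u.1 (vbasis {:F})`_u.2) =
    \sum_u k u *: t (g (vbasis {:E})`_u.1) (vbasis {:F})`_u.2.
  by rewrite linear_sum; apply: eq_bigr => w _; rewrite linearZ /= AE.
rewrite !Asum !(herm_suml hposT); apply: eq_bigr => w _; congr (_ * _).
by rewrite !(herm_sumr hposT); apply: eq_bigr => w' _; rewrite !hTE gh.
Qed.

End TensorGroups.

(** * The slope bound for all subspaces of the tensor product *)

Section TensorSlopes.
Context {R : realType} {K : fieldExtType rat} {P : finType}.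
Variable sigma : P -> {rmorphism K -> R[i]}.
Hypothesis places : infinite_places sigma.
Variables (E F T : vectType K) (t : E -> F -> T).
Hypothesis tT : is_tensor t.
Variables (h : P -> E -> E -> R[i]) (h' : P -> F -> F -> R[i]) (hT : P -> T -> T -> R[i]).
Hypothesis hpos : forall p, pos_def_hermitian (sigma p) (h p).
Hypothesis hpos' : forall p, pos_def_hermitian (sigma p) (h' p).
Hypothesis hposT : forall p, pos_def_hermitian (sigma p) (hT p).
Hypothesis hTE : forall p x x' y y', hT p (t x y) (t x' y') = h p x x' * h' p y y'.
Variables (L : set E) (M : set F).
Hypotheses (lL : full_lattice L) (lM : full_lattice M).
Local Notation LT := (tens_set t L M).
Variables (G : set 'End(E)) (H : set 'End(F)) (r s : nat).
Hypotheses (GA : G `<=` Aut_lattice L h) (HA : H `<=` Aut_lattice M h').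
Hypotheses (mfE : multiplicity_free G r) (mfF : multiplicity_free H s) (s2 : (s <= 2)%N).
Variables (l m : R).
Hypothesis lmin : forall A, l * (\dim A)%:R <= ln (vol_inter sigma h L A).
Hypothesis mmin : forall B, m * (\dim B)%:R <= ln (vol_inter sigma h' M B).

Lemma tensor_slope_bound W : (l + m) * (\dim W)%:R <= ln (vol_inter sigma hT LT W).
Proof.
have [A AE] := tens_action tT; have [A' AE'] := tens_actionr tT.
pose GT := [set A g | g in G] `|` [set A' g | g in H].
have lT := full_tens tT lL lM.
apply: (stable_slope_bound places hposT lT (G := GT)) => [_ [[g Gg <-]|[g Hg <-]]|{}W sW].
- exact: (tens_aut tT hposT hTE M (AE g) (GA Gg)).
(* The action of H on the second factor is an action on the first factor of the flipped tensor
   product. *)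
- have hTE' p y y' x x' : hT p (flip t y x) (flip t y' x') = h' p y y' * h p x x'.
    by rewrite mulrC; apply: hTE.
  have := tens_aut (flip_is_tensor tT) hposT hTE' L (fun y x => AE' g x y) (HA Hg).
  by rewrite tens_set_flip.
have [U [Uirr Uniso Ufull Udir]] := mfE.
have sWG : stable [set A g | g in G] W by move=> g Gg; apply: sW; left.
have sWH : stable [set A' g | g in H] W by move=> g Gg; apply: sW; right.
have [X [XP WE]] := stable_tensor_structure tT Uirr Uniso Ufull Udir AE sWG.
have sX := stable_structure_stable AE' sWH XP.
have [V1 [V2 [V12 V0 VX]]] := two_components mfF s2.
have /choice[p pP] := fun i => VX (X i) (sX i); have /choice[q Xpq] := pP.
(* Each X_i is a sum of some of V1 and V2. Collecting the U_i by this choice gives A for V1 and B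
   for V2. *)
have tvsum (B : {vspace F}) (b : 'I_r -> bool) :
    (\sum_i tensv t (U i) (if b i then B else 0) = tensv t (\sum_(i | b i) U i) B)%VS.
  rewrite [in RHS]big_mkcond /=.
  transitivity (\sum_i tensv t (if b i then U i else 0) B)%VS.
    by apply: eq_bigr => i _; case: (b i) => //; rewrite (tensv0l tT) (tensv0r tT).
  by elim/big_rec2: _ => [|i B1 B2 _ ->]; rewrite ?(tensv0l tT) ?(tensvDl tT).
have {}WE : W = (tensv t (\sum_(i | p i) U i) V1 + tensv t (\sum_(i | q i) U i) V2)%VS.
  rewrite WE -!tvsum -big_split /=; apply: eq_bigr => i _.
  by rewrite {1}Xpq (tensvDr tT).
rewrite WE; apply: (vol_inter_tens_bound places tT hpos hpos' hposT hTE) => //.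
Qed.

End TensorSlopes.

(** * The coordinate model of the tensor product *)

Section ConcreteTensor.
Local Open Scope sesquilinear_scope.
Context {R : realType} {K : fieldExtType rat} {P : finType}.
Variable sigma : P -> {rmorphism K -> R[i]}.
Variables (E F : vectType K).

Lemma tens_coord (x : E) (y : F) u : (tens x y : 'rV_(_)) 0 (mxtens_index u) =
  coord (vbasis {:E}) u.1 x * coord (vbasis {:F}) u.2 y.
Proof. by rewrite !mxE mxtens_indexK. Qed.

Lemma tens_is_tensor : is_tensor (@tens K E F).
Proof.
have ext (v w : tensor E F) :
    (forall u, (v : 'rV_(_)) 0 (mxtens_index u) = (w : 'rV_(_)) 0 (mxtens_index u)) -> v = w.
  by move=> e; apply/rowP => k; rewrite -(mxtens_unindexK k).
have sE (V : vectType K) : spans (fun i : 'I_(\dim {:V}) => (vbasis {:V})`_i).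
  by move=> x; apply: vbasis_spans; apply: memvf.
have sumE (c : 'I_(\dim {:E}) * 'I_(\dim {:F}) -> K) u :
    (\sum_w c w *: (tens (vbasis {:E})`_w.1 (vbasis {:F})`_w.2 : 'rV_(_))) 0 (mxtens_index u) = c u.
  rewrite summxE (bigD1 u) //= big1 ?addr0 => [|w wu]; rewrite mxE tens_coord.
    by rewrite !coord_free ?(basis_free (vbasisP _)) // !eqxx !mulr1.
  rewrite !coord_free ?(basis_free (vbasisP _)) // -natrM mulnb.
  by move: wu; rewrite -pair_eqE /pair_eq /= => /negPf ->; rewrite mulr0.
split.
  split=> [a x x' y|a x y y']; apply: ext => u; rewrite [RHS]mxE [X in _ = X + _]mxE !tens_coord linearP.
    by rewrite mulrDl mulrA.
  by rewrite mulrDr mulrCA.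
exists 'I_(\dim {:E}), 'I_(\dim {:F}), (fun i : 'I_(\dim {:E}) => (vbasis {:E})`_i),
  (fun i : 'I_(\dim {:F}) => (vbasis {:F})`_i).
split; last by split; apply: vbasis_indep.
split=> // [c e u|x]; first by rewrite -sumE e mxE.
by exists (fun u => (x : 'rV_(_)) 0 (mxtens_index u)); apply: ext => u; rewrite sumE.
Qed.

Lemma posdef1 (C : numClosedFieldType) n : posdef (1%:M : 'M[C]_n).
Proof.
split=> [|c /rV0Pn[i nz]]; first by rewrite trmx1 map_mx1.
rewrite mulmx1 mxE (bigD1 i) //= ltr_pwDl //; first by rewrite !mxE mul_conjC_gt0.
by apply: sumr_ge0 => j _; rewrite !mxE mul_conjC_ge0.
Qed.

Lemma posdef_tens (C : numClosedFieldType) m n (A : 'M[C]_m) (B : 'M[C]_n) :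
  posdef A -> posdef B -> posdef (A *t B).
Proof.
move=> /posdef_factor[X uX ->] /posdef_factor[Y uY ->].
have -> : (X *m X^t*) *t (Y *m Y^t*) = (X *t Y) *m 1%:M *m (X *t Y)^t*.
  by rewrite mulmx1 trmx_tens map_mxT tensmx_mul.
apply: posdef_congr; last exact: posdef1.
apply/row_freeP; exists (invmx X *t invmx Y); rewrite tensmx_mul !mulmxV //.
apply/matrixP => i j; rewrite !mxE -natrM mulnb.
rewrite -(can_eq (@mxtens_unindexK m n)) -pair_eqE //.
Qed.

Variables (h : P -> E -> E -> R[i]) (h' : P -> F -> F -> R[i]).
Hypothesis hpos : forall p, pos_def_hermitian (sigma p) (h p).
Hypothesis hpos' : forall p, pos_def_hermitian (sigma p) (h' p).

Lemma tensor_form_pos p : pos_def_hermitian (sigma p) (tensor_form sigma h h' p).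
Proof.
pose Q := gram (h p) (@std_basis K E) *t gram (h' p) (@std_basis K F).
have pQ : posdef Q.
  by apply: posdef_tens; apply: (gram_posdef (sigma := sigma)) => //; apply: vbasis_indep.
have formE u v : tensor_form sigma h h' p u v =
    (map_mx (sigma p) u *m Q *m (map_mx (sigma p) v)^t*) 0 0.
  by rewrite /tensor_form map_trmx.
split=> [a x y z|x y|c nzc].
- rewrite !formE map_mxD map_mxZ !mulmxDl -!scalemxAl.
  by rewrite [LHS]mxE [X in X + _]mxE.
- rewrite !formE -[in LHS](proj1 pQ).
  have -> : map_mx (sigma p) y *m Q^t* *m (map_mx (sigma p) x)^t* =
      (map_mx (sigma p) x *m Q *m (map_mx (sigma p) y)^t*)^t*.
    by rewrite !adjM trmxCK mulmxA.
  by rewrite [LHS]mxE [in LHS]mxE.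
(* Positivity is required in [std_basis] of the row space, which need not be its canonical basis; S
   is the change of basis. *)
pose S : 'M[K]_(\dim {:tensor E F}, \dim {:E} * \dim {:F}) :=
  \matrix_i ((@std_basis K (tensor E F) i) : 'rV_(_)).
have -> : gram (tensor_form sigma h h' p) (@std_basis K (tensor E F)) =
    map_mx (sigma p) S *m Q *m (map_mx (sigma p) S)^t*.
  apply/matrixP => i j; rewrite mxE formE.
  have rS k : map_mx (sigma p) (std_basis k : tensor E F) = row k (map_mx (sigma p) S).
    by apply/rowP => x; rewrite !mxE.
  rewrite !rS -row_mul.
  by rewrite mxE [RHS]mxE; apply: eq_bigr => k _; rewrite !mxE.
have fS : row_free (map_mx (sigma p) S).
  rewrite row_free_map; apply: inj_row_free => v; rewrite mulmx_sum_row => v0.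
  apply/rowP => i; rewrite mxE; apply: (vbasis_indep (U := {:tensor E F})%VS (fun i => v 0 i)).
  by rewrite -[RHS]v0; apply: eq_bigr => j _; rewrite rowK.
have -> : (map_mx Num.conj c)^T = c^t* by rewrite map_trmx.
exact: (proj2 (posdef_congr fS pQ) c nzc).
Qed.

End ConcreteTensor.

Local Open Scope complex_scope.

Theorem theorem3p1 (R : realType) (K : fieldExtType rat)
    (K_TR_or_CM : @totally_real R K \/ @CM_field R K)
    (P : finType) (sigma : P -> {rmorphism K -> R[i]}) (places : infinite_places sigma)
    (E F : vectType K) (L : set E) (h : P -> E -> E -> R[i])
    (M : set F) (h' : P -> F -> F -> R[i])
    (latL : OK_lattice sigma L h) (latM : OK_lattice sigma M h')
    (G : set 'End(E)) (H : set 'End(F))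
    (sGL : subgroup G (Aut_lattice L h)) (sHM : subgroup H (Aut_lattice M h'))
    (r s : nat) (mfE : multiplicity_free G r) (mfF : multiplicity_free H s)
    (rs2 : (minn r s <= 2)%N) :
  mu_min sigma (tensor_form sigma h h') (tensor_lattice L M)
  = mu_min sigma h L * mu_min sigma h' M.
Proof.
have lL := OK_lattice_full latL; have lM := OK_lattice_full latM.
have [_ _ _ hpos] := latL; have [_ _ _ hpos'] := latM.
have tT := @tens_is_tensor K E F; have hposT := tensor_form_pos hpos hpos'.
have hTE := tensor_formE hpos hpos'.
have -> : tensor_lattice L M = tens_set (@tens K E F) L M by [].
have lT := full_tens tT lL lM.
have dT : \dim {:tensor E F} = (\dim {:E} * \dim {:F})%N by rewrite -(tensv_full tT) (dim_tensv tT).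
(* If a factor has rank 0, so has the tensor product, and both sides are the default value 0. *)
have [E0|nzE] := eqVneq {:E}%VS 0%VS.
  rewrite (mu_min_trivial sigma h L E0) mul0r mu_min_trivial //.
  by apply/eqP; rewrite -dimv_eq0 dT E0 dimv0.
have [F0|nzF] := eqVneq {:F}%VS 0%VS.
  rewrite (mu_min_trivial sigma h' M F0) mulr0 mu_min_trivial //.
  by apply/eqP; rewrite -dimv_eq0 dT F0 dimv0 muln0.
have [l [A [nzA lA lmin]]] := multiplicity_free_min places hpos lL sGL mfE nzE.
have [m [B [nzB mB mmin]]] := multiplicity_free_min places hpos' lM sHM mfF nzF.
have GA : G `<=` Aut_lattice L h by case: sGL.
have HA : H `<=` Aut_lattice M h' by case: sHM.
rewrite (mu_minE places hpos lL nzA lA lmin) (mu_minE places hpos' lM nzB mB mmin) -expRD.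
(* The bound is attained at A ⊗ B, where A and B attain the minima of the two factors. *)
apply: (mu_minE places hposT lT (U0 := tensv (@tens K E F) A B)).
- by rewrite -dimv_eq0 (dim_tensv tT) muln_eq0 !dimv_eq0 negb_or nzA.
- rewrite (ln_vol_inter_tens places tT hpos hpos' hposT hTE lL lM) lA mB (dim_tensv tT) natrM.
  move: (\dim A)%:R (\dim B)%:R => a b; by rewrite mulrDl !mulrA; congr (_ + _); rewrite mulrAC.
move=> W; have := rs2; rewrite geq_min => /orP[r2|s2]; last first.
  exact: (tensor_slope_bound places tT hpos hpos' hposT hTE lL lM GA HA mfE mfF s2).
(* When r <= 2 the two factors exchange roles. *)
have hTE' p y y' x x' : tensor_form sigma h h' p (flip (@tens K E F) y x) (flip (@tens K E F) y' x') =
    h' p y y' * h p x x' by rewrite mulrC; apply: hTE.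
have := tensor_slope_bound places (flip_is_tensor tT) hpos' hpos hposT hTE' lM lL HA GA mfF mfE r2 mmin lmin W.
by rewrite tens_set_flip addrC.
Qed.
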